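(* For every $k\in\mathbb N$, $\mathsf{Loop}[\log^k n,\ \mathsf{poly}(n),\ 1]=\mathsf{AC}^k$ and $\mathsf{Loop}[\log^k n,\ \mathsf{poly}(n),\ \log n]=\mathsf{TC}^k$.
   Context: $\mathsf{Loop}[T(n),d(n),s(n)]$ is the set of languages $\mathcal L:\{0,1\}^*\to\{0,1\}$ such that for every $n$ there is a deterministic Looped Transformer $M_n$ (non-uniform: a different model for each $n$) with embedding size $O(d(n))$ and $O(s(n))$ bits of precision whose final output token after $O(T(n))$ loop iterations equals $\mathcal L(x)$ for all $x\in\{0,1\}^n$. Looped Transformer: embeds the input position-wise, applies a fixed block of constantly many residual layers (non-causal multi-head softmax self-attention, then position-wise ReLU feedforward $W_2\mathrm{ReLU}(W_1z+b)$) repeatedly, and outputs $\arg\max$ of a linear output map at the last position. Finite precision: numbers with a sign bit and $s$-bit mantissa (no exponent), each arithmetic operation rounded to the nearest representable number, multi-term sums computed left to right with rounding after each addition. $\mathsf{AC}^k$ (resp. $\mathsf{TC}^k$, $\mathsf{NC}^k$): languages decided by non-uniform families of Boolean circuits of size $\mathsf{poly}(n)$ and depth $O(\log^k n)$ with unbounded fan-in AND/OR and NOT gates (resp. unbounded fan-in threshold/majority gates; bounded fan-in Boolean gates). *)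

(* Defs.v *)
From Stdlib Require Import Reals ZArith List Arith.
Import ListNotations.
Open Scope R_scope.

Definition lang := list bool -> bool.

Definition lg (n : nat) : nat := Nat.log2 n.

(* A circuit on n inputs is a list of gates in topological order.     *)
(* Wires 0..n-1 are the inputs; wire n+j is gate j.  Gate j may only   *)
(* read wires < n+j.  The output is the last wire.                     *)
Inductive gkind := GAnd | GOr | GNot | GMaj.

Record gate := mkGate { gk : gkind; gin : list nat }.

Definition count_true (bs : list bool) : nat := length (filter (fun b => b) bs).

Definition eval_gate (vals : list bool) (g : gate) : bool :=
  let bs := map (fun i => nth i vals false) (gin g) in
  match gk g with
  | GAnd => forallb (fun b => b) bs
  | GOr => existsb (fun b => b) bs
  | GNot => negb (nth 0 bs false)
  | GMaj => Nat.ltb (length bs) (2 * count_true bs)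
  end.

Definition eval_wires (x : list bool) (gs : list gate) : list bool :=
  fold_left (fun vals g => vals ++ [eval_gate vals g]) gs x.

Definition circ_out (gs : list gate) (x : list bool) : bool :=
  last (eval_wires x gs) false.

Definition depth_wires (n : nat) (gs : list gate) : list nat :=
  fold_left (fun ds g => ds ++ [S (list_max (map (fun i => nth i ds 0%nat) (gin g)))])
            gs (repeat 0%nat n).

Definition circ_depth (n : nat) (gs : list gate) : nat := list_max (depth_wires n gs).

Definition circ_size (gs : list gate) : nat := length gs.

Definition circ_wf (ok : gkind -> bool) (n : nat) (gs : list gate) : Prop :=
  forall j g, nth_error gs j = Some g ->
    ok (gk g) = true /\
    (forall i, In i (gin g) -> (i < n + j)%nat) /\
    (gk g = GNot -> length (gin g) = 1%nat).

Definition ac_ok (k : gkind) : bool :=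
  match k with GAnd | GOr | GNot => true | GMaj => false end.
Definition tc_ok (k : gkind) : bool := true.

Definition CircuitClass (ok : gkind -> bool) (k : nat) (L : lang) : Prop :=
  exists c n0 : nat, forall n : nat, exists gs : list gate,
    circ_wf ok n gs /\
    (forall x : list bool, length x = n -> circ_out gs x = L x) /\
    ((n0 <= n)%nat -> (circ_size gs <= n ^ c)%nat /\
                      (circ_depth n gs <= c * lg n ^ k)%nat).

Definition AC (k : nat) (L : lang) : Prop := CircuitClass ac_ok k L.
Definition TC (k : nat) (L : lang) : Prop := CircuitClass tc_ok k L.

(* Precision p: fixed point (no exponent), sign bit and a mantissa of  *)
(* 2p bits, p of them after the binary point: the representable        *)
(* numbers are z / 2^p with z an integer, |z| <= 2^(2p) - 1.           *)
(* Rounding = to the nearest representable number (ties upward),       *)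
(* saturating at the extreme representable values.                    *)
Definition scale (p : nat) : R := 2 ^ p.
Definition maxZ (p : nat) : Z := (2 ^ (2 * Z.of_nat p) - 1)%Z.

Definition representable (p : nat) (x : R) : Prop :=
  exists z : Z, (Z.abs z <= maxZ p)%Z /\ x = IZR z / scale p.

Definition rnd (p : nat) (x : R) : R :=
  let z := (up (x * scale p + / 2) - 1)%Z in   (* floor (x 2^p + 1/2) *)
  IZR (Z.max (- maxZ p) (Z.min (maxZ p) z)) / scale p.

Definition fadd (p : nat) (a b : R) : R := rnd p (a + b).
Definition fmul (p : nat) (a b : R) : R := rnd p (a * b).
Definition fdiv (p : nat) (a b : R) : R := rnd p (a / b).   (* / 0 = 0 in Stdlib *)
Definition fexp (p : nat) (a : R) : R := rnd p (exp a).

Definition fsum (p : nat) (l : list R) : R :=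
  match l with
  | [] => 0
  | a :: t => fold_left (fadd p) t a
  end.

Definition vec := nat -> R.
Definition mat := nat -> nat -> R.   (* W i j : row i, column j *)

Definition fdot (p m : nat) (u v : vec) : R :=
  fsum p (map (fun i => fmul p (u i) (v i)) (seq 0 m)).

Definition fmatvec (p m : nat) (W : mat) (v : vec) : vec :=
  fun i => fdot p m (W i) v.

(* one residual layer: multi-head non-causal softmax attention, then a
   ReLU feedforward W2 ReLU(W1 z + b); per-head matrices are d x d.   *)
Record Layer := mkLayer {
  WQ : nat -> mat; WK : nat -> mat; WV : nat -> mat; WO : nat -> mat; (* indexed by head *)
  W1 : mat; b1 : vec; W2 : mat }.

Record LT := mkLT {
  lt_d : nat;          (* embedding size *)
  lt_w : nat;          (* feedforward hidden width *)
  lt_H : nat;          (* number of heads *)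
  lt_prec : nat;
  lt_iters : nat;
  lt_emb : nat -> bool -> vec;  (* position-wise embedding (position, bit) *)
  lt_layers : list Layer;
  lt_out : mat                  (* linear output map, 2 x d *)
}.

Definition attention (p d H N : nat) (ly : Layer) (X : nat -> vec) : nat -> vec :=
  fun i =>
    let head (h : nat) : vec :=
      let q := fmatvec p d (WQ ly h) (X i) in
      let e (j : nat) := fexp p (fdot p d q (fmatvec p d (WK ly h) (X j))) in
      let Zs := fsum p (map e (seq 0 N)) in
      fun c => fsum p (map (fun j => fmul p (fdiv p (e j) Zs)
                                        (fmatvec p d (WV ly h) (X j) c)) (seq 0 N)) in
    fun c => fsum p (map (fun h => fmatvec p d (WO ly h) (head h) c) (seq 0 H)).

Definition attn_sub (p d H N : nat) (ly : Layer) (X : nat -> vec) : nat -> vec :=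
  fun i c => fadd p (X i c) (attention p d H N ly X i c).

Definition ffn_sub (p d w : nat) (ly : Layer) (X : nat -> vec) : nat -> vec :=
  fun i =>
    let x := X i in
    let hid : vec := fun r => Rmax 0 (fadd p (fmatvec p d (W1 ly) x r) (b1 ly r)) in
    fun c => fadd p (x c) (fmatvec p w (W2 ly) hid c).

Definition layer_apply (M : LT) (N : nat) (ly : Layer) (X : nat -> vec) : nat -> vec :=
  ffn_sub (lt_prec M) (lt_d M) (lt_w M) ly
          (attn_sub (lt_prec M) (lt_d M) (lt_H M) N ly X).

Definition block (M : LT) (N : nat) (X : nat -> vec) : nat -> vec :=
  fold_left (fun Y ly => layer_apply M N ly Y) (lt_layers M) X.

Definition lt_run (M : LT) (x : list bool) : bool :=
  let N := length x in
  let X0 : nat -> vec := fun i => lt_emb M i (nth i x false) in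
  let XT := Nat.iter (lt_iters M) (block M N) X0 in
  let o := fmatvec (lt_prec M) (lt_d M) (lt_out M) (XT (N - 1)%nat) in
  if Rlt_dec (o 0%nat) (o 1%nat) then true else false.

Definition lt_wf (M : LT) : Prop :=
  let p := lt_prec M in let d := lt_d M in let w := lt_w M in
  (forall i b c, (c < d)%nat -> representable p (lt_emb M i b c)) /\
  (forall o c, (o < 2)%nat -> (c < d)%nat -> representable p (lt_out M o c)) /\
  (forall ly, In ly (lt_layers M) ->
     (forall h r c, (h < lt_H M)%nat -> (r < d)%nat -> (c < d)%nat ->
        representable p (WQ ly h r c) /\ representable p (WK ly h r c) /\
        representable p (WV ly h r c) /\ representable p (WO ly h r c)) /\
     (forall r c, (r < w)%nat -> (c < d)%nat -> representable p (W1 ly r c)) /\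
     (forall r, (r < w)%nat -> representable p (b1 ly r)) /\
     (forall r c, (r < d)%nat -> (c < w)%nat -> representable p (W2 ly r c))).

Definition lt_decides (M : LT) (n : nat) (L : lang) : Prop :=
  lt_wf M /\ forall x : list bool, length x = n -> lt_run M x = L x.

Definition Loop (T D S : nat -> nat) (L : lang) : Prop :=
  exists c n0 : nat, forall n : nat, exists M : LT,
    lt_decides M n L /\
    ((n0 <= n)%nat ->
       (lt_d M <= c * D n)%nat /\ (lt_w M <= c * D n)%nat /\
       (lt_H M <= c)%nat /\ (length (lt_layers M) <= c)%nat /\
       (lt_iters M <= c * T n)%nat /\ (lt_prec M <= c * S n)%nat).

Definition LoopPoly (T S : nat -> nat) (L : lang) : Prop :=
  exists e : nat, Loop T (fun n => n ^ e)%nat S L.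

(* Main.v *)
Require Import Defs.
From Stdlib Require Import Reals ZArith List Arith Lia Lra Bool.
Import ListNotations.

(** A rounded sum of grid numbers is an integer walk clamped to [-M, M], and every other operation of
    a layer is a table lookup on boundedly many bits (for precision O(1)) or polynomially many bits
    (for precision O(log n)).  Bounded clamped walks decompose into a cascade of flip-flops, hence are
    in AC^0; in general the last time the walk is saturated from below is found by thresholds, hence
    clamped sums are in TC^0.  So one loop iteration costs constant depth.

    Conversely, uniform attention copies all input bits to every position (saturation of the softmax
    normalizer keeps its weights away from 0), and the feedforward layer updates all gates of the
    circuit at once.  Unbounded NOR tolerates saturation; majority needs log-size precision, and a fan-in
    that is polynomial counted with multiplicity.  Repeated inputs may give a majority gate weights of
    arbitrary size; these are first reduced to polynomially many bits by Diophantine approximation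
    (Frank and Tardos), and the resulting sum is compared by carry lookahead on radix-K column sums. *)

(** * Fixed-point rounding *)

(** Saturating addition is not associative, so a sum cannot be split into a tree of partial sums or
    replaced by one count; the whole clamped walk has to be analysed. Numbers are kept in one-hot
    form, one bit per grid value. At precision O(log n) there are polynomially many grid values, so
    any operation on two numbers, [exp] and division included, is a table of constant depth, and no
    numerical analysis enters. In the other direction constant precision is the obstacle: an
    unsaturated weight 1/n would round to 0, and an amplified input bit is known only to be 0 or at
    least 1. Such values are read by NOR alone, while node values are rewritten as exact 0 or 1 in
    every loop. Circuit size counts gates, not wires, so [gin] may repeat an input without limit.
    AND and OR do not notice, but a majority gate acquires an unbounded integer weight. Even the
    polynomially many bits that remain after the reduction of weights exceed O(log n) precision,
    hence such a gate is expanded into a circuit of constant depth whose fan-in is polynomial. *)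

Definition clampZ (p : nat) (z : Z) : Z := Z.max (- maxZ p) (Z.min (maxZ p) z).
Definition gridR (p : nat) (z : Z) : R := IZR z / scale p.
Definition toZ (p : nat) (x : R) : Z := (up (x * scale p) - 1)%Z.

Lemma scale_pos p : 0 < scale p.
Proof. unfold scale. apply pow_lt. lra. Qed.

Lemma scale_IZR p : scale p = IZR (2 ^ Z.of_nat p).
Proof. unfold scale. rewrite pow_IZR. reflexivity. Qed.

Lemma maxZ_nonneg p : (0 <= maxZ p)%Z.
Proof.
  unfold maxZ. assert (0 < 2 ^ (2 * Z.of_nat p))%Z by (apply Z.pow_pos_nonneg; lia). lia.
Qed.

Lemma clampZ_id p z : (Z.abs z <= maxZ p)%Z -> clampZ p z = z.
Proof. unfold clampZ. lia. Qed.

Lemma grid_scale p z : gridR p z * scale p = IZR z.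
Proof. unfold gridR. pose proof (scale_pos p). field. lra. Qed.

Lemma up_IZR_plus z (e : R) : 0 <= e < 1 -> up (IZR z + e) = (z + 1)%Z.
Proof.
  intros He. symmetry. apply tech_up; rewrite plus_IZR; lra.
Qed.

Lemma toZ_grid p z : toZ p (gridR p z) = z.
Proof.
  unfold toZ. rewrite grid_scale. replace (IZR z) with (IZR z + 0) by lra.
  rewrite up_IZR_plus by lra. lia.
Qed.

Lemma rnd_grid p z : rnd p (gridR p z) = gridR p (clampZ p z).
Proof.
  unfold rnd. rewrite grid_scale, up_IZR_plus by lra.
  replace (z + 1 - 1)%Z with z by lia. reflexivity.
Qed.

Lemma representable_grid p z : (Z.abs z <= maxZ p)%Z -> representable p (gridR p z).
Proof. intros H. exists z. split; [exact H | reflexivity]. Qed.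

Lemma representable_toZ p x : representable p x -> x = gridR p (toZ p x).
Proof.
  intros (z & Hz & ->). change (IZR z / scale p) with (gridR p z). now rewrite toZ_grid.
Qed.

Lemma toZ_bound p x : representable p x -> (Z.abs (toZ p x) <= maxZ p)%Z.
Proof.
  intros (z & Hz & ->). change (IZR z / scale p) with (gridR p z). now rewrite toZ_grid.
Qed.

Lemma representable_rnd p x : representable p (rnd p x).
Proof.
  unfold rnd. eexists. split; [|reflexivity].
  pose proof (maxZ_nonneg p). lia.
Qed.

Lemma rnd_id p x : representable p x -> rnd p x = x.
Proof.
  intros (z & Hz & ->). change (IZR z / scale p) with (gridR p z).
  rewrite rnd_grid, clampZ_id; auto.
Qed.

Lemma up_mono x y : x <= y -> (up x <= up y)%Z.
Proof.
  intros H. destruct (archimed x) as [H1 H2]. destruct (archimed y) as [H3 H4].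
  assert (IZR (up x) < IZR (up y + 1)) by (rewrite plus_IZR; lra).
  apply lt_IZR in H0. lia.
Qed.

(** Combined with [rnd_id], monotonicity carries an inequality against a representable number
    through any rounding, saturated or not; the attention weight and the NOR rows are estimated in
    this way. *)
Lemma rnd_mono p x y : x <= y -> rnd p x <= rnd p y.
Proof.
  intros H. pose proof (scale_pos p). unfold rnd, Rdiv.
  apply Rmult_le_compat_r; [left; now apply Rinv_0_lt_compat|].
  apply IZR_le.
  assert (up (x * scale p + / 2) <= up (y * scale p + / 2))%Z.
  { apply up_mono. apply Rplus_le_compat_r, Rmult_le_compat_r; lra. }
  lia.
Qed.

Lemma representable_0 p : representable p 0.
Proof.
  exists 0%Z. split; [pose proof (maxZ_nonneg p); simpl; lia | unfold Rdiv; lra].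
Qed.

Lemma grid_plus p a b : gridR p a + gridR p b = gridR p (a + b).
Proof. unfold gridR. rewrite plus_IZR. pose proof (scale_pos p). field. lra. Qed.

Lemma fadd_grid p a b : fadd p (gridR p a) (gridR p b) = gridR p (clampZ p (a + b)).
Proof. unfold fadd. now rewrite grid_plus, rnd_grid. Qed.

Lemma representable_opp p x : representable p x -> representable p (- x).
Proof.
  intros (z & Hz & ->). exists (- z)%Z. split; [lia|].
  rewrite opp_IZR. pose proof (scale_pos p). field. lra.
Qed.

Lemma representable_relu p x : representable p x -> representable p (Rmax 0 x).
Proof.
  intros H. unfold Rmax. destruct (Rle_dec 0 x); [exact H | apply representable_0].
Qed.

(** * Rounded sums from left to right *)

Fixpoint fsumf (p : nat) (f : nat -> R) (n : nat) : R :=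
  match n with O => 0 | S m => fadd p (fsumf p f m) (f m) end.

Lemma fadd_0_l p x : representable p x -> fadd p 0 x = x.
Proof. intros H. unfold fadd. rewrite Rplus_0_l. now apply rnd_id. Qed.

Lemma fadd_0_r p x : representable p x -> fadd p x 0 = x.
Proof. intros H. unfold fadd. rewrite Rplus_0_r. now apply rnd_id. Qed.

(** [fsum] takes its first term unrounded. Starting from 0 rounds that term once more, which is
    harmless when it is representable. *)
Lemma fsum_seq p f n :
  representable p (f O) -> fsum p (map f (seq 0 n)) = fsumf p f n.
Proof.
  intros H0.
  assert (forall l, fsum p (f O :: l) = fold_left (fadd p) (f O :: l) 0) as E.
  { intros l. cbn. now rewrite fadd_0_l. }
  assert (forall m, fold_left (fadd p) (map f (seq 0 m)) 0 = fsumf p f m) as F.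
  { induction m as [|m IH]; [reflexivity|].
    rewrite seq_S, map_app, fold_left_app, IH. reflexivity. }
  destruct n as [|n]; [reflexivity|].
  rewrite <- F. apply E.
Qed.

Lemma representable_fsumf p f n : representable p (fsumf p f n).
Proof.
  destruct n; simpl; [apply representable_0 | apply representable_rnd].
Qed.

(** Invariant principle: since rounded sums cannot be rearranged, a guessed closed form of the
    partial sums is checked one addition at a time. *)
Lemma fsumf_prefix p f (S : nat -> R) n :
  S O = 0 -> (forall r, (r < n)%nat -> fadd p (S r) (f r) = S (Datatypes.S r)) ->
  fsumf p f n = S n.
Proof.
  intros H0. induction n as [|n IH]; intros H; simpl; [auto|].
  rewrite IH by (intros; apply H; lia). apply H. lia.
Qed.

Lemma fsumf_ext p f g n : (forall r, (r < n)%nat -> f r = g r) -> fsumf p f n = fsumf p g n.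
Proof.
  induction n as [|n IH]; intros H; simpl; [reflexivity|].
  rewrite IH by (intros; apply H; lia). now rewrite H by lia.
Qed.

Lemma fsumf_zero p f n : (forall r, (r < n)%nat -> f r = 0) -> fsumf p f n = 0.
Proof.
  intros H. rewrite (fsumf_prefix p f (fun _ => 0)); auto.
  intros r Hr. rewrite H by auto. apply fadd_0_r, representable_0.
Qed.

Lemma fsumf_single p f n i :
  (i < n)%nat -> representable p (f i) ->
  (forall r, (r < n)%nat -> r <> i -> f r = 0) -> fsumf p f n = f i.
Proof.
  intros Hi Hr H.
  rewrite (fsumf_prefix p f (fun r => if le_lt_dec r i then 0 else f i)).
  - destruct (le_lt_dec n i); [lia | reflexivity].
  - destruct (le_lt_dec 0 i); [reflexivity | lia].
  - intros r Hrn. destruct (le_lt_dec r i) as [H1|H1], (le_lt_dec (S r) i) as [H2|H2]; try lia.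
    + rewrite H by lia. apply fadd_0_r, representable_0.
    + replace r with i by lia. now apply fadd_0_l.
    + rewrite (H r) by lia. now apply fadd_0_r.
Qed.

Lemma representable_fmul p x y : representable p (fmul p x y).
Proof. apply representable_rnd. Qed.

Lemma fdot_fsumf p m u v :
  fdot p m u v = fsumf p (fun i => fmul p (u i) (v i)) m.
Proof. unfold fdot. apply fsum_seq with (f := fun i => fmul p (u i) (v i)), representable_fmul. Qed.

(* Fixed-point addition on the grid only saturates, so a rounded sum is a clamped integer walk. *)
Fixpoint csum (M : Z) (z : nat -> Z) (n : nat) : Z :=
  match n with O => 0%Z | S m => Z.max (- M) (Z.min M (csum M z m + z m)) end.

Lemma fsumf_csum p f n :
  (forall r, (r < n)%nat -> representable p (f r)) ->
  fsumf p f n = gridR p (csum (maxZ p) (fun r => toZ p (f r)) n).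
Proof.
  induction n as [|n IH]; intros H; simpl.
  - unfold gridR, Rdiv. now rewrite Rmult_0_l.
  - rewrite IH by (intros; apply H; lia).
    rewrite (representable_toZ p (f n)) at 1 by (apply H; lia).
    apply fadd_grid.
Qed.

(** * Boolean expressions and circuits *)

Local Open Scope nat_scope.

(** Trees without sharing, so that sizes and depths compose freely. Sharing happens only between
    stages, where the variables of an expression stand for wires already built. *)
Inductive expr := EVar (i : nat) | EGate (k : gkind) (l : list expr).

Fixpoint esize (e : expr) : nat :=
  match e with EVar _ => 1 | EGate _ l => S (list_sum (map esize l)) end.

Fixpoint edepth (e : expr) : nat :=
  match e with EVar _ => 0 | EGate _ l => S (list_max (map edepth l)) end.

Definition gate_fn (k : gkind) (bs : list bool) : bool :=
  match k with
  | GAnd => forallb (fun b => b) bs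
  | GOr => existsb (fun b => b) bs
  | GNot => negb (nth 0 bs false)
  | GMaj => Nat.ltb (length bs) (2 * count_true bs)
  end.

Fixpoint eeval (v : nat -> bool) (e : expr) : bool :=
  match e with EVar i => v i | EGate k l => gate_fn k (map (eeval v) l) end.

Inductive ewf (ok : gkind -> bool) (V : nat -> Prop) : expr -> Prop :=
| ewf_var i : V i -> ewf ok V (EVar i)
| ewf_gate k l : ok k = true -> (k = GNot -> length l = 1) ->
    (forall e, In e l -> ewf ok V e) -> ewf ok V (EGate k l).

Lemma expr_nested_ind (P : expr -> Prop) :
  (forall i, P (EVar i)) ->
  (forall k l, (forall e, In e l -> P e) -> P (EGate k l)) -> forall e, P e.
Proof.
  intros Hv Hg. fix IH 1. intros [i|k l]; [apply Hv|].
  apply Hg. induction l as [|a l IHl]; [intros e []|].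
  intros e [<-|He]; [apply IH | exact (IHl e He)].
Qed.

Lemma esize_pos e : 1 <= esize e.
Proof. destruct e; simpl; lia. Qed.

(** * Values and depths of wires *)

Definition wire (gs : list gate) (x : list bool) (w : nat) : bool :=
  nth w (eval_wires x gs) false.
Definition wdepth (n : nat) (gs : list gate) (w : nat) : nat :=
  nth w (depth_wires n gs) 0.

Lemma eval_wires_snoc x gs g :
  eval_wires x (gs ++ [g]) = eval_wires x gs ++ [eval_gate (eval_wires x gs) g].
Proof. unfold eval_wires. now rewrite fold_left_app. Qed.

Lemma depth_wires_snoc n gs g :
  depth_wires n (gs ++ [g]) =
  depth_wires n gs ++ [S (list_max (map (wdepth n gs) (gin g)))].
Proof. unfold depth_wires at 1. now rewrite fold_left_app. Qed.

Lemma eval_wires_length x gs : length (eval_wires x gs) = length x + length gs.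
Proof.
  induction gs as [|g gs IH] using rev_ind; [simpl; lia|].
  rewrite eval_wires_snoc, !length_app, IH. simpl. lia.
Qed.

Lemma depth_wires_length n gs : length (depth_wires n gs) = n + length gs.
Proof.
  induction gs as [|g gs IH] using rev_ind; [unfold depth_wires; simpl; rewrite repeat_length; lia|].
  rewrite depth_wires_snoc, !length_app, IH. simpl. lia.
Qed.

Lemma wire_app gs t x w : w < length x + length gs -> wire (gs ++ t) x w = wire gs x w.
Proof.
  intros H. induction t as [|g t IH] using rev_ind; [now rewrite app_nil_r|].
  rewrite app_assoc. unfold wire at 1. rewrite eval_wires_snoc, app_nth1.
  - exact IH.
  - rewrite eval_wires_length, length_app. lia.
Qed.

Lemma wdepth_app n gs t w : w < n + length gs -> wdepth n (gs ++ t) w = wdepth n gs w.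
Proof.
  intros H. induction t as [|g t IH] using rev_ind; [now rewrite app_nil_r|].
  rewrite app_assoc. unfold wdepth at 1. rewrite depth_wires_snoc, app_nth1.
  - exact IH.
  - rewrite depth_wires_length, length_app. lia.
Qed.

Lemma wire_snoc gs g x :
  wire (gs ++ [g]) x (length x + length gs) = gate_fn (gk g) (map (wire gs x) (gin g)).
Proof.
  unfold wire at 1. rewrite eval_wires_snoc, app_nth2; rewrite eval_wires_length; [|lia].
  rewrite Nat.sub_diag. reflexivity.
Qed.

Lemma wdepth_snoc n gs g :
  wdepth n (gs ++ [g]) (n + length gs) = S (list_max (map (wdepth n gs) (gin g))).
Proof.
  unfold wdepth at 1. rewrite depth_wires_snoc, app_nth2; rewrite depth_wires_length; [|lia].
  now rewrite Nat.sub_diag.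
Qed.

Lemma wire_input gs x w : w < length x -> wire gs x w = nth w x false.
Proof. intros H. change gs with ([] ++ gs). rewrite wire_app; [reflexivity | simpl; lia]. Qed.

Lemma wdepth_input n gs w : w < n -> wdepth n gs w = 0.
Proof.
  intros H. change gs with ([] ++ gs). rewrite wdepth_app; [|simpl; lia].
  unfold wdepth. simpl. apply nth_repeat_lt. exact H.
Qed.

Lemma wdepth_out n gs w : n + length gs <= w -> wdepth n gs w = 0.
Proof. intros H. unfold wdepth. apply nth_overflow. now rewrite depth_wires_length. Qed.

Lemma list_max_le_iff l m : list_max l <= m <-> (forall a, In a l -> a <= m).
Proof. rewrite list_max_le, Forall_forall. reflexivity. Qed.

Lemma list_max_in l a : In a l -> a <= list_max l.
Proof. now apply list_max_le_iff. Qed.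

Lemma circ_depth_le n gs D : (forall w, wdepth n gs w <= D) -> circ_depth n gs <= D.
Proof.
  intros H. unfold circ_depth. apply list_max_le_iff. intros a Ha.
  destruct (In_nth _ _ 0 Ha) as (w & _ & <-). apply H.
Qed.

Lemma wdepth_le_circ n gs w : wdepth n gs w <= circ_depth n gs.
Proof.
  unfold wdepth, circ_depth. destruct (nth_in_or_default w (depth_wires n gs) 0) as [H|H].
  - now apply list_max_in.
  - rewrite H. lia.
Qed.

Lemma circ_out_wire gs x :
  circ_out gs x = wire gs x (length x + length gs - 1).
Proof.
  unfold circ_out, wire. rewrite <- eval_wires_length.
  generalize (eval_wires x gs) as l. intros l.
  induction l as [|a l IH] using rev_ind; [reflexivity|].
  rewrite last_last, length_app, app_nth2; simpl; [|lia].
  now replace (length l + 1 - 1 - length l) with 0 by lia.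
Qed.

Lemma circ_wf_nil ok n : circ_wf ok n [].
Proof. intros [|j] g H; discriminate. Qed.

Lemma circ_wf_snoc ok n gs g :
  circ_wf ok n gs -> ok (gk g) = true ->
  (forall i, In i (gin g) -> i < n + length gs) ->
  (gk g = GNot -> length (gin g) = 1) -> circ_wf ok n (gs ++ [g]).
Proof.
  intros Hwf H1 H2 H3 j g' Hj. destruct (lt_dec j (length gs)) as [Hl|Hl].
  - rewrite nth_error_app1 in Hj by lia. now apply Hwf.
  - rewrite nth_error_app2 in Hj by lia.
    destruct (j - length gs) as [|q] eqn:E; [|destruct q; discriminate].
    injection Hj as <-. replace j with (length gs) by lia. auto.
Qed.

Lemma circ_wf_prefix ok n gs t : circ_wf ok n (gs ++ t) -> circ_wf ok n gs.
Proof.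
  intros H j g Hj. apply H. rewrite nth_error_app1; auto.
  apply nth_error_Some. congruence.
Qed.

(** The depth bound concerns the added wires only; old wires keep theirs. The last clause bounds the
    fan-in with repetitions, which later bounds the weights that majority gates turn into. *)
Definition extends (ok : gkind -> bool) (n : nat) (gs gs' : list gate) (sz D : nat) : Prop :=
  exists t, gs' = gs ++ t /\ circ_wf ok n gs' /\ length t <= sz /\
    (forall w, n + length gs <= w -> wdepth n gs' w <= D) /\
    (forall g, In g t -> length (gin g) <= sz).

Lemma extends_refl ok n gs sz D : circ_wf ok n gs -> extends ok n gs gs sz D.
Proof.
  intros H. exists []. rewrite app_nil_r. split; [reflexivity|]. split; [exact H|].
  split; [simpl; lia|]. split; [|intros g []].
  intros w Hw. rewrite wdepth_out; lia.
Qed.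

Lemma extends_trans ok n g1 g2 g3 s1 s2 s D1 D2 D :
  extends ok n g1 g2 s1 D1 -> extends ok n g2 g3 s2 D2 ->
  s1 + s2 <= s -> D1 <= D -> D2 <= D -> extends ok n g1 g3 s D.
Proof.
  intros (t1 & -> & W1 & L1 & P1 & G1) (t2 & -> & W2 & L2 & P2 & G2) Hs H1 H2.
  exists (t1 ++ t2). rewrite app_assoc. split; [reflexivity|]. split; [exact W2|].
  rewrite length_app. split; [lia|]. split.
  - intros w Hw. destruct (lt_dec w (n + length (g1 ++ t1))) as [Hl|Hl].
    + rewrite wdepth_app by exact Hl. specialize (P1 w Hw). lia.
    + specialize (P2 w ltac:(lia)). lia.
  - intros g Hg. apply in_app_or in Hg. destruct Hg as [Hg|Hg];
      [specialize (G1 g Hg) | specialize (G2 g Hg)]; lia.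
Qed.

Lemma extends_wf ok n gs gs' s D : extends ok n gs gs' s D -> circ_wf ok n gs'.
Proof. intros (t & _ & H & _). exact H. Qed.

Lemma extends_length ok n gs gs' s D :
  extends ok n gs gs' s D -> length gs <= length gs' <= length gs + s.
Proof. intros (t & -> & _ & H & _). rewrite length_app. lia. Qed.

Lemma extends_wire ok n gs gs' s D x w :
  extends ok n gs gs' s D -> length x = n -> w < n + length gs -> wire gs' x w = wire gs x w.
Proof. intros (t & -> & _) Hx Hw. apply wire_app. lia. Qed.

Lemma extends_wdepth ok n gs gs' s D w :
  extends ok n gs gs' s D -> w < n + length gs -> wdepth n gs' w = wdepth n gs w.
Proof. intros (t & -> & _) Hw. now apply wdepth_app. Qed.

Lemma eeval_ext ok V v v' e :
  ewf ok V e -> (forall i, V i -> v i = v' i) -> eeval v e = eeval v' e.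
Proof.
  intros He Hv. induction e as [i|k l IH] using expr_nested_ind; inversion He; subst; simpl; auto.
  f_equal. apply map_ext_in. auto.
Qed.

(** * Compiling expressions onto existing wires *)

Definition compiled ok n gs (pi : nat -> nat) D e gs' w : Prop :=
  extends ok n gs gs' (esize e) (D + edepth e) /\ w < n + length gs' /\
  wdepth n gs' w <= D + edepth e /\
  forall x, length x = n -> wire gs' x w = eeval (fun i => wire gs x (pi i)) e.

Definition compiled_list ok n gs (pi : nat -> nat) D es gs' ws : Prop :=
  extends ok n gs gs' (list_sum (map esize es)) (D + list_max (map edepth es)) /\
  length ws = length es /\
  (forall w, In w ws -> w < n + length gs' /\
     wdepth n gs' w <= D + list_max (map edepth es)) /\
  forall x, length x = n -> map (wire gs' x) ws = map (eeval (fun i => wire gs x (pi i))) es.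

Definition env_ok n gs (V : nat -> Prop) (pi : nat -> nat) D : Prop :=
  forall i, V i -> pi i < n + length gs /\ wdepth n gs (pi i) <= D.

Lemma env_ok_extends ok n gs gs' s D' V pi D :
  extends ok n gs gs' s D' -> env_ok n gs V pi D -> env_ok n gs' V pi D.
Proof.
  intros HE H i Hi. destruct (H i Hi) as [H1 H2]. split.
  - apply extends_length in HE. lia.
  - erewrite extends_wdepth; eauto.
Qed.

(** Compilability of the members is a hypothesis, so that the lemma serves inside the nested
    induction over expressions as well as after it. *)
Lemma compile_list_of ok V n D pi es :
  (forall e, In e es -> ewf ok V e) ->
  (forall e, In e es -> forall gs, circ_wf ok n gs -> env_ok n gs V pi D ->
     exists gs' w, compiled ok n gs pi D e gs' w) ->
  forall gs, circ_wf ok n gs -> env_ok n gs V pi D ->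
  exists gs' ws, compiled_list ok n gs pi D es gs' ws.
Proof.
  intros Hewf. induction es as [|e es IH]; intros Hc gs Hwf Henv.
  - exists gs, []. split; [now apply extends_refl|]. repeat split; easy.
  - destruct (Hc e (or_introl eq_refl) gs Hwf Henv) as (g1 & w & E1 & Hw & Hd & Hv).
    destruct (IH (fun e' H => Hewf e' (or_intror H)) (fun e' H => Hc e' (or_intror H)) g1)
      as (g2 & ws & E2 & Hl & Hws & Hv2).
    + eapply extends_wf; eauto.
    + eapply env_ok_extends; eauto.
    + exists g2, (w :: ws). split; [|split; [|split]].
      * eapply extends_trans; eauto; simpl; lia.
      * simpl. lia.
      * intros w' [<-|Hw'].
        -- split; [apply extends_length in E2; lia|].
           erewrite extends_wdepth by eauto. simpl. lia.
        -- destruct (Hws w' Hw'). split; simpl; lia.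
      * intros x Hx. simpl. f_equal.
        -- erewrite extends_wire by eauto. auto.
        -- rewrite Hv2 by auto. apply map_ext_in. intros e' He'.
           eapply eeval_ext; [apply Hewf; now right|].
           intros i Hi. destruct (Henv i Hi). eapply extends_wire; eauto.
Qed.

Lemma list_sum_esize_length es : length es <= list_sum (map esize es).
Proof. induction es as [|e es IH]; simpl; [lia|]. pose proof (esize_pos e). lia. Qed.

(** The top gate is appended last, so its value sits on the wire that [circ_out] reads. Wrapping any
    expression in a one-input [GOr] therefore makes it the output. *)
Lemma compile_expr_last ok V n D pi k l gs :
  ewf ok V (EGate k l) -> circ_wf ok n gs -> env_ok n gs V pi D ->
  (exists gs1 ws, compiled_list ok n gs pi D l gs1 ws) ->
  exists gs', compiled ok n gs pi D (EGate k l) gs' (n + length gs' - 1) /\ 1 <= length gs'.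
Proof.
  intros He Hwf Henv (gs1 & ws & E & Hlen & Hws & Hv). inversion He as [|k' l' Hok Hn Hl]; subst.
  exists (gs1 ++ [mkGate k ws]).
  assert (Hd : wdepth n (gs1 ++ [mkGate k ws]) (n + length gs1) <= D + edepth (EGate k l)).
  { rewrite wdepth_snoc. simpl.
    cut (list_max (map (wdepth n gs1) ws) <= D + list_max (map edepth l)); [lia|].
    apply list_max_le_iff. intros a Ha. apply in_map_iff in Ha.
    destruct Ha as (w & <- & Hw). now apply Hws. }
  pose proof (list_sum_esize_length l) as Hll.
  assert (E' : extends ok n gs1 (gs1 ++ [mkGate k ws])
                 (S (length l)) (D + edepth (EGate k l))).
  { exists [mkGate k ws]. split; [reflexivity|]. split; [|split; [simpl; lia|split]].
    - apply circ_wf_snoc; simpl; auto.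
      + eapply extends_wf; eauto.
      + intros i Hi. now apply Hws.
      + intros Hk. rewrite Hlen. auto.
    - intros w Hw. destruct (Nat.eq_dec w (n + length gs1)) as [->|Hne]; [exact Hd|].
      rewrite wdepth_out; [lia|]. rewrite length_app. simpl. lia.
    - intros g [<-|[]]. simpl. lia. }
  rewrite length_app. simpl length.
  replace (n + (length gs1 + 1) - 1) with (n + length gs1) by lia.
  split; [|lia]. split; [|split; [|split]].
  - destruct E as (t & -> & W & L & P & G). destruct E' as (t' & Et & W' & L' & P' & G').
    apply app_inv_head in Et. subst t'.
    exists (t ++ [mkGate k ws]). rewrite app_assoc. split; [reflexivity|]. split; [exact W'|].
    split; [rewrite length_app; simpl; lia|]. split.
    + intros w Hw. destruct (lt_dec w (n + length (gs ++ t))) as [Hlt|Hlt].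
      * rewrite wdepth_app by auto. specialize (P w Hw). simpl. lia.
      * apply P'. lia.
    + intros g Hg. apply in_app_or in Hg. simpl. destruct Hg as [Hg|[<-|[]]].
      * specialize (G g Hg). lia.
      * simpl. lia.
  - rewrite length_app. simpl. lia.
  - exact Hd.
  - intros x Hx. rewrite <- Hx, wire_snoc. simpl. now rewrite Hv.
Qed.

Lemma compile_expr ok V n D pi e :
  ewf ok V e -> forall gs, circ_wf ok n gs -> env_ok n gs V pi D ->
  exists gs' w, compiled ok n gs pi D e gs' w.
Proof.
  induction e as [i|k l IH] using expr_nested_ind; intros He gs Hwf Henv.
  - inversion He; subst. destruct (Henv i) as [H1 H2]; auto.
    exists gs, (pi i). split; [now apply extends_refl|]. simpl. repeat split; auto; lia.
  - inversion He as [|k' l' Hok Hn Hl]; subst.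
    destruct (compile_expr_last ok V n D pi k l gs He Hwf Henv) as (gs' & H & _); [|eauto].
    eapply compile_list_of; eauto.
Qed.

Lemma compile_list ok V n D pi es :
  (forall e, In e es -> ewf ok V e) -> forall gs, circ_wf ok n gs -> env_ok n gs V pi D ->
  exists gs' ws, compiled_list ok n gs pi D es gs' ws.
Proof. intros H. eapply compile_list_of; eauto. intros. eapply compile_expr; eauto. Qed.

Lemma compile_last ok V n D pi k l gs :
  ewf ok V (EGate k l) -> circ_wf ok n gs -> env_ok n gs V pi D ->
  exists gs', compiled ok n gs pi D (EGate k l) gs' (n + length gs' - 1) /\ 1 <= length gs'.
Proof.
  intros He Hwf Henv. eapply compile_expr_last; eauto.
  inversion He; subst. eapply compile_list; eauto.
Qed.

(** * Small expressions of bounded depth *)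

(* [C_val a] is the valuation of the variables in the situation [a]; the gates [C_ok] may be used. *)
Record ectx := mkEctx {
  C_ok : gkind -> bool; C_V : nat -> Prop; C_A : Type; C_val : C_A -> nat -> bool; C_K : nat;
  C_K2 : 2 <= C_K; C_and : C_ok GAnd = true; C_or : C_ok GOr = true; C_not : C_ok GNot = true }.

(* A single [a] for depth and size exponent: composing constructions only adds constants to it. *)
Definition hasE (C : ectx) (a : nat) (f : C_A C -> bool) : Prop :=
  exists e, ewf (C_ok C) (C_V C) e /\ esize e <= C_K C ^ a /\ edepth e <= a /\
    forall x, eeval (C_val C x) e = f x.

Section Combinators.
Variable C : ectx.
Notation A := (C_A C).
Notation K := (C_K C).

Lemma Kpow_mono a b : a <= b -> K ^ a <= K ^ b.
Proof. intros H. pose proof (C_K2 C). apply Nat.pow_le_mono_r; lia. Qed.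

Lemma Kpow_pos a : 1 <= K ^ a.
Proof. pose proof (Kpow_mono 0 a ltac:(lia)). simpl in H. lia. Qed.

Lemma Kpow_succ a : 2 * K ^ a <= K ^ (S a).
Proof. pose proof (C_K2 C). rewrite Nat.pow_succ_r'. apply Nat.mul_le_mono_r. lia. Qed.

Lemma hasE_ext a (f g : A -> bool) : (forall x, f x = g x) -> hasE C a f -> hasE C a g.
Proof. intros H (e & H1 & H2 & H3 & H4). exists e. repeat split; auto. intros. now rewrite H4. Qed.

Lemma hasE_mono a b (f : A -> bool) : a <= b -> hasE C a f -> hasE C b f.
Proof.
  intros H (e & H1 & H2 & H3 & H4). exists e. repeat split; auto; try lia.
  pose proof (Kpow_mono a b H). lia.
Qed.

Lemma hasE_var a i : C_V C i -> hasE C a (fun x => C_val C x i).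
Proof.
  intros H. exists (EVar i). repeat split; simpl; try lia.
  - now constructor.
  - apply Kpow_pos.
Qed.

Lemma hasE_list {I} a (f : I -> A -> bool) (l : list I) :
  (forall i, In i l -> hasE C a (f i)) ->
  exists es, length es = length l /\ (forall e, In e es -> ewf (C_ok C) (C_V C) e) /\
    list_sum (map esize es) <= length l * K ^ a /\ list_max (map edepth es) <= a /\
    forall x, map (eeval (C_val C x)) es = map (fun i => f i x) l.
Proof.
  induction l as [|i l IH]; intros H.
  - exists []. simpl. repeat split; auto; try lia; easy.
  - destruct (H i (or_introl eq_refl)) as (e & H1 & H2 & H3 & H4).
    destruct IH as (es & J0 & J1 & J2 & J3 & J4); [intros; apply H; now right|].
    exists (e :: es). simpl. repeat split; try lia.
    + intros e' [<-|He']; auto.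
    + intros x. now rewrite H4, J4.
Qed.

(** At most [K ^ b] children of size [K ^ a] give [K ^ (a + b)]. One more unit of the exponent pays
    for the gate itself, as [2 <= K], and also for the extra level of depth. *)
Lemma hasE_gate {I} k a b (f : I -> A -> bool) (l : list I) :
  C_ok C k = true -> (k = GNot -> length l = 1) -> length l <= K ^ b ->
  (forall i, In i l -> hasE C a (f i)) ->
  hasE C (a + b + 1) (fun x => gate_fn k (map (fun i => f i x) l)).
Proof.
  intros Hk Hn Hl Hf. destruct (hasE_list a f l Hf) as (es & J0 & J1 & J2 & J3 & J4).
  exists (EGate k es). split; [|split; [|split]].
  - constructor; auto. intros Hk'. rewrite J0. auto.
  - simpl. pose proof (Kpow_succ (a + b)). pose proof (Kpow_pos (a + b)).
    assert (length l * K ^ a <= K ^ (a + b)).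
    { rewrite Nat.pow_add_r, (Nat.mul_comm (K ^ a)). now apply Nat.mul_le_mono_r. }
    replace (a + b + 1) with (S (a + b)) by lia. lia.
  - simpl. lia.
  - intros x. simpl. now rewrite J4.
Qed.

Lemma hasE_bigor {I} a b (f : I -> A -> bool) (l : list I) :
  length l <= K ^ b -> (forall i, In i l -> hasE C a (f i)) ->
  hasE C (a + b + 1) (fun x => existsb (fun i => f i x) l).
Proof.
  intros Hl Hf. eapply hasE_ext; [|apply (hasE_gate GOr a b f l); auto; [apply C_or | discriminate]].
  intros x. simpl. induction l as [|i l IH]; simpl; [reflexivity|]. f_equal. apply IH.
  - simpl in Hl. lia.
  - intros. apply Hf. now right.
Qed.

Lemma hasE_bigand {I} a b (f : I -> A -> bool) (l : list I) :
  length l <= K ^ b -> (forall i, In i l -> hasE C a (f i)) ->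
  hasE C (a + b + 1) (fun x => forallb (fun i => f i x) l).
Proof.
  intros Hl Hf. eapply hasE_ext; [|apply (hasE_gate GAnd a b f l); auto; [apply C_and | discriminate]].
  intros x. simpl. induction l as [|i l IH]; simpl; [reflexivity|]. f_equal. apply IH.
  - simpl in Hl. lia.
  - intros. apply Hf. now right.
Qed.

Lemma hasE_not a (f : A -> bool) : hasE C a f -> hasE C (a + 1) (fun x => negb (f x)).
Proof.
  intros H. eapply hasE_mono; [|eapply hasE_ext; [|apply (hasE_gate GNot a 0 (fun (_ : unit) => f) [tt])]].
  - lia.
  - intros x. reflexivity.
  - apply C_not.
  - reflexivity.
  - simpl. lia.
  - auto.
Qed.

Lemma hasE_const (b : bool) : hasE C 1 (fun _ => b).
Proof.
  destruct b.
  - apply (hasE_bigand 0 0 (fun (_ : unit) _ => true) []); simpl; [lia | easy].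
  - apply (hasE_bigor 0 0 (fun (_ : unit) _ => true) []); simpl; [lia | easy].
Qed.

Lemma hasE_const' a (b : bool) : 1 <= a -> hasE C a (fun _ => b).
Proof. intros H. eapply hasE_mono; [exact H|]. apply hasE_const. Qed.

Lemma hasE_or a (f g : A -> bool) :
  hasE C a f -> hasE C a g -> hasE C (a + 2) (fun x => f x || g x).
Proof.
  intros Hf Hg. pose proof (C_K2 C).
  eapply hasE_ext; [|eapply hasE_mono; [|apply (hasE_bigor a 1 (fun h x => h x) [f; g])]].
  - intros x. simpl. now rewrite orb_false_r.
  - lia.
  - simpl. lia.
  - intros i [<-|[<-|[]]]; auto.
Qed.

Lemma hasE_and a (f g : A -> bool) :
  hasE C a f -> hasE C a g -> hasE C (a + 2) (fun x => f x && g x).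
Proof.
  intros Hf Hg. pose proof (C_K2 C).
  eapply hasE_ext; [|eapply hasE_mono; [|apply (hasE_bigand a 1 (fun h x => h x) [f; g])]].
  - intros x. simpl. now rewrite andb_true_r.
  - lia.
  - simpl. lia.
  - intros i [<-|[<-|[]]]; auto.
Qed.

(** [g] generates and [h] propagates. Read as a flip-flop, [g] sets the bit and [h] holds it; both
    readings are used, for clamped walks and for radix addition. *)
Fixpoint carry (g h : nat -> bool) (r0 : bool) (t : nat) : bool :=
  match t with O => r0 | S t => g t || (h t && carry g h r0 t) end.

(* Carry lookahead: the last generated carry survives iff it is propagated ever since. *)
Lemma carry_lookahead g h r0 t :
  carry g h r0 t =
  existsb (fun i => g i && forallb h (seq (S i) (t - S i))) (seq 0 t)
  || (r0 && forallb h (seq 0 t)).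
Proof.
  induction t as [|t IH]; [simpl; now rewrite andb_true_r|].
  cbn [carry]. rewrite IH, seq_S, existsb_app, forallb_app. cbn [existsb forallb].
  replace (S t - S (0 + t)) with 0 by lia. cbn [seq forallb].
  assert (E : existsb (fun i => g i && forallb h (seq (S i) (S t - S i))) (seq 0 t) =
          h t && existsb (fun i => g i && forallb h (seq (S i) (t - S i))) (seq 0 t)).
  { assert (F : forall l, (forall i, In i l -> i < t) ->
      existsb (fun i => g i && forallb h (seq (S i) (S t - S i))) l =
      h t && existsb (fun i => g i && forallb h (seq (S i) (t - S i))) l).
    { induction l as [|i l IHl]; intros Hl; cbn [existsb]; [now rewrite andb_false_r|].
      rewrite IHl by (intros; apply Hl; now right).
      assert (i < t) by (apply Hl; now left).
      replace (S t - S i) with (S (t - S i)) by lia.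
      rewrite seq_S, forallb_app. cbn [forallb].
      replace (S i + (t - S i)) with t by lia.
      destruct (g i), (h t), (forallb h (seq (S i) (t - S i))); reflexivity. }
    apply F. intros i Hi. apply in_seq in Hi. lia. }
  rewrite E. simpl (0 + t).
  destruct (g t), (h t), r0, (forallb h (seq 0 t)),
    (existsb (fun i => g i && forallb h (seq (S i) (t - S i))) (seq 0 t)); reflexivity.
Qed.

Lemma hasE_carry a b (g h : nat -> A -> bool) r0 t :
  1 <= a -> t <= K ^ b ->
  (forall i, i < t -> hasE C a (g i) /\ hasE C a (h i)) ->
  hasE C (a + 2 * b + 6) (fun x => carry (fun i => g i x) (fun i => h i x) r0 t).
Proof.
  intros Ha Ht H.
  assert (Hh : forall s n, s + n <= t -> hasE C (a + b + 1) (fun x => forallb (fun j => h j x) (seq s n))).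
  { intros s n Hn. apply hasE_bigand; [rewrite length_seq; lia|].
    intros j Hj. apply in_seq in Hj. apply H. lia. }
  eapply hasE_ext; [intros x; symmetry; apply carry_lookahead|].
  replace (a + 2 * b + 6) with ((a + 2 * b + 4) + 2) by lia.
  apply hasE_or.
  - replace (a + 2 * b + 4) with ((a + b + 1 + 2) + b + 1) by lia.
    apply hasE_bigor; [rewrite length_seq; lia|].
    intros i Hi. apply in_seq in Hi. apply hasE_and.
    + eapply hasE_mono; [|apply H]; lia.
    + apply Hh. lia.
  - eapply hasE_mono; [|apply (hasE_and (a + b + 1))]; [lia | |].
    + apply hasE_const'. lia.
    + apply Hh. lia.
Qed.

Lemma count_true_app l l' : count_true (l ++ l') = count_true l + count_true l'.
Proof. unfold count_true. now rewrite filter_app, length_app. Qed.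

Lemma count_true_repeat b n : count_true (repeat b n) = if b then n else 0.
Proof. unfold count_true. induction n as [|n IH]; destruct b; simpl in *; lia. Qed.

Lemma count_true_le l : count_true l <= length l.
Proof. unfold count_true. apply filter_length_le. Qed.

(* Padding the inputs with constants turns majority into an arbitrary threshold. *)
Lemma hasE_threshold {I} a b (f : I -> A -> bool) (l : list I) th :
  C_ok C GMaj = true -> 1 <= a -> length l <= K ^ b ->
  (forall i, In i l -> hasE C a (f i)) ->
  hasE C (a + b + 4) (fun x => th <=? count_true (map (fun i => f i x) l)).
Proof.
  intros Hm Ha Hl Hf. destruct (le_lt_dec th (length l)) as [Hth|Hth].
  (* Truncated subtraction leaves at most one of [nT] and [nF] nonzero; in either case the padded
     majority says that twice the count exceeds [2 * th - 1]. *)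
  - set (nT := length l + 1 - 2 * th). set (nF := 2 * th - 1 - length l).
    set (g := fun (o : option bool + I) (x : A) =>
                match o with inl (Some c) => c | inl None => false | inr i => f i x end).
    set (l' := map inr l ++ repeat (inl (Some true)) nT ++ repeat (inl (Some false)) nF).
    assert (Hlen : length l' = length l + (nT + nF)).
    { unfold l'. rewrite !length_app, !repeat_length, length_map. lia. }
    eapply hasE_ext; [|eapply hasE_mono; [|apply (hasE_gate GMaj a (b + 2) g l')]]; auto.
    + intros x. simpl. rewrite length_map, Hlen.
      assert (E : map (fun i => g i x) l' =
                  map (fun i => f i x) l ++ repeat true nT ++ repeat false nF).
      { unfold l'. rewrite !map_app, map_map, !map_repeat. reflexivity. }
      rewrite E, !count_true_app, !count_true_repeat.
      pose proof (count_true_le (map (fun i => f i x) l)) as Hc. rewrite length_map in Hc.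
      apply eq_true_iff_eq. rewrite Nat.ltb_lt, Nat.leb_le. lia.
    + lia.
    + discriminate.
    + rewrite Hlen. pose proof (Kpow_succ b). pose proof (Kpow_succ (S b)).
      pose proof (Kpow_pos b). replace (b + 2) with (S (S b)) by lia. lia.
    + intros i Hi. apply in_app_or in Hi. destruct Hi as [Hi|Hi].
      * apply in_map_iff in Hi. destruct Hi as (j & <- & Hj). apply Hf. exact Hj.
      * apply in_app_or in Hi.
        destruct Hi as [Hi|Hi]; apply repeat_spec in Hi; subst i; simpl; now apply hasE_const'.
  - eapply hasE_ext; [|apply (hasE_const' _ false)]; [|lia].
    intros x. pose proof (count_true_le (map (fun i => f i x) l)) as Hc. rewrite length_map in Hc.
    symmetry. apply Nat.leb_gt. lia.
Qed.

End Combinators.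

(** * Clamped sums *)

Section Tables.
Variable C : ectx.
Notation A := (C_A C).
Notation K := (C_K C).

(** Table lookup: when exactly one [f i] and one [g j] hold, the disjunction over the pairs related
    by [rel] evaluates [rel] at the two encoded values. *)
Lemma hasE_table2 {I J} a b (li : list I) (lj : list J)
    (f : I -> A -> bool) (g : J -> A -> bool) (rel : I -> J -> bool) :
  length li <= K ^ b -> length lj <= K ^ b ->
  (forall i, In i li -> hasE C a (f i)) -> (forall j, In j lj -> hasE C a (g j)) ->
  hasE C (a + 2 * b + 3) (fun x =>
    existsb (fun ij => f (fst ij) x && g (snd ij) x)
            (filter (fun ij => rel (fst ij) (snd ij)) (list_prod li lj))).
Proof.
  intros Hi Hj Hf Hg. replace (a + 2 * b + 3) with ((a + 2) + (b + b) + 1) by lia.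
  apply (hasE_bigor C (a + 2) (b + b) (fun ij x => f (fst ij) x && g (snd ij) x)).
  - etransitivity; [apply filter_length_le|]. rewrite length_prod, Nat.pow_add_r.
    now apply Nat.mul_le_mono.
  - intros [i j] H. apply filter_In in H. destruct H as [H _]. apply in_prod_iff in H.
    apply hasE_and; [now apply Hf | now apply Hg].
Qed.

Variable M : Z.
Hypothesis HM : (0 <= M)%Z.
Hypothesis HMK : Z.to_nat (2 * M + 1) <= K.

Definition zrange : list Z :=
  map (fun i => (Z.of_nat i - M)%Z) (seq 0 (Z.to_nat (2 * M + 1))).

Lemma zrange_In v : In v zrange <-> (Z.abs v <= M)%Z.
Proof.
  unfold zrange. rewrite in_map_iff. split.
  - intros (i & <- & Hi). apply in_seq in Hi. lia.
  - intros H. exists (Z.to_nat (v + M)). split; [lia|]. apply in_seq. lia.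
Qed.

Lemma zrange_length : length zrange <= K ^ 1.
Proof. unfold zrange. rewrite length_map, length_seq. rewrite Nat.pow_1_r. exact HMK. Qed.

(** One-hot encoding by the tests [z = v]. It is affordable because the range has at most [K]
    elements, and it turns every function of two such numbers into a table. *)
Definition zE (a : nat) (z : A -> Z) : Prop :=
  (forall x, (Z.abs (z x) <= M)%Z) /\ forall v, hasE C a (fun x => Z.eqb (z x) v).

Lemma zE_rel2 a z1 z2 (g : Z -> Z -> bool) :
  zE a z1 -> zE a z2 -> hasE C (a + 5) (fun x => g (z1 x) (z2 x)).
Proof.
  intros [B1 H1] [B2 H2].
  eapply hasE_ext; [|replace (a + 5) with (a + 2 * 1 + 3) by lia; apply (hasE_table2 a 1 zrange zrange
    (fun v x => Z.eqb (z1 x) v) (fun v x => Z.eqb (z2 x) v) g);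
    auto using zrange_length].
  intros x. apply eq_true_iff_eq. rewrite existsb_exists. split.
  - intros ([u v] & Hin & Huv). apply filter_In in Hin. simpl in *.
    apply andb_true_iff in Huv. rewrite !Z.eqb_eq in Huv. destruct Huv. subst. tauto.
  - intros Hg. exists (z1 x, z2 x). split.
    + apply filter_In. split; [apply in_prod; now apply zrange_In | exact Hg].
    + simpl. now rewrite !Z.eqb_refl.
Qed.

Lemma zE_rel1 a z (g : Z -> bool) : zE a z -> hasE C (a + 5) (fun x => g (z x)).
Proof. intros H. exact (zE_rel2 a z z (fun u _ => g u) H H). Qed.

Lemma zE_const a v : 1 <= a -> (Z.abs v <= M)%Z -> zE a (fun _ => v).
Proof. intros Ha Hv. split; auto. intros u. now apply hasE_const'. Qed.

(* Additive cost [s] of a clamped sum of up to [K] terms. *)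
Definition clamped_sums (s : nat) : Prop :=
  forall a n (z : nat -> A -> Z), 1 <= a -> n <= K -> (forall j, j < n -> zE a (z j)) ->
    forall v, hasE C (a + s) (fun x => Z.eqb (csum M (fun j => z j x) n) v).

Lemma csum_bound z n : (Z.abs (csum M z n) <= M)%Z.
Proof. destruct n; simpl; lia. Qed.

(** * Constant range: clamped walks as cascades of flip-flops *)

Fixpoint walk (W s0 : nat) (up dn : nat -> bool) (t : nat) : nat :=
  match t with
  | O => Nat.min s0 W
  | S t => let s := walk W s0 up dn t in
           if up t then Nat.min W (S s) else if dn t then Nat.pred s else s
  end.

Lemma walk_le W s0 up dn t : walk W s0 up dn t <= W.
Proof. induction t as [|t IH]; simpl; [lia|]. destruct (up t), (dn t); lia. Qed.

(* The clamped walk on [0..W+1] is the one on [0..W] plus a bit, which is set by an upward step at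
   the top and reset by a downward step at the bottom. *)
Lemma walk_succ W s0 up dn t :
  walk (S W) s0 up dn t = walk W s0 up dn t +
    Nat.b2n (carry (fun j => up j && (walk W s0 up dn j =? W))
                   (fun j => up j || (negb (dn j) || negb (walk W s0 up dn j =? 0)))
                   (W <? s0) t).
Proof.
  induction t as [|t IH].
  - simpl. destruct (Nat.ltb_spec W s0); cbn [Nat.b2n]; lia.
  - cbn [walk carry]. rewrite IH. pose proof (walk_le W s0 up dn t).
    set (r := carry _ _ _ t) in *. set (w := walk W s0 up dn t) in *. clearbody r w.
    destruct (up t), (dn t); destruct (Nat.eqb_spec w W); destruct (Nat.eqb_spec w 0);
      destruct r; cbn -[Nat.min]; lia.
Qed.

Lemma hasE_walk a (up dn : nat -> A -> bool) s0 T W t v :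
  1 <= a -> T <= K ^ 2 ->
  (forall j, j < T -> hasE C a (up j) /\ hasE C a (dn j)) -> t <= T ->
  hasE C (a + 21 * W) (fun x => walk W s0 (fun j => up j x) (fun j => dn j x) t =? v).
Proof.
  intros Ha HT H. revert t v. induction W as [|W IH]; intros t v Ht.
  - eapply hasE_ext; [|apply (hasE_const' C _ (0 =? v))]; [|lia].
    intros x. pose proof (walk_le 0 s0 (fun j => up j x) (fun j => dn j x) t).
    cbv beta. f_equal. lia.
  - set (e := a + 21 * W) in *. assert (He : e = a + 21 * W) by reflexivity. clearbody e.
    set (w := fun t x => walk W s0 (fun j => up j x) (fun j => dn j x) t) in *.
    set (r := fun x => carry (fun j => up j x && (w j x =? W))
                (fun j => up j x || (negb (dn j x) || negb (w j x =? 0))) (W <? s0) t).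
    assert (Hr : hasE C (e + 15) r).
    { replace (e + 15) with ((e + 5) + 2 * 2 + 6) by lia.
      apply (hasE_carry C (e + 5) 2 (fun j x => up j x && (w j x =? W))
        (fun j x => up j x || (negb (dn j x) || negb (w j x =? 0)))); try lia.
      intros i Hi. destruct (H i ltac:(lia)) as [Hu Hd].
      apply (hasE_mono C a e) in Hu, Hd; try lia. split.
      - eapply hasE_mono; [|apply (hasE_and C e); auto]; [lia | apply IH; lia].
      - replace (e + 5) with (e + 1 + 2 + 2) by lia. apply hasE_or.
        + eapply hasE_mono; [|exact Hu]. lia.
        + apply hasE_or; apply hasE_not; auto. apply IH. lia. }
    (* The walk one level higher equals [v] if the lower walk is [v] with bit 0, or [v - 1] with bit
       1. Since [Nat.pred 0 = 0], the second case must exclude [v = 0]. *)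
    eapply hasE_ext with (f := fun x => (w t x =? v) && negb (r x) ||
        (w t x =? Nat.pred v) && (r x && negb (v =? 0))).
    + intros x. rewrite walk_succ. unfold r, w.
      set (r0 := carry _ _ _ t). set (w0 := walk W s0 _ _ t). clearbody r0 w0.
      destruct r0; destruct (Nat.eqb_spec v 0); destruct (Nat.eqb_spec w0 v);
        destruct (Nat.eqb_spec w0 (Nat.pred v)); cbn [negb andb orb Nat.b2n];
        symmetry; try (apply Nat.eqb_eq; lia); apply Nat.eqb_neq; lia.
    + replace (a + 21 * S W) with (e + 15 + 2 + 2 + 2) by lia. apply hasE_or; apply hasE_and.
      * eapply hasE_mono; [|apply IH; exact Ht]. lia.
      * eapply hasE_mono; [|apply hasE_not; exact Hr]. lia.
      * eapply hasE_mono; [|apply IH; exact Ht]. lia.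
      * apply hasE_and; [exact Hr | apply hasE_const'; lia].
Qed.

(** A term becomes a block of [m] unit steps, of which the first [|z j|] move in the direction of
    its sign. Within a block all moves have the same direction, so clamping after every unit agrees
    with clamping once at the end. The interval from [-M] to [M] is shifted to start at 0. *)
Lemma walk_csum (z : nat -> Z) n :
  (forall j, j < n -> (Z.abs (z j) <= M)%Z) ->
  let m := Z.to_nat M in
  Z.of_nat (walk (2 * m) m (fun t => (Z.of_nat (S (t mod m)) <=? z (t / m)%nat)%Z)
                 (fun t => (z (t / m)%nat <=? - Z.of_nat (S (t mod m)))%Z) (n * m))
  = (csum M z n + M)%Z.
Proof.
  intros Hz m.
  assert (Hm : Z.of_nat m = M) by (unfold m; lia). clearbody m.
  set (up := fun t => _). set (dn := fun t => _).
  revert Hz. induction n as [|n IH]; intros Hz; [change (0 * m) with 0; cbn [walk csum]; lia|].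
  specialize (IH ltac:(intros; apply Hz; lia)).
  assert (B : forall i, i <= m -> Z.of_nat (walk (2 * m) m up dn (n * m + i)) =
    Z.max 0 (Z.min (2 * M) (csum M z n + M + Z.max (- Z.of_nat i) (Z.min (Z.of_nat i) (z n))))).
  { induction i as [|i IHi]; intros Hi.
    - rewrite Nat.add_0_r, IH. pose proof (csum_bound z n). lia.
    - rewrite Nat.add_succ_r. cbn [walk]. specialize (IHi ltac:(lia)).
      assert (E1 : (n * m + i) / m = n).
      { rewrite Nat.div_add_l, Nat.div_small; lia. }
      assert (E2 : (n * m + i) mod m = i).
      { rewrite Nat.add_comm, Nat.Div0.mod_add. apply Nat.mod_small. lia. }
      set (w := walk (2 * m) m up dn (n * m + i)) in *. clearbody w. unfold up, dn. rewrite E1, E2.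
      pose proof (csum_bound z n).
      destruct (Z.leb_spec (Z.of_nat (S i)) (z n)); [lia|].
      destruct (Z.leb_spec (z n) (- Z.of_nat (S i))); lia. }
  replace (S n * m) with (n * m + m) by lia. rewrite B by lia. cbn [csum].
  pose proof (csum_bound z n). specialize (Hz n). lia.
Qed.

(** The 5 pays for the tests that define the unit steps, and each of the [2 M] levels costs 21. The
    cost is linear in [M], hence constant only for constant precision. *)
Lemma clamped_sums_constant_range : clamped_sums (5 + 42 * Z.to_nat M).
Proof.
  intros a n z Ha Hn Hz v. set (m := Z.to_nat M).
  (* A target [v] below the range is sent to [2 m + 1], which the walk never reaches; a target above
     the range is out of reach already. *)
  eapply hasE_ext with (f := fun x => walk (2 * m) m
     (fun t => (Z.of_nat (S (t mod m)) <=? z (t / m)%nat x)%Z)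
     (fun t => (z (t / m)%nat x <=? - Z.of_nat (S (t mod m)))%Z) (n * m)
       =? Z.to_nat (v + M) + (if (v + M <? 0)%Z then S (2 * m) else 0)).
  - intros x. pose proof (walk_csum (fun j => z j x) n ltac:(intros; now apply Hz)) as E. cbv zeta in E. fold m in E.
    pose proof (walk_le (2 * m) m (fun t => (Z.of_nat (S (t mod m)) <=? z (t / m)%nat x)%Z)
     (fun t => (z (t / m)%nat x <=? - Z.of_nat (S (t mod m)))%Z) (n * m)).
    set (w := walk _ _ _ _ _) in *.
    apply eq_true_iff_eq. rewrite Nat.eqb_eq, Z.eqb_eq.
    destruct (Z.ltb_spec (v + M) 0); lia.
  - replace (a + (5 + 42 * m)) with (a + 5 + 21 * (2 * m)) by lia.
    apply hasE_walk with (T := n * m)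
      (up := fun t x => (Z.of_nat (S (t mod m)) <=? z (t / m)%nat x)%Z)
      (dn := fun t x => (z (t / m)%nat x <=? - Z.of_nat (S (t mod m)))%Z); try lia.
    + simpl. rewrite Nat.mul_1_r. apply Nat.mul_le_mono; lia.
    + intros j Hj. assert (m <> 0) by (intros ->; lia).
      assert (j / m < n) by (apply Nat.Div0.div_lt_upper_bound; lia).
      split; [apply (zE_rel1 a (z (j / m)) (fun u => Z.of_nat (S (j mod m)) <=? u)%Z)
             |apply (zE_rel1 a (z (j / m)) (fun u => u <=? - Z.of_nat (S (j mod m)))%Z)]; auto.
Qed.

(** * Clamped sums by thresholds *)

Fixpoint psum (z : nat -> Z) (n : nat) : Z :=
  match n with O => 0%Z | S n => (psum z n + z n)%Z end.

(* A lower bound on a clamped walk is witnessed by the last time it was saturated from below. *)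
Lemma csum_ge z n v : (- M < v <= M)%Z ->
  ((v <= csum M z n)%Z <->
   exists i, i <= n /\ ((i = 0 /\ (v <= psum z n)%Z) \/ (v <= psum z n - psum z i - M)%Z) /\
     forall j, i < j <= n -> (v <= M + (psum z n - psum z j))%Z).
Proof.
  revert v. induction n as [|n IH]; intros v Hv.
  - simpl. split.
    + intros H. exists 0. split; [lia|]. split; [left; lia|]. intros; lia.
    + intros (i & Hi & [[-> H]|H] & _); [exact H|]. replace i with 0 in H by lia. simpl in H. lia.
  - cbn [csum psum]. set (P := psum z) in *. fold P.
    transitivity (v - z n <= csum M z n)%Z; [lia|].
    (* The bound required before the last term is [v - z n]. At or below [-M] it holds for free,
       with witness [i = n]; above [M] it is impossible, because even full saturation from above
       just before the last term does not reach [v]. *)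
    destruct (Z_le_gt_dec (v - z n) (- M)) as [H1|H1].
    + split; intros _.
      * exists n. split; [lia|]. split; [right; unfold P; lia|].
        intros j Hj. replace j with (S n) by lia. unfold P. cbn [psum]. lia.
      * pose proof (csum_bound z n). lia.
    + destruct (Z_le_gt_dec (v - z n) M) as [H2|H2].
      * rewrite IH by lia. split.
        -- intros (i & Hi & Hb & Hj). exists i. split; [lia|]. split; [fold P; lia|].
           intros j Hj'. destruct (Nat.eq_dec j (S n)) as [->|Hne].
           ++ unfold P. cbn [psum]. lia.
           ++ specialize (Hj j ltac:(lia)). fold P. lia.
        -- intros (i & Hi & Hb & Hj). destruct (Nat.eq_dec i (S n)) as [->|Hne].
           ++ exfalso. unfold P in Hb. cbn [psum] in Hb. lia.
           ++ exists i. split; [lia|]. split; [fold P; lia|].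
              intros j Hj'. specialize (Hj j ltac:(lia)). fold P. lia.
      * split; [pose proof (csum_bound z n); lia|].
        intros (i & Hi & Hb & Hj). exfalso. destruct (Nat.eq_dec i (S n)) as [->|Hne].
        -- unfold P in Hb. cbn [psum] in Hb. lia.
        -- specialize (Hj n). destruct (Nat.eq_dec i n) as [->|Hne2].
           ++ destruct Hb as [[-> Hb]|Hb]; unfold P in Hb; cbn in Hb; lia.
           ++ specialize (Hj ltac:(lia)). unfold P in Hj. lia.
Qed.

(** In thermometer code a number in the range sets [z + M] of its [2 M] bits. A sum over an interval
    is thus a count up to a known offset, and comparing it takes one threshold gate. *)
Lemma psum_thermometer z i k :
  (forall r, (Z.abs (z r) <= M)%Z) ->
  Z.of_nat (count_true (map (fun ru : nat * nat => (Z.of_nat (S (snd ru)) - M <=? z (fst ru))%Z)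
     (list_prod (seq i k) (seq 0 (2 * Z.to_nat M)))))
  = (psum z (i + k) - psum z i + M * Z.of_nat k)%Z.
Proof.
  intros Hz. revert i. induction k as [|k IH]; intros i.
  - rewrite Nat.add_0_r. simpl. unfold count_true. simpl. lia.
  - cbn [seq list_prod]. rewrite map_app, count_true_app, map_map.
    rewrite Nat2Z.inj_add, IH. replace (S i + k) with (i + S k) by lia. cbn [psum].
    assert (E : forall n, n <= 2 * Z.to_nat M ->
      Z.of_nat (count_true (map (fun u => (Z.of_nat (S u) - M <=? z i)%Z) (seq 0 n)))
      = Z.min (Z.of_nat n) (z i + M)).
    { induction n as [|n IHn]; intros Hn.
      - simpl. unfold count_true. specialize (Hz i). simpl. lia.
      - rewrite seq_S, map_app, count_true_app, Nat2Z.inj_add, IHn by lia.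
        unfold count_true. change (0 + n) with n. cbn [map filter].
        destruct (Z.leb_spec (Z.of_nat (S n) - M) (z i)); cbn [length]; lia. }
    cbn [fst snd]. rewrite E by lia. specialize (Hz i). lia.
Qed.

Lemma hasE_psum_ge a n (z : nat -> A -> Z) i v :
  C_ok C GMaj = true -> n <= K -> (forall j, zE a (z j)) -> i <= n ->
  hasE C (a + 11) (fun x => (v <=? psum (fun j => z j x) n - psum (fun j => z j x) i)%Z).
Proof.
  intros Hm Hn Hz Hi.
  eapply hasE_ext; [|eapply hasE_mono; [|apply (hasE_threshold C (a + 5) 2
    (fun (ru : nat * nat) x => (Z.of_nat (S (snd ru)) - M <=? z (fst ru) x)%Z)
    (list_prod (seq i (n - i)) (seq 0 (2 * Z.to_nat M)))
    (Z.to_nat (v + M * Z.of_nat (n - i))) Hm)]]; try lia.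
  - intros x. pose proof (psum_thermometer (fun j => z j x) i (n - i)) as E.
    replace (i + (n - i)) with n in E by lia. cbv beta in E.
    specialize (E ltac:(intros; apply Hz)).
    apply eq_true_iff_eq. rewrite Nat.leb_le, Z.leb_le. lia.
  - rewrite length_prod, !length_seq. simpl. rewrite Nat.mul_1_r. apply Nat.mul_le_mono; lia.
  - intros [r u] _. apply (zE_rel1 a (z r) (fun w => Z.of_nat (S u) - M <=? w)%Z). auto.
Qed.

Lemma csum_ext z z' n : (forall j, j < n -> z j = z' j) -> csum M z n = csum M z' n.
Proof.
  induction n as [|n IH]; intros H; simpl; [reflexivity|].
  rewrite IH by (intros; apply H; lia). now rewrite H by lia.
Qed.

Lemma hasE_csum_ge a n (z : nat -> A -> Z) v :
  C_ok C GMaj = true -> 1 <= a -> n <= K -> (forall j, zE a (z j)) ->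
  hasE C (a + 18) (fun x => (v <=? csum M (fun j => z j x) n)%Z).
Proof.
  intros Hm Ha Hn Hz.
  destruct (Z_le_gt_dec v (- M)) as [H1|H1].
  { eapply hasE_ext; [|apply (hasE_const' C _ true)]; [|lia].
    intros x. pose proof (csum_bound (fun j => z j x) n). symmetry. apply Z.leb_le. lia. }
  destruct (Z_le_gt_dec v M) as [H2|H2].
  2:{ eapply hasE_ext; [|apply (hasE_const' C _ false)]; [|lia].
      intros x. pose proof (csum_bound (fun j => z j x) n). symmetry. apply Z.leb_gt. lia. }
  pose proof (C_K2 C).
  set (P := fun x => psum (fun j => z j x)).
  eapply hasE_ext with (f := fun x => existsb (fun i =>
     ((i =? 0) && (v <=? P x n - P x 0%nat)%Z || (v + M <=? P x n - P x i)%Z) &&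
     forallb (fun j => (v - M <=? P x n - P x j)%Z) (seq (S i) (n - i))) (seq 0 (S n))).
  - intros x. apply eq_true_iff_eq. rewrite Z.leb_le, csum_ge by lia.
    rewrite existsb_exists. fold (P x). split.
    + intros (i & Hi & Hb). apply in_seq in Hi.
      rewrite andb_true_iff, orb_true_iff, andb_true_iff, forallb_forall in Hb.
      rewrite !Z.leb_le, Nat.eqb_eq in Hb. destruct Hb as [Hb Hj]. exists i.
      split; [lia|]. split.
      * unfold P at 2 in Hb. cbn [psum] in Hb. lia.
      * intros j Hj'. specialize (Hj j). rewrite in_seq, Z.leb_le in Hj. lia.
    + intros (i & Hi & Hb & Hj). exists i. rewrite in_seq. split; [lia|].
      rewrite andb_true_iff, orb_true_iff, andb_true_iff, forallb_forall.
      rewrite !Z.leb_le, Nat.eqb_eq. split.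
      * unfold P at 2. cbn [psum]. lia.
      * intros j Hj'. rewrite in_seq in Hj'. rewrite Z.leb_le. specialize (Hj j). lia.
  - replace (a + 18) with (a + 15 + 2 + 1) by lia.
    apply (hasE_bigor C (a + 15) 2 (fun i x =>
      ((i =? 0) && (v <=? P x n - P x 0%nat)%Z || (v + M <=? P x n - P x i)%Z) &&
      forallb (fun j => (v - M <=? P x n - P x j)%Z) (seq (S i) (n - i)))).
    + rewrite length_seq. simpl. nia.
    + intros i Hi. apply in_seq in Hi. replace (a + 15) with (a + 13 + 2) by lia.
      apply hasE_and.
      * replace (a + 13) with (a + 11 + 2) by lia. apply hasE_or.
        -- destruct (i =? 0); simpl.
           ++ apply hasE_psum_ge; auto. lia.
           ++ apply hasE_const'. lia.
        -- apply hasE_psum_ge; auto. lia.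
      * replace (a + 13) with (a + 11 + 1 + 1) by lia.
        apply (hasE_bigand C (a + 11) 1 (fun j x => (v - M <=? P x n - P x j)%Z)).
        -- rewrite length_seq. simpl. lia.
        -- intros j Hj. apply in_seq in Hj. apply hasE_psum_ge; auto. lia.
Qed.

Lemma clamped_sums_majority : C_ok C GMaj = true -> clamped_sums 21.
Proof.
  intros Hm a n z Ha Hn Hz v.
  set (z' := fun j x => if j <? n then z j x else 0%Z).
  assert (Hz' : forall j, zE a (z' j)).
  { intros j. unfold z'. destruct (Nat.ltb_spec j n); auto. apply zE_const; lia. }
  eapply hasE_ext with (f := fun x => (v <=? csum M (fun j => z' j x) n)%Z &&
     negb (v + 1 <=? csum M (fun j => z' j x) n)%Z).
  - intros x. rewrite (csum_ext (fun j => z j x) (fun j => z' j x)).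
    + set (c := csum _ _ _). apply eq_true_iff_eq.
      rewrite andb_true_iff, negb_true_iff, Z.leb_le, Z.leb_gt, Z.eqb_eq. lia.
    + intros j Hj. unfold z'. destruct (Nat.ltb_spec j n); [reflexivity | lia].
  - replace (a + 21) with (a + 18 + 1 + 2) by lia. apply hasE_and.
    + apply (hasE_mono C (a + 18)); [lia|]. apply hasE_csum_ge; auto.
    + apply hasE_not. apply hasE_csum_ge; auto.
Qed.

End Tables.

(** * Layers of a looped transformer *)

Section Layers.
Variable C : ectx.
Notation A := (C_A C).
Notation K := (C_K C).
Variables (p s : nat).
Notation M := (maxZ p).
Hypothesis HMK : Z.to_nat (2 * M + 1) <= K.
Hypothesis Hs : clamped_sums C M s.

Definition numE (a : nat) (F : A -> R) : Prop :=
  (forall x, representable p (F x)) /\ forall v, hasE C a (fun x => Z.eqb (toZ p (F x)) v).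

Lemma numE_mono a b F : a <= b -> numE a F -> numE b F.
Proof. intros H [H1 H2]. split; auto. intros v. eapply hasE_mono; eauto. Qed.

Lemma numE_zE a F : numE a F -> zE C M a (fun x => toZ p (F x)).
Proof. intros [H1 H2]. split; auto. intros. now apply toZ_bound. Qed.

(** Only closure of the grid under [op] matters: products, quotients and exponentials are all the
    same table lookup on grid indices. *)
Lemma numE_op2 a (op : R -> R -> R) F G :
  (forall u v, representable p u -> representable p v -> representable p (op u v)) ->
  numE a F -> numE a G -> numE (a + 5) (fun x => op (F x) (G x)).
Proof.
  intros Hop HF HG. split; [intros; apply Hop; [apply HF | apply HG]|]. intros v.
  eapply hasE_ext; [|apply (zE_rel2 C M (maxZ_nonneg p) HMK a _ _
    (fun u w => Z.eqb (toZ p (op (gridR p u) (gridR p w))) v) (numE_zE a F HF) (numE_zE a G HG))].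
  intros x. cbv beta. rewrite <- !representable_toZ; [reflexivity | apply HG | apply HF].
Qed.

Lemma numE_op1 a (op : R -> R) F :
  (forall u, representable p u -> representable p (op u)) ->
  numE a F -> numE (a + 5) (fun x => op (F x)).
Proof. intros Hop HF. apply (numE_op2 a (fun u _ => op u) F F); auto. Qed.

Lemma numE_const a c : 1 <= a -> representable p c -> numE a (fun _ => c).
Proof. intros Ha Hc. split; auto. intros v. now apply hasE_const'. Qed.

Lemma numE_fsum a n (F : nat -> A -> R) :
  1 <= a -> n <= K -> (forall j, j < n -> numE a (F j)) ->
  numE (a + s) (fun x => fsum p (map (fun j => F j x) (seq 0 n))).
Proof.
  intros Ha Hn HF. destruct n as [|n].
  { simpl. apply numE_const; [lia | apply representable_0]. }
  assert (E : forall x, fsum p (map (fun j => F j x) (seq 0 (S n))) =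
     gridR p (csum M (fun j => toZ p (F j x)) (S n))).
  { intros x. rewrite (fsum_seq p (fun j => F j x)) by (apply HF; lia).
    apply fsumf_csum. intros r Hr. now apply HF. }
  split.
  - intros x. rewrite E. apply representable_grid, (csum_bound C); [apply maxZ_nonneg | exact HMK].
  - intros v. eapply hasE_ext; [|apply (Hs a (S n) (fun j x => toZ p (F j x)) Ha Hn) with (v := v)].
    + intros x. cbv beta. now rewrite E, toZ_grid.
    + intros j Hj. apply numE_zE. auto.
Qed.

Lemma numE_fmul a F G : numE a F -> numE a G -> numE (a + 5) (fun x => fmul p (F x) (G x)).
Proof. apply numE_op2. intros. apply representable_rnd. Qed.

Lemma numE_fadd a F G : numE a F -> numE a G -> numE (a + 5) (fun x => fadd p (F x) (G x)).
Proof. apply numE_op2. intros. apply representable_rnd. Qed.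

Lemma numE_fdot a m (u v : A -> vec) :
  1 <= a -> m <= K -> (forall i, i < m -> numE a (fun x => u x i)) ->
  (forall i, i < m -> numE a (fun x => v x i)) ->
  numE (a + 5 + s) (fun x => fdot p m (u x) (v x)).
Proof.
  intros Ha Hm Hu Hv. unfold fdot.
  apply (numE_fsum (a + 5) m (fun i x => fmul p (u x i) (v x i))); [lia | exact Hm |].
  intros j Hj. apply numE_fmul; auto.
Qed.

Lemma numE_fmatvec a m (W : mat) (v : A -> vec) r :
  1 <= a -> m <= K -> (forall c, c < m -> representable p (W r c)) ->
  (forall i, i < m -> numE a (fun x => v x i)) ->
  numE (a + 5 + s) (fun x => fmatvec p m W (v x) r).
Proof.
  intros Ha Hm HW Hv. unfold fmatvec. apply (numE_fdot a m (fun _ => W r) v); auto.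
  intros i Hi. apply numE_const; auto.
Qed.

Variables (d w H N : nat) (ly : Layer).
Hypothesis Hd : d <= K.
Hypothesis Hw : w <= K.
Hypothesis HH : H <= K.
Hypothesis HN : N <= K.
Hypothesis HQ : forall h r c, h < H -> r < d -> c < d ->
  representable p (WQ ly h r c) /\ representable p (WK ly h r c) /\
  representable p (WV ly h r c) /\ representable p (WO ly h r c).
Hypothesis HW1 : forall r c, r < w -> c < d -> representable p (W1 ly r c).
Hypothesis Hb1 : forall r, r < w -> representable p (b1 ly r).
Hypothesis HW2 : forall r c, r < d -> c < w -> representable p (W2 ly r c).

Definition stateE (a : nat) (X : A -> nat -> vec) : Prop :=
  forall i c, i < N -> c < d -> numE a (fun x => X x i c).

(** The longest path has six sums (projection, score, normalizer, mixture of positions, output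
    projection, heads) and six lookups of cost 5 (a product in each projection, in the score and in
    the mixture, the exponential, the quotient). *)
Lemma numE_attention a X i c :
  1 <= a -> stateE a X -> i < N -> c < d ->
  numE (a + 30 + 6 * s) (fun x => attention p d H N ly (X x) i c).
Proof.
  intros Ha HX Hi Hc. unfold attention.
  set (e := fun h j x => fexp p (fdot p d (fmatvec p d (WQ ly h) (X x i))
                                          (fmatvec p d (WK ly h) (X x j)))).
  assert (He : forall h j, h < H -> j < N -> numE (a + 15 + 2 * s) (e h j)).
  { intros h j Hh Hj. replace (a + 15 + 2 * s) with ((a + 5 + s) + 5 + s + 5) by lia.
    apply numE_op1; [intros; apply representable_rnd|].
    apply (numE_fdot (a + 5 + s) d (fun x => fmatvec p d (WQ ly h) (X x i))
             (fun x => fmatvec p d (WK ly h) (X x j))); try lia; auto.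
    all: intros r Hr; apply numE_fmatvec with (v := fun x => X x _); auto;
      intros; now apply HQ. }
  replace (a + 30 + 6 * s) with ((a + 25 + 4 * s) + 5 + s + s) by lia.
  apply (numE_fsum (a + 25 + 4 * s + 5 + s) H (fun h x => fmatvec p d (WO ly h)
    (fun c => fsum p (map (fun j => fmul p (fdiv p (e h j x) (fsum p (map (fun j => e h j x) (seq 0 N))))
                                        (fmatvec p d (WV ly h) (X x j) c)) (seq 0 N))) c));
    try lia; auto.
  intros h Hh. apply numE_fmatvec with (v := fun x c => fsum p (map (fun j =>
     fmul p (fdiv p (e h j x) (fsum p (map (fun j => e h j x) (seq 0 N))))
                              (fmatvec p d (WV ly h) (X x j) c)) (seq 0 N))); try lia; auto.
  - intros. now apply HQ.
  - intros r Hr. replace (a + 25 + 4 * s) with ((a + 15 + 3 * s) + 5 + 5 + s) by lia.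
    apply (numE_fsum (a + 15 + 3 * s + 5 + 5) N (fun j x =>
     fmul p (fdiv p (e h j x) (fsum p (map (fun j => e h j x) (seq 0 N))))
                              (fmatvec p d (WV ly h) (X x j) r))); try lia; auto.
    intros j Hj. apply numE_fmul.
    + apply (numE_op2 _ (fdiv p) (e h j) (fun x => fsum p (map (fun j => e h j x) (seq 0 N)))).
      * intros. apply representable_rnd.
      * eapply numE_mono; [|now apply He]. lia.
      * replace (a + 15 + 3 * s) with (a + 15 + 2 * s + s) by lia.
        apply numE_fsum; try lia; auto.
    + apply (numE_mono (a + 5 + s)); [lia|].
      apply numE_fmatvec with (v := fun x => X x j); auto. intros. now apply HQ.
Qed.

Lemma stateE_layer a M' X :
  lt_prec M' = p -> lt_d M' = d -> lt_w M' = w -> lt_H M' = H ->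
  1 <= a -> stateE a X -> stateE (a + (60 + 8 * s)) (fun x => layer_apply M' N ly (X x)).
Proof.
  intros Ep Ed Ew EH Ha HX i c Hi Hc. unfold layer_apply. rewrite Ep, Ed, Ew, EH.
  set (Y := fun x => attn_sub p d H N ly (X x)).
  assert (HY : stateE (a + 35 + 6 * s) Y).
  { intros i' c' Hi' Hc'. unfold Y, attn_sub.
    replace (a + 35 + 6 * s) with (a + 30 + 6 * s + 5) by lia.
    apply (numE_fadd _ (fun x => X x i' c') (fun x => attention p d H N ly (X x) i' c')).
    - eapply numE_mono; [|now apply HX]. lia.
    - now apply numE_attention. }
  change (numE (a + (60 + 8 * s)) (fun x => ffn_sub p d w ly (Y x) i c)).
  clearbody Y. unfold ffn_sub.
  replace (a + (60 + 8 * s)) with (a + 55 + 8 * s + 5) by lia.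
  set (hid := fun x r => Rmax 0 (fadd p (fmatvec p d (W1 ly) (Y x i) r) (b1 ly r))).
  change (numE (a + 55 + 8 * s + 5) (fun x => fadd p (Y x i c) (fmatvec p w (W2 ly) (hid x) c))).
  apply (numE_fadd (a + 55 + 8 * s) (fun x => Y x i c) (fun x => fmatvec p w (W2 ly) (hid x) c)).
  - eapply numE_mono; [|now apply HY]. lia.
  - replace (a + 55 + 8 * s) with (a + 50 + 7 * s + 5 + s) by lia.
    apply numE_fmatvec; try lia; auto.
    intros r Hr. unfold hid. replace (a + 50 + 7 * s) with (a + 45 + 7 * s + 5) by lia.
    apply (numE_op1 _ (Rmax 0)); [apply representable_relu|].
    replace (a + 45 + 7 * s) with (a + 40 + 7 * s + 5) by lia.
    apply (numE_fadd _ (fun x => fmatvec p d (W1 ly) (Y x i) r) (fun _ => b1 ly r)).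
    + replace (a + 40 + 7 * s) with (a + 35 + 6 * s + 5 + s) by lia.
      apply numE_fmatvec with (v := fun x => Y x i); try lia; auto.
    + apply numE_const; auto. lia.
Qed.

End Layers.

Lemma stateE_block C s M N :
  Z.to_nat (2 * maxZ (lt_prec M) + 1) <= C_K C -> clamped_sums C (maxZ (lt_prec M)) s ->
  lt_d M <= C_K C -> lt_w M <= C_K C -> lt_H M <= C_K C -> N <= C_K C -> Defs.lt_wf M ->
  forall a X, 1 <= a -> stateE C (lt_prec M) (lt_d M) N a X ->
  stateE C (lt_prec M) (lt_d M) N (a + length (lt_layers M) * (60 + 8 * s))
    (fun x => block M N (X x)).
Proof.
  intros HMK Hs Hd Hw HH HN (_ & _ & Hl). unfold block.
  induction (lt_layers M) as [|ly l IH]; intros a X Ha HX.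
  - simpl. now rewrite Nat.add_0_r.
  - cbn [fold_left length]. replace (a + S (length l) * (60 + 8 * s)) with
      (a + (60 + 8 * s) + length l * (60 + 8 * s)) by lia.
    apply (IH (fun ly' H => Hl ly' (or_intror H)) (a + (60 + 8 * s))
              (fun x => layer_apply M N ly (X x))); [lia|].
    destruct (Hl ly (or_introl eq_refl)) as (H1 & H2 & H3 & H4).
    apply stateE_layer with (w := lt_w M) (H := lt_H M); auto.
Qed.

(** * From looped transformers to circuits *)

Lemma compile_family ok V n D pi B (es : nat -> expr) s dl gs :
  (forall b, b < B -> ewf ok V (es b) /\ esize (es b) <= s /\ edepth (es b) <= dl) ->
  circ_wf ok n gs -> env_ok n gs V pi D ->
  exists gs' pi', extends ok n gs gs' (B * s) (D + dl) /\
    forall b, b < B -> pi' b < n + length gs' /\ wdepth n gs' (pi' b) <= D + dl /\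
      forall x, length x = n -> wire gs' x (pi' b) = eeval (fun i => wire gs x (pi i)) (es b).
Proof.
  intros Hes Hwf Henv.
  destruct (compile_list ok V n D pi (map es (seq 0 B))) with (gs := gs)
    as (gs' & ws & HE & Hl & Hw & Hv); auto.
  { intros e He. apply in_map_iff in He. destruct He as (b & <- & Hb). apply in_seq in Hb.
    apply Hes. lia. }
  assert (Hsz : list_sum (map esize (map es (seq 0 B))) <= B * s).
  { rewrite map_map. clear -Hes.
    assert (forall l, (forall b, In b l -> b < B) ->
      list_sum (map (fun b => esize (es b)) l) <= length l * s) as H.
    { induction l as [|b l IH]; intros Hl; simpl; [lia|].
      specialize (IH (fun b' H => Hl b' (or_intror H))).
      destruct (Hes b (Hl b (or_introl eq_refl))) as (_ & H & _). lia. }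
    etransitivity; [apply H|]; [|rewrite length_seq; lia].
    intros b Hb. apply in_seq in Hb. lia. }
  assert (Hdl : list_max (map edepth (map es (seq 0 B))) <= dl).
  { apply list_max_le_iff. intros a Ha. apply in_map_iff in Ha. destruct Ha as (e & <- & He).
    apply in_map_iff in He. destruct He as (b & <- & Hb). apply in_seq in Hb. apply Hes. lia. }
  rewrite !length_map, length_seq in Hl.
  exists gs', (fun b => nth b ws 0). split.
  - eapply extends_trans; [exact HE | apply extends_refl with (sz := 0) (D := 0) | lia | lia | lia].
    eapply extends_wf; eauto.
  - intros b Hb. destruct (Hw (nth b ws 0)) as [H1 H2]; [apply nth_In; lia|].
    split; [exact H1|]. split; [lia|]. intros x Hx.
    specialize (Hv x Hx). apply (f_equal (fun l => nth b l false)) in Hv.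
    rewrite (nth_indep _ false (wire gs' x 0)), map_nth in Hv by (rewrite length_map; lia).
    rewrite Hv, map_map.
    rewrite (nth_indep _ false (eeval (fun i => wire gs x (pi i)) (es 0)))
      by (rewrite length_map, length_seq; lia).
    rewrite (map_nth (fun b => eeval (fun i => wire gs x (pi i)) (es b))).
    now rewrite seq_nth by lia.
Qed.

(** The expressions of a round take the wires of the previous round as variables, so sizes and
    depths add up over the rounds instead of being substituted into one another. *)
Lemma unroll_circuit ok n B (vals : nat -> list bool -> nat -> bool) (e0 es : nat -> expr) s dl T :
  (forall b, b < B -> ewf ok (fun i => i < n) (e0 b) /\ esize (e0 b) <= s /\ edepth (e0 b) <= dl) ->
  (forall b, b < B -> ewf ok (fun i => i < B) (es b) /\ esize (es b) <= s /\ edepth (es b) <= dl) ->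
  (forall b x, b < B -> length x = n -> eeval (fun i => nth i x false) (e0 b) = vals 0 x b) ->
  (forall b t x, b < B -> eeval (vals t x) (es b) = vals (S t) x b) ->
  exists gs pi, circ_wf ok n gs /\ length gs <= S T * (B * s) /\
    (forall w, wdepth n gs w <= S T * dl) /\
    forall b, b < B -> pi b < n + length gs /\
      forall x, length x = n -> wire gs x (pi b) = vals T x b.
Proof.
  intros H0 H1 V0 V1. induction T as [|T IH].
  - destruct (compile_family ok (fun i => i < n) n 0 (fun i => i) B e0 s dl [] H0)
      as (gs & pi & HE & Hpi); [apply circ_wf_nil | |].
    { intros i Hi. rewrite wdepth_input by exact Hi. simpl. lia. }
    exists gs, pi. split; [eapply extends_wf; eauto|].
    pose proof (extends_length _ _ _ _ _ _ HE) as HL. simpl in HL. split; [lia|]. split.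
    + intros w. destruct (lt_dec w n) as [Hw|Hw]; [rewrite wdepth_input by exact Hw; lia|].
      destruct HE as (t & _ & _ & _ & HD & _). specialize (HD w). simpl in HD. lia.
    + intros b Hb. destruct (Hpi b Hb) as (P1 & _ & P3). split; [exact P1|].
      intros x Hx. rewrite P3, <- V0 by auto. eapply eeval_ext; [now apply H0|].
      intros i Hi. apply wire_input. rewrite Hx. exact Hi.
  - destruct IH as (gs & pi & Hwf & HL & HD & Hpi).
    destruct (compile_family ok (fun i => i < B) n (S T * dl) pi B es s dl gs H1 Hwf)
      as (gs' & pi' & HE & Hpi').
    { intros i Hi. split; [now apply Hpi | apply HD]. }
    exists gs', pi'. split; [eapply extends_wf; eauto|].
    pose proof (extends_length _ _ _ _ _ _ HE) as HL'. split; [lia|]. split.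
    + intros w. destruct (lt_dec w (n + length gs)) as [Hw|Hw].
      * erewrite extends_wdepth by eauto. specialize (HD w). lia.
      * destruct HE as (t & _ & _ & _ & HD' & _). specialize (HD' w). lia.
    + intros b Hb. destruct (Hpi' b Hb) as (P1 & _ & P3). split; [exact P1|].
      intros x Hx. rewrite P3, <- V1 by auto. eapply eeval_ext; [now apply H1|].
      intros i Hi. now apply Hpi.
Qed.

Lemma expr_choice B (P : nat -> expr -> Prop) :
  (forall b, b < B -> exists e, P b e) -> exists es, forall b, b < B -> P b (es b).
Proof.
  induction B as [|B IH]; intros H; [exists (fun _ => EVar 0); lia|].
  destruct IH as (es & Hes); [intros; apply H; lia|].
  destruct (H B) as (e & He); [lia|].
  exists (fun b => if b =? B then e else es b). intros b Hb.
  destruct (Nat.eqb_spec b B); [now subst | apply Hes; lia].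
Qed.

Lemma block_representable M N X :
  (forall i c, c < lt_d M -> representable (lt_prec M) (X i c)) ->
  forall i c, c < lt_d M -> representable (lt_prec M) (block M N X i c).
Proof.
  unfold block. revert X. induction (lt_layers M) as [|ly l IH]; intros X HX; [exact HX|].
  apply IH. intros i c Hc. apply representable_rnd.
Qed.

Section Simulation.
Variables (ok : gkind -> bool) (M : LT) (n K s : nat) (L : lang).
Hypothesis ok_and : ok GAnd = true.
Hypothesis ok_or : ok GOr = true.
Hypothesis ok_not : ok GNot = true.
Hypothesis HK : 2 <= K.
Hypothesis Hn : 1 <= n.
Hypothesis HnK : n <= K.
Hypothesis Hd : lt_d M <= K.
Hypothesis Hw : lt_w M <= K.
Hypothesis HH : lt_H M <= K.
Hypothesis HMK : Z.to_nat (2 * maxZ (lt_prec M) + 1) <= K.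
Hypothesis Hs : forall C, C_ok C = ok -> C_K C = K -> clamped_sums C (maxZ (lt_prec M)) s.
Hypothesis HM : lt_decides M n L.

Notation p := (lt_prec M).
Notation d := (lt_d M).

Definition state (t : nat) (x : list bool) : nat -> vec :=
  Nat.iter t (block M n) (fun i => lt_emb M i (nth i x false)).

Lemma state_representable t x i c : c < d -> representable p (state t x i c).
Proof.
  revert i c. induction t as [|t IH]; intros i c Hc.
  - now apply HM.
  - simpl. now apply block_representable.
Qed.

Let R := Z.to_nat (2 * maxZ p + 1).
Let B := n * d * R.

(** The index is in mixed radix, [b = (i * d + c) * R + k]: the bit says that coordinate [c] at
    position [i] is the grid point number [k], counted from the lowest. *)
Definition state_bit (t : nat) (x : list bool) (b : nat) : bool :=
  Z.eqb (toZ p (state t x (b / R / d) ((b / R) mod d))) (Z.of_nat (b mod R) - maxZ p).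

(** The variables of [C0] are input bits, those of [C1] the bits of a state. A situation of [C1] is
    a time together with an input, so the only states considered are those of actual runs, which are
    known to be representable. *)
Let C0 := mkEctx ok (fun i => i < n) (list bool) (fun x i => nth i x false) K HK ok_and ok_or ok_not.
Let C1 := mkEctx ok (fun i => i < B) (nat * list bool) (fun tx b => state_bit (fst tx) (snd tx) b)
            K HK ok_and ok_or ok_not.

(** One exponent for three kinds of expressions: an initial bit (6), a bit after one loop (1 plus
    the layers) and the readout ([11 + s]). *)
Let a := 12 + s + length (lt_layers M) * (60 + 8 * s).

Lemma state_bit_init b : b < B -> hasE C0 a (fun x => state_bit 0 x b).
Proof.
  intros Hb. unfold state_bit. set (i := b / R / d). set (c := (b / R) mod d).
  assert (Hi : i < n).
  { unfold i. apply Nat.Div0.div_lt_upper_bound. apply Nat.Div0.div_lt_upper_bound.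
    unfold B in Hb. lia. }
  set (g := fun v => Z.eqb (toZ p (lt_emb M i v c)) (Z.of_nat (b mod R) - maxZ p)).
  eapply hasE_ext with (f := fun x : C_A C0 => C_val C0 x i && g true || negb (C_val C0 x i) && g false).
  - intros x. simpl. unfold state. simpl. fold (g (nth i x false)).
    destruct (nth i x false), (g true), (g false); reflexivity.
  - apply (hasE_mono C0 6); [unfold a; lia|].
    apply (hasE_or C0 4 (fun x => C_val C0 x i && g true) (fun x => negb (C_val C0 x i) && g false));
      apply (hasE_and C0 2 _ (fun _ => _)).
    + apply hasE_var. exact Hi.
    + apply hasE_const'. lia.
    + apply (hasE_not C0 1). apply hasE_var. exact Hi.
    + apply hasE_const'. lia.
Qed.

Lemma state_stateE : stateE C1 p d n 1 (fun tx => state (fst tx) (snd tx)).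
Proof.
  intros i c Hi Hc. split; [intros; now apply state_representable|]. intros v.
  pose proof (maxZ_nonneg p) as HM0.
  destruct (Z_le_gt_dec (Z.abs v) (maxZ p)) as [Hv|Hv].
  - set (k := Z.to_nat (v + maxZ p)). set (b := (i * d + c) * R + k).
    assert (Hk : k < R) by (unfold k, R; lia).
    assert (E1 : b / R = i * d + c) by (unfold b; rewrite Nat.div_add_l, Nat.div_small; lia).
    assert (E2 : b mod R = k).
    { unfold b. rewrite Nat.add_comm, Nat.Div0.mod_add. now apply Nat.mod_small. }
    assert (E3 : (i * d + c) / d = i) by (rewrite Nat.div_add_l, Nat.div_small; lia).
    assert (E4 : (i * d + c) mod d = c).
    { rewrite Nat.add_comm, Nat.Div0.mod_add. now apply Nat.mod_small. }
    assert (HbB : b < B).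
    { unfold b, B. assert (i * d + c < n * d) by nia. nia. }
    eapply hasE_ext; [|apply (hasE_var C1 1 b); exact HbB].
    intros [t x]. simpl. unfold state_bit. rewrite E1, E2, E3, E4.
    f_equal. unfold k. lia.
  - eapply hasE_ext; [|apply (hasE_const' C1 1 false); lia].
    intros [t x]. simpl. symmetry. apply Z.eqb_neq.
    pose proof (toZ_bound p _ (state_representable t x i c Hc)). lia.
Qed.

Lemma state_bit_step b : b < B -> hasE C1 a (fun tx => state_bit (S (fst tx)) (snd tx) b).
Proof.
  intros Hb. unfold state_bit. set (i := b / R / d). set (c := (b / R) mod d).
  assert (Hd0 : d <> 0) by (intros E; unfold B in Hb; rewrite E in Hb; lia).
  assert (Hi : i < n).
  { unfold i. apply Nat.Div0.div_lt_upper_bound. apply Nat.Div0.div_lt_upper_bound.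
    unfold B in Hb. lia. }
  assert (Hc : c < d) by (now apply Nat.mod_upper_bound).
  assert (H := stateE_block C1 s M n HMK (Hs C1 eq_refl eq_refl) Hd Hw HH HnK (proj1 HM) 1
    _ (le_n 1) state_stateE i c Hi Hc).
  destruct H as [_ H]. specialize (H (Z.of_nat (b mod R) - maxZ p)%Z).
  apply (hasE_mono C1 (1 + length (lt_layers M) * (60 + 8 * s))); [unfold a; lia|]. exact H.
Qed.

Lemma gridR_lt u v : (gridR p u < gridR p v)%R <-> (u < v)%Z.
Proof.
  unfold gridR, Rdiv. pose proof (Rinv_0_lt_compat _ (scale_pos p)) as Hp. split; intros H.
  - apply lt_IZR. now apply Rmult_lt_reg_r in H.
  - apply Rmult_lt_compat_r; auto. now apply IZR_lt.
Qed.

Definition readout (t : nat) (x : list bool) : bool :=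
  let o := fmatvec p d (lt_out M) (state t x (n - 1)) in
  if Rlt_dec (o 0) (o 1) then true else false.

Lemma readout_hasE : hasE C1 a (fun tx => readout (fst tx) (snd tx)).
Proof.
  pose proof (Hs C1 eq_refl eq_refl) as Hs1.
  assert (Ho : forall o, o < 2 -> numE C1 p (1 + 5 + s)
     (fun tx => fmatvec p d (lt_out M) (state (fst tx) (snd tx) (n - 1)) o)).
  { intros o Ho. apply (numE_fmatvec C1 p s HMK Hs1 1 d (lt_out M)
      (fun tx => state (fst tx) (snd tx) (n - 1)) o); auto.
    - intros c Hc. now apply HM.
    - intros c Hc. apply state_stateE; lia. }
  pose proof (zE_rel2 C1 (maxZ p) (maxZ_nonneg p) HMK _ _ _ Z.ltb
    (numE_zE C1 p _ _ (Ho 0 ltac:(lia))) (numE_zE C1 p _ _ (Ho 1 ltac:(lia)))) as H.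
  apply (hasE_mono C1 (1 + 5 + s + 5)); [unfold a; lia|].
  eapply hasE_ext; [|exact H]. intros tx. cbv beta. unfold readout.
  set (o := fmatvec p d (lt_out M) (state (fst tx) (snd tx) (n - 1))).
  destruct (Ho 0 ltac:(lia)) as [R0 _]. destruct (Ho 1 ltac:(lia)) as [R1 _].
  specialize (R0 tx). specialize (R1 tx). fold o in R0, R1.
  apply representable_toZ in R0, R1. cbv zeta.
  destruct (Rlt_dec (o 0) (o 1)) as [Hlt|Hlt].
  - apply Z.ltb_lt. rewrite R0, R1 in Hlt. now apply gridR_lt in Hlt.
  - apply Z.ltb_ge. rewrite R0, R1, gridR_lt in Hlt. lia.
Qed.

Lemma looped_transformer_circuit :
  exists gs, circ_wf ok n gs /\ (forall x, length x = n -> circ_out gs x = L x) /\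
    circ_size gs <= S (lt_iters M) * (B * K ^ a) + K ^ a + 1 /\
    circ_depth n gs <= (lt_iters M + 3) * a.
Proof.
  destruct (expr_choice B (fun b e => ewf ok (fun i => i < n) e /\ esize e <= K ^ a /\ edepth e <= a /\
    forall x, eeval (fun i => nth i x false) e = state_bit 0 x b)) as (e0 & He0).
  { intros b Hb. exact (state_bit_init b Hb). }
  destruct (expr_choice B (fun b e => ewf ok (fun i => i < B) e /\ esize e <= K ^ a /\ edepth e <= a /\
    forall tx : nat * list bool, eeval (state_bit (fst tx) (snd tx)) e =
       state_bit (S (fst tx)) (snd tx) b)) as (es & Hes).
  { intros b Hb. exact (state_bit_step b Hb). }
  set (T := lt_iters M) in *.
  destruct (unroll_circuit ok n B state_bit e0 es (K ^ a) a T) as (gs & pi & Hwf & HL & HD & Hpi).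
  { intros b Hb. destruct (He0 b Hb) as (? & ? & ? & _). auto. }
  { intros b Hb. destruct (Hes b Hb) as (? & ? & ? & _). auto. }
  { intros b x Hb _. now apply He0. }
  { intros b t x Hb. now apply (Hes b Hb) with (tx := (t, x)). }
  destruct readout_hasE as (e & We & Se & De & Ve).
  destruct (compile_last ok (fun i => i < B) n (S T * a) pi GOr [e] gs) as (gs' & HC & Hlen).
  - constructor; [exact ok_or | discriminate |]. intros e' [<-|[]]. exact We.
  - exact Hwf.
  - intros i Hi. split; [now apply Hpi | apply HD].
  - destruct HC as (HE & _ & _ & Hv). exists gs'. split; [eapply extends_wf; eauto|]. split; [|split].
    + intros x Hx. rewrite circ_out_wire, Hx, Hv by exact Hx. simpl. rewrite orb_false_r.
      rewrite (eeval_ext ok (fun i => i < B) _ (state_bit T x) e We).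
      * specialize (Ve (T, x)). simpl in Ve. etransitivity; [exact Ve|].
        rewrite <- (proj2 HM x Hx). unfold readout, lt_run, state. now rewrite Hx.
      * intros i Hi. now apply Hpi.
    + apply extends_length in HE. unfold circ_size. rewrite <- Nat.add_assoc.
      etransitivity; [apply HE|]. apply Nat.add_le_mono; [exact HL|]. cbn [esize map list_sum fold_right].
      change (C_K C1) with K in Se. lia.
    + assert (1 <= a) by (unfold a; lia).
      apply circ_depth_le. intros w. destruct (lt_dec w (n + length gs)) as [Hlt|Hlt].
      * erewrite extends_wdepth by eauto. specialize (HD w). lia.
      * destruct HE as (t & _ & _ & _ & HD' & _). specialize (HD' w). simpl in HD', De. lia.
Qed.

End Simulation.

(** The class asks for a circuit at every length but bounds it only from [n0] on. Below that, a
    decision tree over the input bits serves for any language. *)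
Lemma boolean_function_circuit ok n (L : lang) :
  ok GAnd = true -> ok GOr = true -> ok GNot = true ->
  exists gs, circ_wf ok n gs /\ forall x, length x = n -> circ_out gs x = L x.
Proof.
  intros Ha Ho Hn.
  assert (H : forall m (f : lang), m <= n -> exists e, ewf ok (fun i => i < n) e /\
    forall x, length x = n -> eeval (fun i => nth i x false) e = f (firstn m x)).
  { induction m as [|m IH]; intros f Hm.
    - exists (EGate (if f [] then GAnd else GOr) []). split.
      + constructor; [destruct (f []); auto | destruct (f []); discriminate | easy].
      + intros x _. simpl. destruct (f []); reflexivity.
    - destruct (IH (fun y => f (y ++ [true])) ltac:(lia)) as (e1 & W1 & V1).
      destruct (IH (fun y => f (y ++ [false])) ltac:(lia)) as (e2 & W2 & V2).
      exists (EGate GOr [EGate GAnd [EVar m; e1]; EGate GAnd [EGate GNot [EVar m]; e2]]). split.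
      + assert (Wm : ewf ok (fun i => i < n) (EVar m)) by (constructor; lia).
        repeat first [exact Wm | exact W1 | exact W2 | constructor; auto; try discriminate; simpl;
          intros e Hin; repeat destruct Hin as [<-|Hin]; try easy].
      + intros x Hx. assert (E : firstn (S m) x = firstn m x ++ [nth m x false]).
        { clear -Hx Hm. revert m Hm. subst n. induction x as [|b x IHx]; intros m Hm; simpl in Hm; [lia|].
          destruct m as [|m]; [reflexivity|]. simpl. f_equal. apply IHx. lia. }
        rewrite E. simpl. rewrite V1, V2 by auto.
        destruct (nth m x false), (f (firstn m x ++ [true])), (f (firstn m x ++ [false])); reflexivity. }
  destruct (H n L (le_n n)) as (e & We & Ve).
  destruct (compile_last ok (fun i => i < n) n 0 (fun i => i) GOr [e] []) as (gs & HC & _).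
  - constructor; auto. intros e' [<-|[]]. exact We.
  - apply circ_wf_nil.
  - intros i Hi. rewrite wdepth_input by exact Hi. simpl. lia.
  - destruct HC as (HE & _ & _ & Hv). exists gs. split; [eapply extends_wf; eauto|].
    intros x Hx. rewrite circ_out_wire, Hx, Hv by exact Hx. simpl. rewrite orb_false_r.
    rewrite (eeval_ext ok (fun i => i < n) _ (fun i => nth i x false) e We).
    + rewrite Ve by exact Hx. rewrite <- Hx at 1. now rewrite firstn_all.
    + intros i Hi. apply wire_input. rewrite Hx. exact Hi.
Qed.

(** * Threshold networks as looped transformers *)

(** [Nor] may read gathered input bits, whose exact value is uncontrolled. [Thr] needs exact 0 and
    1, so it reads only nodes. *)
Inductive rule := Nor (P : nat -> bool) | Thr (w : nat -> Z) (th : Z).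

Definition fire (m n : nat) (x : list bool) (y : nat -> bool) (r : rule) : bool :=
  match r with
  | Nor P => negb (existsb (fun a => P a && (if a <? m then y a else nth (a - m) x false))
                           (seq 0 (m + n)))
  | Thr w th => (th <=? psum (fun a => w a * Z.b2z (y a)) m)%Z
  end.

Definition net_step (m n : nat) (rules : nat -> rule) (x : list bool) (y : nat -> bool) : nat -> bool :=
  fun c => fire m n x y (rules c).

Definition net_run (m n : nat) (rules : nat -> rule) (x : list bool) (T : nat) : nat -> bool :=
  Nat.iter T (net_step m n rules x) (fun _ => false).

(** Keeps every partial sum and shifted threshold an integer below [2 ^ p] in absolute value, so
    that a weighted row is computed without rounding or saturation. A NOR row may saturate. *)
Definition rule_fits (m p : nat) (r : rule) : Prop :=
  match r with
  | Nor _ => True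
  | Thr w th => (psum (fun a => Z.abs (w a)) m + Z.abs th + 1 <= 2 ^ Z.of_nat p - 1)%Z
  end.

Section NetworkTransformer.
Variables (m n p T : nat) (rules : nat -> rule) (out : nat).
Hypothesis Hp : 2 <= p.
Hypothesis Hfit : forall c, c < m -> rule_fits m p (rules c).
Local Open Scope R_scope.

Definition bR (b : bool) : R := if b then 1 else 0.

(** An attention weight may be as small as [2 ^ -p], but the factor [2 ^ p] is not representable:
    the largest number is [2 ^ p - 2 ^ -p]. It is split into [gain] in [WV] and 2 in [WO]. *)
Definition gain : R := IZR (2 ^ (Z.of_nat p - 1)).

Definition weight (r c : nat) : R :=
  match rules r with
  | Nor P => if (c <? m + n)%nat && P c then -1 else 0
  | Thr w _ => if (c <? m)%nat then IZR (w c) else 0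
  end.

Definition bias (r : nat) : Z := match rules r with Nor _ => 0%Z | Thr _ th => (- th)%Z end.

(* Coordinates: m node values, n gathered input bits, n slots in which position i stores its own bit.
   Hidden units: [relu (s - th + 1)] and [relu (s - th)], whose difference is the new node value, and
   copies of the nodes and gathered bits that are used to erase them. *)
Definition netLayer : Layer := {|
  WQ := fun _ _ _ => 0;
  WK := fun _ _ _ => 0;
  WV := fun _ r c => if (r =? c)%nat && (m + n <=? r)%nat then gain else 0;
  WO := fun _ r c => if (m <=? r)%nat && (r <? m + n)%nat && (c =? r + n)%nat then 2 else 0;
  W1 := fun r c => if (r <? m)%nat then weight r c
                   else if (r <? 2 * m)%nat then weight (r - m) c
                   else if (r =? 2 * m + c)%nat then 1 else 0;
  b1 := fun r => if (r <? m)%nat then IZR (bias r + 1)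
                 else if (r <? 2 * m)%nat then IZR (bias (r - m)) else 0;
  W2 := fun c r => if (c <? m)%nat && (r =? c)%nat then 1
                   else if (c <? m)%nat && (r =? m + c)%nat then -1
                   else if (c <? m + n)%nat && (r =? 2 * m + c)%nat then -1 else 0 |}.

Definition netLT : LT := {|
  lt_d := m + 2 * n; lt_w := 3 * m + n; lt_H := 1; lt_prec := p; lt_iters := T;
  lt_emb := fun i b c => bR ((c =? m + n + i)%nat && b);
  lt_layers := [netLayer];
  lt_out := fun o c => if (o =? 1)%nat && (c =? out)%nat && (c <? m)%nat then 1 else 0 |}.

Lemma pow2_ge4 : (4 <= 2 ^ Z.of_nat p)%Z.
Proof. change 4%Z with (2 ^ 2)%Z. apply Z.pow_le_mono_r; lia. Qed.

Lemma maxZ_square : maxZ p = (2 ^ Z.of_nat p * 2 ^ Z.of_nat p - 1)%Z.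
Proof. unfold maxZ. rewrite <- Z.pow_add_r by lia. do 2 f_equal. lia. Qed.

Lemma representable_IZR z : (Z.abs z <= 2 ^ Z.of_nat p - 1)%Z -> representable p (IZR z).
Proof.
  intros Hz. pose proof pow2_ge4. exists (z * 2 ^ Z.of_nat p)%Z. split.
  - rewrite maxZ_square, Z.abs_mul. nia.
  - rewrite mult_IZR, <- scale_IZR. pose proof (scale_pos p). field. lra.
Qed.

Lemma representable_small z : (Z.abs z <= 3)%Z -> representable p (IZR z).
Proof. intros Hz. apply representable_IZR. pose proof pow2_ge4. lia. Qed.

Lemma representable_bR b : representable p (bR b).
Proof. destruct b; [apply (representable_small 1) | apply (representable_small 0)]; lia. Qed.

Lemma representable_bR_minus b b' : representable p (bR b - bR b').
Proof.
  replace (bR b - bR b') with (IZR (Z.b2z b - Z.b2z b')).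
  - apply representable_small. destruct b, b'; simpl; lia.
  - rewrite minus_IZR. destruct b, b'; reflexivity.
Qed.

Lemma gain_scale : gain * 2 = scale p.
Proof.
  unfold gain. rewrite scale_IZR, <- mult_IZR. f_equal.
  rewrite Z.mul_comm, <- Z.pow_succ_r by lia. f_equal. lia.
Qed.

Lemma representable_gain : representable p gain.
Proof.
  apply representable_IZR. pose proof pow2_ge4.
  assert (2 ^ Z.of_nat p = 2 * 2 ^ (Z.of_nat p - 1))%Z.
  { rewrite <- Z.pow_succ_r by lia. f_equal. lia. }
  lia.
Qed.

Lemma representable_half : representable p (/ 2).
Proof.
  exists (2 ^ (Z.of_nat p - 1))%Z. split.
  - pose proof pow2_ge4.
    assert (2 ^ Z.of_nat p = 2 * 2 ^ (Z.of_nat p - 1))%Z.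
    { rewrite <- Z.pow_succ_r by lia. f_equal. lia. }
    rewrite maxZ_square. nia.
  - fold gain. rewrite <- gain_scale. pose proof gain_scale. pose proof (scale_pos p). field. lra.
Qed.

Lemma fmul_0_l x : fmul p 0 x = 0.
Proof. unfold fmul. rewrite Rmult_0_l. apply rnd_id, representable_0. Qed.

Lemma fmul_0_r x : fmul p x 0 = 0.
Proof. unfold fmul. rewrite Rmult_0_r. apply rnd_id, representable_0. Qed.

Lemma fmul_1_l x : representable p x -> fmul p 1 x = x.
Proof. intros H. unfold fmul. rewrite Rmult_1_l. now apply rnd_id. Qed.

Lemma fmul_m1_l x : representable p x -> fmul p (-1) x = - x.
Proof.
  intros H. unfold fmul. replace (-1 * x) with (- x) by ring.
  now apply rnd_id, representable_opp.
Qed.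

Lemma fmatvec_single k W (v : vec) r c :
  (c < k)%nat -> (forall c', (c' < k)%nat -> c' <> c -> W r c' = 0) ->
  fmatvec p k W v r = fmul p (W r c) (v c).
Proof.
  intros Hc H. unfold fmatvec. rewrite fdot_fsumf.
  apply fsumf_single with (f := fun i => fmul p (W r i) (v i)); auto using representable_fmul.
  intros c' H1 H2. rewrite H by auto. apply fmul_0_l.
Qed.

Lemma fmatvec_ext k W (v v' : vec) r :
  (forall c, (c < k)%nat -> v c = v' c) -> fmatvec p k W v r = fmatvec p k W v' r.
Proof.
  intros H. unfold fmatvec. rewrite !fdot_fsumf. apply fsumf_ext.
  intros c Hc. now rewrite H.
Qed.

Lemma fmatvec_zero k W (v : vec) r :
  (forall c', (c' < k)%nat -> W r c' = 0) -> fmatvec p k W v r = 0.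
Proof.
  intros H. unfold fmatvec. rewrite fdot_fsumf. apply fsumf_zero.
  intros c' H1. rewrite H by auto. apply fmul_0_l.
Qed.

(** Queries and keys vanish, so every score is [exp 0 = 1]; this is the rounded softmax normalizer.
    [gathered] is what a true input bit becomes after attention, and apart from being representable
    it is only known to be at least 1. *)
Definition mass : R := fsum p (map (fun _ => 1) (seq 0 n)).
Definition attn_weight : R := fdiv p 1 mass.
Definition gathered : R := fmul p 2 (fmul p attn_weight gain).

Lemma representable_1 : representable p 1.
Proof. apply (representable_small 1). lia. Qed.

Lemma mass_bounds : (1 <= n)%nat -> 1 <= mass < scale p.
Proof.
  intros Hn. unfold mass. rewrite (fsum_seq p (fun _ => 1)) by apply representable_1. split.
  - destruct n as [|k]; [lia|]. clear Hn. induction k as [|k IH].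
    + simpl. rewrite fadd_0_l; [lra | apply representable_1].
    + cbn [fsumf] in *. unfold fadd at 1. rewrite <- (rnd_id p 1) at 1 by apply representable_1.
      apply rnd_mono. unfold fadd at 1 in IH. unfold fadd at 1. lra.
  - destruct (representable_fsumf p (fun _ => 1) n) as (z & Hz & ->).
    pose proof (scale_pos p) as Hs. apply Rmult_lt_reg_r with (scale p); [exact Hs|].
    unfold Rdiv. rewrite Rmult_assoc, Rinv_l, Rmult_1_r by lra.
    rewrite scale_IZR, <- mult_IZR. apply IZR_lt. rewrite maxZ_square in Hz. lia.
Qed.

(* Saturation of the normalizer keeps the attention weight at or above the resolution 2^-p. *)
Lemma gathered_ge_1 : (1 <= n)%nat -> 1 <= gathered.
Proof.
  intros Hn. destruct (mass_bounds Hn) as [H1 H2]. pose proof (scale_pos p) as Hs.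
  assert (Hw : / scale p <= attn_weight).
  { unfold attn_weight, fdiv. rewrite <- (rnd_id p (/ scale p)).
    - apply rnd_mono. unfold Rdiv. rewrite Rmult_1_l. apply Rinv_le_contravar; lra.
    - exists 1%Z. split; [rewrite maxZ_square; pose proof pow2_ge4; simpl; nia | unfold Rdiv; ring]. }
  assert (Hg : / 2 <= fmul p attn_weight gain).
  { unfold fmul. rewrite <- (rnd_id p (/ 2)) at 1 by apply representable_half.
    apply rnd_mono. pose proof gain_scale.
    replace (/ 2) with (/ scale p * gain) by (rewrite <- H; field; lra).
    apply Rmult_le_compat_r; lra. }
  unfold gathered, fmul at 1. rewrite <- (rnd_id p 1) at 1 by apply representable_1.
  apply rnd_mono. lra.
Qed.

Lemma psum_abs_le (z z' : nat -> Z) k : (forall r, (Z.abs (z r) <= z' r)%Z) ->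
  (Z.abs (psum z k) <= psum z' k)%Z.
Proof. intros H. induction k as [|k IH]; simpl; [lia|]. specialize (H k). lia. Qed.

Lemma psum_mono_abs (w : nat -> Z) k k' : (k <= k')%nat ->
  (psum (fun a => Z.abs (w a)) k <= psum (fun a => Z.abs (w a)) k')%Z.
Proof. intros H. induction H; simpl; lia. Qed.

Lemma representable_weight r c : (r < m)%nat -> representable p (weight r c).
Proof.
  intros Hr. pose proof (Hfit r Hr) as HF. unfold weight.
  destruct (rules r) as [P|w th]; cbn [rule_fits] in HF.
  - destruct (_ && _); [apply (representable_small (-1)); lia | apply representable_0].
  - destruct (Nat.ltb_spec c m) as [Hc|]; [|apply representable_0].
    apply representable_IZR. pose proof (psum_mono_abs w (S c) m Hc) as H1.
    pose proof (psum_mono_abs w 0 c ltac:(lia)) as H2. simpl in H1, H2. lia.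
Qed.

Lemma representable_bias r b :
  (r < m)%nat -> (0 <= b <= 1)%Z -> representable p (IZR (bias r + b)).
Proof.
  intros Hr Hb. pose proof (Hfit r Hr) as HF. pose proof pow2_ge4.
  apply representable_IZR. unfold bias. destruct (rules r) as [P|w th]; cbn [rule_fits] in HF.
  - lia.
  - pose proof (psum_mono_abs w 0 m ltac:(lia)) as H2. simpl in H2. lia.
Qed.

Lemma netLT_wf : Defs.lt_wf netLT.
Proof.
  unfold Defs.lt_wf. cbn [lt_prec lt_d lt_w lt_H lt_emb lt_out lt_layers netLT].
  assert (R0 := representable_0 p). assert (R1 := representable_1).
  assert (R2 : representable p 2) by (apply (representable_small 2); lia).
  assert (Rm : representable p (-1)) by (apply (representable_small (-1)); lia).
  assert (Rg := representable_gain).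
  split; [|split].
  - intros. apply representable_bR.
  - intros o c _ _. destruct (_ && _); assumption.
  - intros ly [<-|[]]. cbn [WQ WK WV WO W1 W2 b1 netLayer]. repeat apply conj.
    + intros h r c _ _ _. repeat apply conj; auto; destruct (_ && _); assumption.
    + intros r c Hr Hc. destruct (Nat.ltb_spec r m); [now apply representable_weight|].
      destruct (Nat.ltb_spec r (2 * m)); [apply representable_weight; lia|].
      destruct (_ =? _)%nat; assumption.
    + intros r Hr. destruct (Nat.ltb_spec r m); [apply representable_bias; lia|].
      destruct (Nat.ltb_spec r (2 * m)); [|assumption].
      rewrite <- (Z.add_0_r (bias _)). apply representable_bias; lia.
    + intros r c _ _. repeat (destruct (_ && _); [assumption|]). assumption.
Qed.

Variable x : list bool.
Hypothesis Hx : length x = n.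

Definition gath (j : nat) : R := if nth j x false then gathered else 0.

(** All positions carry the same node values, so the answer can be read at the last one. The
    gathered block is 0 between loops, and positions differ only in the slot that keeps their own
    bit. *)
Definition encodes (y : nat -> bool) (X : nat -> vec) : Prop :=
  forall i c, (c < m + 2 * n)%nat -> X i c =
    if (c <? m)%nat then bR (y c)
    else bR ((c =? m + n + i)%nat && nth i x false).

(** Slot [j] can be nonzero at position [j] alone, so each sum over positions has at most one
    nonzero term and accumulates no error. *)
Lemma attention_value y X i c : encodes y X -> (c < m + 2 * n)%nat ->
  attention p (m + 2 * n) 1 n netLayer X i c =
  if (m <=? c)%nat && (c <? m + n)%nat then gath (c - m) else 0.
Proof.
  intros HX Hc.
  set (head := fun c => fsum p (map (fun j => fmul p attn_weight
       (fmatvec p (m + 2 * n) (WV netLayer 0) (X j) c)) (seq 0 n))).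
  assert (E : attention p (m + 2 * n) 1 n netLayer X i c =
              fmatvec p (m + 2 * n) (WO netLayer 0) head c).
  { unfold attention, head, attn_weight, mass. cbn [seq map fsum fold_left].
    set (e := fun j => fexp p _).
    assert (He : forall j, e j = 1).
    { intros j. unfold e. rewrite fdot_fsumf, fsumf_zero.
      - unfold fexp. rewrite exp_0. apply rnd_id, representable_1.
      - intros r _. rewrite (fmatvec_zero (m + 2 * n) (WQ netLayer 0)) by reflexivity.
        apply fmul_0_l. }
    assert (Hm : map e (seq 0 n) = map (fun _ => 1) (seq 0 n)) by (apply map_ext; auto).
    apply fmatvec_ext. intros r _. f_equal. apply map_ext. intros j. rewrite Hm.
    change (fmul p (fdiv p (e j) (fsum p (map (fun _ => 1) (seq 0 n))))
      (fmatvec p (m + 2 * n) (WV netLayer 0) (X j) r) =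
      fmul p (fdiv p 1 (fsum p (map (fun _ => 1) (seq 0 n))))
      (fmatvec p (m + 2 * n) (WV netLayer 0) (X j) r)). now rewrite He. }
  rewrite E. clear E.
  destruct ((m <=? c)%nat && (c <? m + n)%nat) eqn:Hr.
  - apply andb_true_iff in Hr. rewrite Nat.leb_le, Nat.ltb_lt in Hr.
    rewrite (fmatvec_single _ _ _ c (c + n)).
    2: lia.
    2:{ intros c' _ Hne. simpl. destruct (Nat.eqb_spec c' (c + n)); [lia|].
        now rewrite andb_false_r. }
    assert (Hh : head (c + n)%nat = if nth (c - m) x false then fmul p attn_weight gain else 0).
    { unfold head.
      rewrite (fsum_seq p (fun j => fmul p attn_weight (fmatvec p (m + 2 * n) (WV netLayer 0) (X j) (c + n)%nat)))
        by apply representable_fmul.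
      assert (Hv : forall j, (j < n)%nat -> fmatvec p (m + 2 * n) (WV netLayer 0) (X j) (c + n)%nat =
                 if (j =? c - m)%nat && nth j x false then gain else 0).
      { intros j Hj. rewrite (fmatvec_single _ _ _ (c + n) (c + n)).
        2: lia.
        2:{ intros c' _ Hne. simpl. destruct (Nat.eqb_spec (c + n) c'); [lia | reflexivity]. }
        simpl. rewrite Nat.eqb_refl. destruct (Nat.leb_spec (m + n) (c + n)); [|lia]. simpl.
        rewrite HX by lia. destruct (Nat.ltb_spec (c + n) m); [lia|].
        destruct (Nat.eqb_spec (c + n) (m + n + j)), (Nat.eqb_spec j (c - m)); try lia;
          simpl; [|apply fmul_0_r].
        destruct (nth j x false); simpl; [|apply fmul_0_r].
        unfold fmul. rewrite Rmult_1_r. apply rnd_id, representable_gain. }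
      rewrite (fsumf_single _ _ _ (c - m)); [| lia | apply representable_fmul |].
      - rewrite Hv, Nat.eqb_refl by lia. simpl.
        destruct (nth (c - m) x false); [reflexivity | apply fmul_0_r].
      - intros j Hj Hne. rewrite Hv by exact Hj.
        destruct (Nat.eqb_spec j (c - m)); [lia|]. apply fmul_0_r. }
    rewrite Hh. simpl. destruct Hr as [Hr1 Hr2].
    apply Nat.leb_le in Hr1. apply Nat.ltb_lt in Hr2. rewrite Hr1, Hr2, Nat.eqb_refl. simpl.
    unfold gath, gathered. destruct (nth (c - m) x false); [reflexivity | apply fmul_0_r].
  - apply fmatvec_zero. intros c' _. simpl. now rewrite Hr.
Qed.

Definition attended (y : nat -> bool) (i c : nat) : R :=
  if (c <? m)%nat then bR (y c)
  else if (c <? m + n)%nat then gath (c - m)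
  else bR ((c =? m + n + i)%nat && nth i x false).

Lemma representable_gath j : representable p (gath j).
Proof.
  unfold gath. destruct (nth j x false); [apply representable_fmul | apply representable_0].
Qed.

Lemma representable_attended y i c : representable p (attended y i c).
Proof.
  unfold attended. destruct (c <? m)%nat; [apply representable_bR|].
  destruct (c <? m + n)%nat; [apply representable_gath | apply representable_bR].
Qed.

Lemma gath_cases j : gath j = (if nth j x false then gathered else 0) /\ 0 <= gath j /\
  (nth j x false = true -> 1 <= gath j).
Proof.
  unfold gath. split; [reflexivity|].
  destruct (nth j x false) eqn:E.
  - assert (j < n)%nat.
    { destruct (lt_dec j n); auto. rewrite nth_overflow in E by lia. discriminate. }
    pose proof gathered_ge_1 ltac:(lia). split; intros; lra.
  - split; [lra | discriminate].
Qed.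

Lemma attn_sub_value y X i c : encodes y X -> (c < m + 2 * n)%nat ->
  attn_sub p (m + 2 * n) 1 n netLayer X i c = attended y i c.
Proof.
  intros HX Hc. unfold attn_sub. rewrite (attention_value y X i c HX Hc), HX by exact Hc.
  unfold attended. destruct (Nat.ltb_spec c m), (Nat.leb_spec m c); try lia; simpl.
  - apply fadd_0_r, representable_bR.
  - destruct (Nat.ltb_spec c (m + n)); [|apply fadd_0_r, representable_bR].
    destruct (Nat.eqb_spec c (m + n + i)); [lia|]. simpl. apply fadd_0_l, representable_gath.
Qed.

(** Rounding is monotone and fixes 0 and -1. Hence partial sums never become positive, and once at
    most -1 they stay there, even when saturated. *)
Lemma fsumf_nonpos f k :
  (forall r, (r < k)%nat -> f r = 0 \/ f r <= -1) ->
  fsumf p f k <= 0 /\ ((exists r, (r < k)%nat /\ f r <= -1) -> fsumf p f k <= -1).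
Proof.
  assert (R1 : rnd p (-1) = -1) by (apply rnd_id, (representable_small (-1)); lia).
  assert (R0 : rnd p 0 = 0) by apply rnd_id, representable_0.
  induction k as [|k IH]; intros H; simpl.
  - split; [lra|]. intros (r & Hr & _). lia.
  - destruct IH as [I1 I2]; [intros; apply H; lia|]. unfold fadd.
    assert (Hk := H k ltac:(lia)). split.
    + apply Rle_trans with (rnd p 0); [apply rnd_mono; destruct Hk as [->|Hk]; lra | lra].
    + intros (r & Hr & Hf). apply Rle_trans with (rnd p (-1)); [apply rnd_mono | lra].
      destruct (Nat.eq_dec r k) as [->|Hne].
      * lra.
      * assert (fsumf p f k <= -1) by (apply I2; exists r; split; [lia | exact Hf]).
        destruct Hk as [->|Hk]; lra.
Qed.

Lemma row_value y r (v : vec) i :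
  (r < m)%nat -> (forall c, (c < m + 2 * n)%nat -> v c = attended y i c) ->
  match rules r with
  | Nor P => fdot p (m + 2 * n) (weight r) v <= 0 /\
     (if fire m n x y (Nor P) then fdot p (m + 2 * n) (weight r) v = 0
      else fdot p (m + 2 * n) (weight r) v <= -1)
  | Thr w th => fdot p (m + 2 * n) (weight r) v = IZR (psum (fun a => w a * Z.b2z (y a))%Z m)
  end.
Proof.
  intros Hr Hv. pose proof (Hfit r Hr) as HF. rewrite fdot_fsumf.
  destruct (rules r) as [P|w th] eqn:E.
  - set (f := fun i0 => fmul p (weight r i0) (v i0)).
    assert (Hf : forall c, (c < m + 2 * n)%nat -> f c =
       if (c <? m + n)%nat && P c then - attended y i c else 0).
    { intros c Hc. unfold f. rewrite Hv by exact Hc. unfold weight. rewrite E.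
      destruct ((c <? m + n)%nat && P c); [|apply fmul_0_l].
      apply fmul_m1_l, representable_attended. }
    assert (Hc : forall c, (c < m + n)%nat ->
       (if (if c <? m then y c else nth (c - m) x false)%nat then 1 <= attended y i c
        else attended y i c = 0)).
    { intros c Hc. unfold attended. apply Nat.ltb_lt in Hc. rewrite Hc.
      destruct (c <? m)%nat.
      - destruct (y c); simpl; lra.
      - destruct (gath_cases (c - m)) as (G1 & G2 & G3).
        destruct (nth (c - m) x false); [apply G3; reflexivity | exact G1]. }
    destruct (fsumf_nonpos f (m + 2 * n)) as [F1 F2].
    { intros c Hc'. rewrite Hf by exact Hc'. destruct ((c <? m + n)%nat && P c) eqn:Ec; [|now left].
      apply andb_true_iff in Ec. rewrite Nat.ltb_lt in Ec. specialize (Hc c (proj1 Ec)).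
      destruct (if (c <? m)%nat then y c else nth (c - m) x false); [right | left]; lra. }
    split; [exact F1|]. cbn [fire]. destruct (existsb _ _) eqn:Ex; simpl.
    + apply F2. apply existsb_exists in Ex. destruct Ex as (c & Hin & Hb). apply in_seq in Hin.
      exists c. split; [lia|]. rewrite Hf by lia. apply andb_true_iff in Hb. destruct Hb as [Hb1 Hb2].
      specialize (Hc c ltac:(lia)). rewrite Hb2 in Hc. rewrite Hb1.
      destruct (Nat.ltb_spec c (m + n)); [simpl; lra | lia].
    + apply fsumf_zero. intros c Hc'. rewrite Hf by exact Hc'.
      destruct (Nat.ltb_spec c (m + n)) as [Hlt|]; [|reflexivity]. simpl.
      destruct (P c) eqn:ES; [|reflexivity]. specialize (Hc c Hlt).
      destruct (if (c <? m)%nat then y c else nth (c - m) x false) eqn:Ey; [exfalso|lra].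
      assert (X : false = true); [|discriminate]. rewrite <- Ex.
      apply existsb_exists. exists c. rewrite in_seq, ES, Ey. split; [lia | reflexivity].
  - simpl in HF. set (z := fun a => (w a * Z.b2z (y a))%Z).
    assert (Hz : forall a, (Z.abs (z a) <= Z.abs (w a))%Z).
    { intros a. unfold z. destruct (y a); simpl; lia. }
    rewrite (fsumf_prefix p _ (fun k => IZR (psum z (Nat.min k m)))).
    + rewrite Nat.min_r by lia. reflexivity.
    + reflexivity.
    + intros c Hc. rewrite Hv by exact Hc. unfold weight, attended. rewrite E.
      destruct (Nat.ltb_spec c m) as [Hlt|Hge].
      * rewrite !Nat.min_l by lia.
        assert (E2 : fmul p (IZR (w c)) (bR (y c)) = IZR (z c)).
        { unfold z. destruct (y c); simpl; [|rewrite Z.mul_0_r; apply fmul_0_r].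
          unfold fmul. rewrite Rmult_1_r, Z.mul_1_r. apply rnd_id, representable_IZR.
          pose proof (psum_mono_abs w (S c) m Hlt) as Hmono. simpl in Hmono.
          assert (0 <= psum (fun a => Z.abs (w a)) c)%Z.
          { pose proof (psum_mono_abs w 0 c ltac:(lia)). simpl in H. lia. } lia. }
        rewrite E2. unfold fadd. rewrite <- plus_IZR. apply rnd_id, representable_IZR.
        change (psum z c + z c)%Z with (psum z (S c)).
        pose proof (psum_abs_le z _ (S c) Hz).
        pose proof (psum_mono_abs w (S c) m Hlt). lia.
      * rewrite !Nat.min_r by lia. rewrite fmul_0_l. apply fadd_0_r, representable_IZR.
        pose proof (psum_abs_le z _ m Hz). lia.
Qed.

(** On integers, [relu (s - th + 1) - relu (s - th)] is the step function at [th]. A NOR row has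
    [th = 0]; its sum may fail to be an integer, but it is 0 or at most -1, and below -1 both units
    vanish. *)
Lemma hidden_difference y r (v : vec) i :
  (r < m)%nat -> (forall c, (c < m + 2 * n)%nat -> v c = attended y i c) ->
  let h1 := Rmax 0 (fadd p (fdot p (m + 2 * n) (weight r) v) (IZR (bias r + 1))) in
  let h2 := Rmax 0 (fadd p (fdot p (m + 2 * n) (weight r) v) (IZR (bias r))) in
  fadd p h1 (- h2) = bR (fire m n x y (rules r)).
Proof.
  intros Hr Hv h1 h2. pose proof (row_value y r v i Hr Hv) as HR. pose proof (Hfit r Hr) as HF.
  set (s := fdot p (m + 2 * n) (weight r) v) in *. unfold bias in *.
  assert (R0 : rnd p 0 = 0) by apply rnd_id, representable_0.
  assert (R1 : rnd p 1 = 1) by apply rnd_id, representable_1.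
  destruct (rules r) as [P|w th].
  - assert (E2 : h2 = 0).
    { unfold h2. apply Rmax_left. unfold fadd. rewrite <- R0. apply rnd_mono. destruct HR. lra. }
    rewrite E2, Ropp_0. destruct HR as [H1 H2].
    destruct (fire m n x y (Nor P)); unfold h1, bR.
    + rewrite H2. unfold fadd at 2. replace (0 + IZR (0 + 1)) with 1 by (simpl; lra). rewrite R1.
      rewrite Rmax_right by lra. apply fadd_0_r, representable_1.
    + rewrite Rmax_left; [apply fadd_0_r, representable_0|].
      unfold fadd. rewrite <- R0. apply rnd_mono. simpl. lra.
  - cbn [fire rule_fits] in *. set (z := psum (fun a => w a * Z.b2z (y a))%Z m) in *.
    assert (Hz : (Z.abs z <= psum (fun a => Z.abs (w a)) m)%Z).
    { apply psum_abs_le. intros a. destruct (y a); simpl; lia. }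
    assert (Hrelu : forall b, (Z.abs (z + b) <= 2 ^ Z.of_nat p - 1)%Z ->
       Rmax 0 (fadd p s (IZR b)) = IZR (Z.max 0 (z + b))).
    { intros b Hb. rewrite HR. unfold fadd. rewrite <- plus_IZR, rnd_id by now apply representable_IZR.
      destruct (Z_le_gt_dec 0 (z + b)) as [Hle|Hgt].
      - rewrite Z.max_r by lia. apply Rmax_right. now apply IZR_le.
      - rewrite Z.max_l by lia. apply Rmax_left. apply IZR_le. lia. }
    unfold h1, h2. rewrite !Hrelu by lia. unfold fadd. rewrite <- opp_IZR, <- plus_IZR.
    destruct (Z.leb_spec th z).
    + replace (_ + _)%Z with 1%Z by lia. exact R1.
    + replace (_ + _)%Z with 0%Z by lia. exact R0.
Qed.

Lemma layer_step y X : encodes y X -> encodes (net_step m n rules x y) (layer_apply netLT n netLayer X).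
Proof.
  intros HX i c Hc. unfold layer_apply. cbn [lt_prec lt_d lt_w lt_H netLT]. unfold ffn_sub.
  set (v := attn_sub p (m + 2 * n) 1 n netLayer X i).
  assert (Hv : forall c, (c < m + 2 * n)%nat -> v c = attended y i c)
    by (intros; now apply attn_sub_value).
  set (hid := fun r => Rmax 0 (fadd p (fmatvec p (m + 2 * n) (W1 netLayer) v r) (b1 netLayer r))).
  cbv zeta. change (fadd p (v c) (fmatvec p (3 * m + n) (W2 netLayer) hid c) =
    if (c <? m)%nat then bR (net_step m n rules x y c)
    else bR ((c =? m + n + i)%nat && nth i x false)).
  assert (Hrep : forall r, representable p (hid r)).
  { intros r. apply representable_relu, representable_rnd. }
  assert (Hcopy : forall c, (c < m + n)%nat -> hid (2 * m + c)%nat = attended y i c).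
  { intros c' Hc'. unfold hid. rewrite (fmatvec_single _ _ _ _ c').
    2: lia.
    2:{ intros c2 _ Hne. cbn [W1 netLayer].
        destruct (Nat.ltb_spec (2 * m + c') m); [lia|].
        destruct (Nat.ltb_spec (2 * m + c') (2 * m)); [lia|].
        destruct (Nat.eqb_spec (2 * m + c') (2 * m + c2)); [lia | reflexivity]. }
    cbn [W1 b1 netLayer].
    destruct (Nat.ltb_spec (2 * m + c') m); [lia|].
    destruct (Nat.ltb_spec (2 * m + c') (2 * m)); [lia|]. rewrite Nat.eqb_refl, Hv by lia.
    rewrite fmul_1_l, fadd_0_r by apply representable_attended.
    apply Rmax_right. unfold attended. destruct (c' <? m)%nat; [destruct (y c'); simpl; lra|].
    destruct (c' <? m + n)%nat; [apply gath_cases|].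
    destruct (_ && _); simpl; lra. }
  rewrite Hv by exact Hc. destruct (Nat.ltb_spec c m) as [Hlt|Hge].
  - pose proof (hidden_difference y c v i Hlt Hv) as HD. cbv zeta in HD.
    assert (H1 : hid c = Rmax 0 (fadd p (fdot p (m + 2 * n) (weight c) v) (IZR (bias c + 1)))).
    { unfold hid, fmatvec. cbn [W1 b1 netLayer]. apply Nat.ltb_lt in Hlt. now rewrite Hlt. }
    assert (H2 : hid (m + c)%nat = Rmax 0 (fadd p (fdot p (m + 2 * n) (weight c) v) (IZR (bias c)))).
    { unfold hid, fmatvec. cbn [W1 b1 netLayer].
      destruct (Nat.ltb_spec (m + c) m); [lia|]. destruct (Nat.ltb_spec (m + c) (2 * m)); [|lia].
      now replace (m + c - m)%nat with c by lia. }
    rewrite <- H1, <- H2 in HD. fold (net_step m n rules x y c) in HD.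
    set (b := net_step m n rules x y c) in *.
    assert (Hs : fmatvec p (3 * m + n) (W2 netLayer) hid c = bR b - bR (y c)).
    { unfold fmatvec. rewrite fdot_fsumf.
      (* The row has nonzero entries at [c], [m + c] and [2 m + c], met in this order. The partial
         sum passes through [hid c], the new value, and new minus old; the residual connection then
         adds the old value back. *)
      rewrite (fsumf_prefix p _ (fun k =>
        if (k <=? c)%nat then 0 else if (k <=? m + c)%nat then hid c
        else if (k <=? 2 * m + c)%nat then bR b else bR b - bR (y c))).
      - destruct (Nat.leb_spec (3 * m + n) c); [lia|].
        destruct (Nat.leb_spec (3 * m + n) (m + c)); [lia|].
        destruct (Nat.leb_spec (3 * m + n) (2 * m + c)); [lia | reflexivity].
      - reflexivity.
      - intros r Hr. cbn [W2 netLayer].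
        destruct (Nat.ltb_spec c m); [|lia]. destruct (Nat.ltb_spec c (m + n)); [|lia].
        destruct (Nat.leb_spec r c), (Nat.leb_spec r (m + c)), (Nat.leb_spec r (2 * m + c)),
          (Nat.leb_spec (S r) c), (Nat.leb_spec (S r) (m + c)),
          (Nat.leb_spec (S r) (2 * m + c)); try lia;
        destruct (Nat.eqb_spec r c), (Nat.eqb_spec r (m + c)), (Nat.eqb_spec r (2 * m + c));
          try lia; cbn [andb]; subst.
        all: rewrite ?fmul_0_l, ?fmul_1_l, ?fmul_m1_l by apply Hrep.
        all: try match goal with
          | |- fadd _ ?a 0 = ?a => apply fadd_0_r;
              match a with
              | 0 => apply representable_0
              | bR _ => apply representable_bR
              | bR _ - bR _ => apply representable_bR_minus
              | _ => apply Hrep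
              end
          end.
        + now apply fadd_0_l.
        + exact HD.
        + rewrite Hcopy by lia. unfold attended. apply Nat.ltb_lt in Hlt. rewrite Hlt.
          unfold fadd. apply rnd_id. apply representable_bR_minus. }
    rewrite Hs. unfold attended. apply Nat.ltb_lt in Hlt. rewrite Hlt.
    unfold fadd. replace (bR (y c) + (bR b - bR (y c))) with (bR b) by ring.
    apply rnd_id, representable_bR.
  - destruct (Nat.ltb_spec c (m + n)) as [Hlt2|Hge2].
    + rewrite (fmatvec_single _ _ _ _ (2 * m + c)).
      2: lia.
      2:{ intros r _ Hne. cbn [W2 netLayer]. destruct (Nat.ltb_spec c m); [lia|].
          destruct (Nat.eqb_spec r (2 * m + c)); [lia|]. now rewrite andb_false_r. }
      cbn [W2 netLayer]. destruct (Nat.ltb_spec c m); [lia|].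
      destruct (Nat.ltb_spec c (m + n)); [|lia]. rewrite Nat.eqb_refl. cbn [andb].
      rewrite fmul_m1_l, Hcopy by (apply Hrep || exact Hlt2).
      destruct (Nat.eqb_spec c (m + n + i)); [lia|]. simpl.
      unfold fadd. rewrite Rplus_opp_r. apply rnd_id, representable_0.
    + rewrite fmatvec_zero.
      * rewrite fadd_0_r by apply representable_attended. unfold attended.
        destruct (Nat.ltb_spec c m); [lia|]. destruct (Nat.ltb_spec c (m + n)); [lia | reflexivity].
      * intros r _. cbn [W2 netLayer]. destruct (Nat.ltb_spec c m); [lia|].
        destruct (Nat.ltb_spec c (m + n)); [lia | reflexivity].
Qed.

Lemma netLT_run :
  lt_run netLT x = (out <? m)%nat && net_run m n rules x T out.
Proof.
  assert (HE : forall t, encodes (net_run m n rules x t)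
     (Nat.iter t (block netLT n) (fun i => lt_emb netLT i (nth i x false)))).
  { induction t as [|t IH].
    - intros i c Hc. simpl. destruct (Nat.ltb_spec c m); [|reflexivity].
      destruct (Nat.eqb_spec c (m + n + i)); [lia | reflexivity].
    - simpl. apply layer_step. exact IH. }
  unfold lt_run. rewrite Hx. specialize (HE T). cbn [lt_iters netLT lt_prec lt_d].
  set (XT := Nat.iter T _ _) in *.
  rewrite (fmatvec_zero _ _ _ 0) by reflexivity.
  destruct (Nat.ltb_spec out m) as [Hlt|Hge].
  - rewrite (fmatvec_single _ _ _ 1 out).
    2: lia.
    2:{ intros c _ Hne. simpl. destruct (Nat.eqb_spec c out); [lia | reflexivity]. }
    cbn [lt_out netLT]. rewrite !Nat.eqb_refl. apply Nat.ltb_lt in Hlt as Hlt'. rewrite Hlt'.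
    cbn [andb]. rewrite HE by lia. rewrite Hlt'. rewrite fmul_1_l by apply representable_bR.
    destruct (net_run m n rules x T out); unfold bR; destruct (Rlt_dec _ _); auto; lra.
  - rewrite fmatvec_zero.
    + destruct (Rlt_dec 0 0); [lra | reflexivity].
    + intros c Hc. simpl. destruct (Nat.eqb_spec c out); [|reflexivity].
      destruct (Nat.ltb_spec c m); [lia | reflexivity].
Qed.

End NetworkTransformer.

(** * Circuits as threshold networks *)

Lemma nth_error_firstn_snoc (gs : list gate) j g :
  nth_error gs j = Some g -> exists t, gs = (firstn j gs ++ [g]) ++ t /\ length (firstn j gs) = j.
Proof.
  intros H. destruct (nth_error_split gs j H) as (l1 & l2 & -> & Hl). exists l2.
  subst j. rewrite firstn_app, firstn_all, Nat.sub_diag. simpl.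
  rewrite app_nil_r, <- app_assoc. auto.
Qed.

Lemma wire_gate ok n gs x j g :
  circ_wf ok n gs -> length x = n -> nth_error gs j = Some g ->
  wire gs x (n + j) = gate_fn (gk g) (map (wire gs x) (gin g)).
Proof.
  intros Hwf Hx Hg. destruct (nth_error_firstn_snoc gs j g Hg) as (t & E & Hl).
  destruct (Hwf j g Hg) as (_ & Hin & _).
  set (pre := firstn j gs) in *. clearbody pre. subst gs.
  rewrite wire_app by (rewrite length_app, Hl; simpl; lia).
  rewrite <- Hl. rewrite <- Hx, wire_snoc. f_equal. apply map_ext_in. intros i Hi.
  rewrite <- app_assoc, wire_app; [reflexivity|]. rewrite Hl, Hx. auto.
Qed.

Lemma wdepth_gate ok n gs j g :
  circ_wf ok n gs -> nth_error gs j = Some g ->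
  wdepth n gs (n + j) = S (list_max (map (wdepth n gs) (gin g))).
Proof.
  intros Hwf Hg. destruct (nth_error_firstn_snoc gs j g Hg) as (t & E & Hl).
  destruct (Hwf j g Hg) as (_ & Hin & _).
  set (pre := firstn j gs) in *. clearbody pre. subst gs.
  rewrite wdepth_app by (rewrite length_app, Hl; simpl; lia).
  rewrite <- Hl. rewrite wdepth_snoc. do 2 f_equal. apply map_ext_in. intros i Hi.
  rewrite <- app_assoc, wdepth_app; [reflexivity|]. rewrite Hl. auto.
Qed.

Definition nor_list (l : list nat) : rule := Nor (fun a => existsb (Nat.eqb a) l).

Lemma fire_nor_list m n x y l : (forall a, In a l -> a < m + n) ->
  fire m n x y (nor_list l) = negb (existsb (fun a => if a <? m then y a else nth (a - m) x false) l).
Proof.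
  intros Hl. cbn [fire nor_list]. f_equal. apply eq_true_iff_eq. rewrite !existsb_exists. split.
  - intros (a & _ & H). apply andb_true_iff in H. destruct H as [H1 H2].
    apply existsb_exists in H1. destruct H1 as (b & Hb & Eb). apply Nat.eqb_eq in Eb. subst. eauto.
  - intros (a & Ha & H). exists a. rewrite in_seq. split; [specialize (Hl a Ha); lia|].
    rewrite H, andb_true_r. apply existsb_exists. exists a. now rewrite Nat.eqb_refl.
Qed.

Lemma fire_nor_nodes m n x y l : (forall a, In a l -> a < m) ->
  fire m n x y (nor_list l) = negb (existsb y l).
Proof.
  intros Hl. rewrite fire_nor_list by (intros a Ha; specialize (Hl a Ha); lia). f_equal.
  induction l as [|a l IH]; simpl; [reflexivity|].
  rewrite IH by (intros; apply Hl; now right).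
  destruct (Nat.ltb_spec a m); [reflexivity|]. specialize (Hl a (or_introl eq_refl)). lia.
Qed.

Lemma psum_ext z z' k : (forall a, a < k -> z a = z' a) -> psum z k = psum z' k.
Proof.
  induction k as [|k IH]; intros H; simpl; [reflexivity|].
  rewrite IH by (intros; apply H; lia). now rewrite H by lia.
Qed.

Lemma psum_count_occ (l : list nat) (f : nat -> Z) m : (forall a, In a l -> a < m) ->
  psum (fun a => Z.of_nat (count_occ Nat.eq_dec l a) * f a)%Z m =
  fold_right (fun a s => (f a + s)%Z) 0%Z l.
Proof.
  intros Hl. induction l as [|b l IH]; cbn [fold_right].
  - clear Hl. induction m as [|m IHm]; simpl in *; [reflexivity|]. now rewrite IHm.
  - rewrite <- IH by (intros; apply Hl; now right).
    assert (Hb : b < m) by (apply Hl; now left). clear IH Hl.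
    assert (E : forall k, psum (fun a => Z.of_nat (count_occ Nat.eq_dec (b :: l) a) * f a)%Z k =
       ((if (b <? k)%nat then f b else 0) + psum (fun a => Z.of_nat (count_occ Nat.eq_dec l a) * f a) k)%Z).
    { induction k as [|k IHk]; [reflexivity|]. cbn [psum]. rewrite IHk. cbn [count_occ].
      destruct (Nat.eq_dec b k), (Nat.ltb_spec b k), (Nat.ltb_spec b (S k)); try lia; subst; lia. }
    rewrite E. apply Nat.ltb_lt in Hb. now rewrite Hb.
Qed.

Lemma fold_count_true (y : nat -> bool) l :
  fold_right (fun a s => (2 * Z.b2z (y a) + s)%Z) 0%Z l =
  (2 * Z.of_nat (count_true (map y l)))%Z.
Proof.
  unfold count_true. induction l as [|a l IH]; cbn [fold_right]; [reflexivity|].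
  rewrite IH. cbn [map filter]. destruct (y a); cbn [Z.b2z length]; lia.
Qed.

Section CircuitNetwork.
Variables (ok : gkind -> bool) (n : nat) (gs : list gate).
Hypothesis Hwf : circ_wf ok n gs.

Let W := n + length gs.
Let m := 2 * W.

Definition maj_rule (l : list nat) : rule :=
  Thr (fun a => Z.of_nat (count_occ Nat.eq_dec l a) * 2)%Z (Z.of_nat (length l) + 1)%Z.

(* Node [w] computes wire [w] and node [W + w] its negation. *)
Definition circ_rules (c : nat) : rule :=
  if c <? W then
    match nth_error gs (c - n) with
    | Some g => if c <? n then nor_list [W + c] else
        match gk g with
        | GAnd => nor_list (map (fun i => W + i) (gin g))
        | GOr => nor_list [W + c]
        | GNot => nor_list (gin g)
        | GMaj => maj_rule (gin g)
        end
    | None => nor_list [W + c]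
    end
  else
    let w := c - W in
    if w <? n then nor_list [m + w] else
      match nth_error gs (w - n) with
      | Some g => match gk g with GOr => nor_list (gin g) | _ => nor_list [w] end
      | None => nor_list [w]
      end.

Lemma fire_maj x y l : (forall a, In a l -> a < m) ->
  fire m n x y (maj_rule l) = gate_fn GMaj (map y l).
Proof.
  intros Hl. cbn [fire maj_rule gate_fn].
  rewrite (psum_ext _ (fun a => Z.of_nat (count_occ Nat.eq_dec l a) * (2 * Z.b2z (y a)))%Z)
    by (intros; lia).
  rewrite psum_count_occ by exact Hl.
  rewrite fold_count_true, length_map. apply eq_true_iff_eq. rewrite Z.leb_le, Nat.ltb_lt. lia.
Qed.

(** The weights total twice the length, the threshold is the length plus 1, and [rule_fits] leaves a
    margin of 2. *)
Lemma maj_rule_fits p l : (forall a, In a l -> a < m) ->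
  3 * length l + 3 <= 2 ^ p -> rule_fits m p (maj_rule l).
Proof.
  intros Hl Hp. cbn [rule_fits maj_rule].
  rewrite (psum_ext _ (fun a => Z.of_nat (count_occ Nat.eq_dec l a) * 2)%Z) by (intros; lia).
  rewrite psum_count_occ by exact Hl.
  assert (E : fold_right (fun a s => (2 + s)%Z) 0%Z l = (2 * Z.of_nat (length l))%Z).
  { clear. induction l as [|a l IH]; cbn [fold_right]; [reflexivity|]. rewrite IH. simpl length. lia. }
  rewrite E. apply inj_le in Hp. rewrite Nat2Z.inj_pow in Hp. lia.
Qed.

Lemma gin_lt j g i : nth_error gs j = Some g -> In i (gin g) -> i < n + j.
Proof. intros Hg. apply (Hwf j g Hg). Qed.

(** All nodes update at once, and early values are meaningless; a wire of depth D is right from time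
    [2 D + 2] on and stays right. The initial 2 is for inputs, which enter negated through a NOR and
    are then negated again. A gate takes at most two more rounds: AND reads negated nodes, and OR is
    the negation of a NOR. *)
Lemma circ_net_correct x w t : length x = n -> w < W ->
  (2 * wdepth n gs w + 2 <= t -> net_run m n circ_rules x t w = wire gs x w) /\
  (2 * wdepth n gs w + 3 <= t -> net_run m n circ_rules x t (W + w) = negb (wire gs x w)).
Proof.
  intros Hx. revert t. induction w as [w IH] using lt_wf_ind. intros t Hw.
  set (y := net_run m n circ_rules x) in *.
  assert (Hy : forall t c, y (S t) c = fire m n x (y t) (circ_rules c)) by reflexivity.
  assert (Hm : forall a, a < W -> a < m /\ W + a < m) by (unfold m; lia).
  assert (Hsingle : forall t a, a < m -> fire m n x (y t) (nor_list [a]) = negb (y t a)).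
  { intros t' a Ha. rewrite fire_nor_nodes; [simpl; now rewrite orb_false_r|].
    intros b [<-|[]]. exact Ha. }
  destruct (lt_dec w n) as [Hwn|Hwn].
  - rewrite wdepth_input by exact Hwn. rewrite wire_input by lia.
    assert (RN : circ_rules (W + w) = nor_list [m + w]).
    { unfold circ_rules. destruct (Nat.ltb_spec (W + w) W); [lia|].
      replace (W + w - W) with w by lia. apply Nat.ltb_lt in Hwn. now rewrite Hwn. }
    assert (RP : circ_rules w = nor_list [W + w]).
    { unfold circ_rules. apply Nat.ltb_lt in Hw, Hwn. rewrite Hw, Hwn.
      destruct (nth_error gs (w - n)); reflexivity. }
    assert (HN : forall t, 1 <= t -> y t (W + w) = negb (nth w x false)).
    { intros [|t'] Ht; [lia|]. rewrite Hy, RN, fire_nor_list by (intros a [<-|[]]; lia).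
      simpl. destruct (Nat.ltb_spec (m + w) m); [lia|]. replace (m + w - m) with w by lia.
      now rewrite orb_false_r. }
    split; intros Ht.
    + destruct t as [|t]; [lia|]. rewrite Hy, RP, Hsingle by now apply Hm.
      rewrite HN by lia. apply negb_involutive.
    + apply HN. lia.
  - set (j := w - n). assert (Ew : w = n + j) by (unfold j; lia).
    destruct (nth_error gs j) as [g|] eqn:Hg.
    2:{ apply nth_error_None in Hg. unfold W in Hw. lia. }
    assert (HD : wdepth n gs w = S (list_max (map (wdepth n gs) (gin g)))).
    { rewrite Ew. eapply wdepth_gate; eauto. }
    assert (HV : wire gs x w = gate_fn (gk g) (map (wire gs x) (gin g))).
    { rewrite Ew. eapply wire_gate; eauto. }
    assert (Hin : forall i, In i (gin g) -> i < w) by (intros i Hi; rewrite Ew; eapply gin_lt; eauto).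
    assert (HP : forall t, 2 * wdepth n gs w <= t -> map (y t) (gin g) = map (wire gs x) (gin g)).
    { intros t' Ht. apply map_ext_in. intros i Hi. apply IH; [now apply Hin | | ].
      - specialize (Hin i Hi). lia.
      - pose proof (list_max_in _ _ (in_map (wdepth n gs) _ _ Hi)). lia. }
    assert (HQ : forall t, 2 * wdepth n gs w + 1 <= t ->
       map (fun i => y t (W + i)) (gin g) = map (fun i => negb (wire gs x i)) (gin g)).
    { intros t' Ht. apply map_ext_in. intros i Hi. apply IH; [now apply Hin | | ].
      - specialize (Hin i Hi). lia.
      - pose proof (list_max_in _ _ (in_map (wdepth n gs) _ _ Hi)). lia. }
    assert (EX : forall (f : nat -> bool) l, existsb f l = existsb (fun b => b) (map f l)).
    { intros f l. induction l as [|a l IHl]; simpl; [reflexivity | now rewrite IHl]. }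
    assert (RP : circ_rules w = match gk g with
        | GAnd => nor_list (map (fun i => W + i) (gin g)) | GOr => nor_list [W + w]
        | GNot => nor_list (gin g) | GMaj => maj_rule (gin g) end).
    { unfold circ_rules. fold j. rewrite Hg. apply Nat.ltb_lt in Hw. rewrite Hw.
      destruct (Nat.ltb_spec w n); [lia | reflexivity]. }
    assert (RN : circ_rules (W + w) = match gk g with GOr => nor_list (gin g) | _ => nor_list [w] end).
    { unfold circ_rules. destruct (Nat.ltb_spec (W + w) W); [lia|].
      replace (W + w - W) with w by lia. fold j. rewrite Hg.
      destruct (Nat.ltb_spec w n); [lia | reflexivity]. }
    destruct (Hwf j g Hg) as (_ & _ & Hnot).
    assert (HOr : gk g = GOr -> forall t, 2 * wdepth n gs w + 1 <= t ->
               y t (W + w) = negb (wire gs x w)).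
    { intros Eg [|t'] Ht; [lia|]. rewrite Hy, RN, HV, Eg.
      rewrite fire_nor_nodes by (intros a Ha; specialize (Hin a Ha); apply Hm; lia).
      rewrite EX, HP by lia. reflexivity. }
    assert (Hpos : forall t, 2 * wdepth n gs w + 2 <= t -> y t w = wire gs x w).
    { intros [|t'] Ht; [lia|]. rewrite Hy, RP.
      specialize (HP t' ltac:(lia)). specialize (HQ t' ltac:(lia)).
      destruct (gk g) eqn:Eg.
      - rewrite fire_nor_nodes.
        + rewrite HV, EX, map_map, HQ. simpl. clear.
          induction (gin g) as [|a l IHl]; simpl; [reflexivity|].
          rewrite negb_orb, negb_involutive, IHl. reflexivity.
        + intros a Ha. apply in_map_iff in Ha. destruct Ha as (i & <- & Hi).
          specialize (Hin i Hi). apply Hm. lia.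
      - rewrite Hsingle by now apply Hm. rewrite HOr by (auto; lia). apply negb_involutive.
      - rewrite fire_nor_nodes by (intros a Ha; specialize (Hin a Ha); apply Hm; lia).
        rewrite HV, EX, HP. specialize (Hnot eq_refl).
        destruct (gin g) as [|a [|b l]]; try discriminate. simpl. now rewrite orb_false_r.
      - rewrite fire_maj by (intros a Ha; specialize (Hin a Ha); apply Hm; lia). now rewrite HV, HP. }
    split; [apply Hpos|]. intros Ht.
    destruct (gk g) eqn:Eg; [| apply HOr; auto; lia | |];
      (destruct t as [|t]; [lia|]; rewrite Hy, RN, Hsingle by (now apply Hm);
       rewrite Hpos by lia; reflexivity).
Qed.

Lemma circ_rules_fit p c :
  (forall g, In g gs -> gk g = GMaj -> 3 * length (gin g) + 3 <= 2 ^ p) ->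
  c < m -> rule_fits m p (circ_rules c).
Proof.
  intros Hg Hc. unfold circ_rules. destruct (Nat.ltb_spec c W) as [HcW|HcW].
  - destruct (nth_error gs (c - n)) as [g|] eqn:E; [|exact I].
    destruct (Nat.ltb_spec c n); [exact I|]. destruct (gk g) eqn:Ek; try exact I.
    apply maj_rule_fits.
    + intros a Ha. pose proof (gin_lt _ _ _ E Ha). unfold m. lia.
    + apply Hg; [|exact Ek]. eapply nth_error_In; eauto.
  - cbv zeta. destruct (_ <? n); [exact I|]. destruct (nth_error gs _) as [g|]; [|exact I].
    destruct (gk g); exact I.
Qed.

Lemma circuit_looped_transformer p (L : lang) :
  2 <= p -> (forall g, In g gs -> gk g = GMaj -> 3 * length (gin g) + 3 <= 2 ^ p) ->
  (forall x, length x = n -> circ_out gs x = L x) ->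
  lt_decides (netLT m n p (2 * circ_depth n gs + 2) circ_rules (W - 1)) n L.
Proof.
  intros Hp Hg HL.
  assert (Hfit : forall c, c < m -> rule_fits m p (circ_rules c))
    by (intros; now apply circ_rules_fit).
  split; [now apply netLT_wf|]. intros x Hx. rewrite netLT_run by auto.
  rewrite <- HL, circ_out_wire, Hx by exact Hx. fold W.
  destruct (Nat.ltb_spec (W - 1) m) as [Hlt|Hge].
  - apply circ_net_correct; [exact Hx | unfold m in Hlt; lia |].
    pose proof (wdepth_le_circ n gs (W - 1)). lia.
  (* This case forces [W = 0], no inputs and no gates, where both sides take the default [false]. *)
  - symmetry. unfold wire. apply nth_overflow. rewrite eval_wires_length, Hx. fold W.
    unfold m in Hge. lia.
Qed.

End CircuitNetwork.

(** * Small integer weights *)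

Lemma list_sum_fibers (f : nat -> nat) N l : (forall q, In q l -> f q < N) ->
  length l <= list_sum (map (fun v => length (filter (fun q => f q =? v) l)) (seq 0 N)).
Proof.
  induction l as [|q l IH]; intros Hf; simpl; [lia|].
  assert (E : forall vs, NoDup vs ->
    list_sum (map (fun v => length (if f q =? v then q :: filter (fun q => f q =? v) l
                                   else filter (fun q => f q =? v) l)) vs) =
    (if in_dec Nat.eq_dec (f q) vs then 1 else 0) +
    list_sum (map (fun v => length (filter (fun q => f q =? v) l)) vs)).
  { induction vs as [|v vs IHv]; intros Hnd; [reflexivity|].
    inversion Hnd; subst. cbn [map list_sum fold_right] in *. unfold list_sum in *.
    rewrite IHv by assumption.
    destruct (Nat.eqb_spec (f q) v), (in_dec Nat.eq_dec (f q) vs),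
      (in_dec Nat.eq_dec (f q) (v :: vs)) as [Hi|Hi]; subst; cbn [length]; try lia; try contradiction.
    - exfalso. apply Hi. now left.
    - exfalso. apply Hi. now right.
    - destruct Hi; [congruence | contradiction]. }
  rewrite E by apply seq_NoDup.
  specialize (IH (fun q' H => Hf q' (or_intror H))).
  destruct (in_dec _ _ _) as [_|Hn]; [lia|].
  exfalso. apply Hn. apply in_seq. specialize (Hf q (or_introl eq_refl)). lia.
Qed.

(** One coordinate at a time: some value of the last coordinate is shared by more than [N ^ n] of
    the vectors, and the induction continues among those. *)
Lemma vector_pigeonhole (a : nat -> nat -> nat) N n l :
  (forall q i, a q i < N) -> NoDup l -> N ^ n < length l ->
  exists q1 q2, In q1 l /\ In q2 l /\ q1 < q2 /\ forall i, i < n -> a q1 i = a q2 i.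
Proof.
  intros Ha. revert l. induction n as [|n IH]; intros l Hnd Hl.
  - destruct l as [|q1 [|q2 l]]; simpl in Hl; try lia.
    inversion Hnd as [|? ? Hni]; subst. assert (q1 <> q2) by (intros ->; apply Hni; now left).
    destruct (lt_dec q1 q2); [exists q1, q2 | exists q2, q1]; simpl; repeat split; auto; lia.
  - assert (Hv : exists v, N ^ n < length (filter (fun q => a q n =? v) l)).
    { destruct (existsb (fun v => N ^ n <? length (filter (fun q => a q n =? v) l)) (seq 0 N)) eqn:E.
      - apply existsb_exists in E. destruct E as (v & _ & Hv). apply Nat.ltb_lt in Hv. eauto.
      - exfalso. pose proof (list_sum_fibers (fun q => a q n) N l (fun q _ => Ha q n)) as Hs.
        assert (forall vs, (forall v, In v vs -> In v (seq 0 N)) ->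
          list_sum (map (fun v => length (filter (fun q => a q n =? v) l)) vs) <= length vs * N ^ n) as Hb.
        { induction vs as [|v vs IHv]; intros Hvs; [simpl; lia|].
          specialize (IHv (fun v' H => Hvs v' (or_intror H))).
          assert (length (filter (fun q => a q n =? v) l) <= N ^ n).
          { apply Nat.nlt_ge. intros Hlt. apply Nat.ltb_lt in Hlt.
            rewrite <- not_true_iff_false in E. apply E. apply existsb_exists.
            exists v. split; [apply Hvs; now left | exact Hlt]. }
          cbn [map length]. unfold list_sum in *. cbn [fold_right]. lia. }
        specialize (Hb (seq 0 N) (fun v H => H)). rewrite length_seq in Hb. simpl in Hl. lia. }
    destruct Hv as (v & Hv).
    destruct (IH _ (NoDup_filter _ Hnd) Hv) as (q1 & q2 & H1 & H2 & Hlt & Heq).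
    apply filter_In in H1, H2. destruct H1 as [H1 E1], H2 as [H2 E2].
    apply Nat.eqb_eq in E1, E2. exists q1, q2. repeat split; auto.
    intros i Hi. destruct (Nat.eq_dec i n) as [->|]; [congruence | apply Heq; lia].
Qed.

(* Simultaneous Diophantine approximation of the ratios [w i / M] with a common denominator [q]. *)
Lemma dirichlet_approximation (n N : nat) (w : nat -> Z) (M : Z) : 1 <= N -> (0 < M)%Z ->
  exists (q : Z) (v : nat -> Z), (1 <= q <= Z.of_nat N ^ Z.of_nat n)%Z /\
    forall i, i < n -> (Z.abs (q * w i - M * v i) * Z.of_nat N < M)%Z.
Proof.
  intros HN HM.
  set (res := fun q i => ((Z.of_nat q * w i) mod M)%Z).
  assert (Hres : forall q i, (0 <= res q i < M)%Z) by (intros; now apply Z.mod_pos_bound).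
  set (a := fun q i => Z.to_nat (res q i * Z.of_nat N / M)).
  assert (Hfl : forall q i, (M * Z.of_nat (a q i) <= res q i * Z.of_nat N <
                             M * Z.of_nat (a q i) + M)%Z).
  { intros q i. specialize (Hres q i). unfold a.
    assert (0 <= res q i * Z.of_nat N / M)%Z by (apply Z.div_pos; lia).
    rewrite Z2Nat.id by assumption.
    pose proof (Z.mul_div_le (res q i * Z.of_nat N) M HM).
    pose proof (Z.mul_succ_div_gt (res q i * Z.of_nat N) M HM). lia. }
  (* Of the [N ^ n + 1] multiples of [w], two have their residues modulo [M] in the same interval of
     length [M / N] at every coordinate. Their difference is the denominator [q], and the
     differences of the quotients are the numerators [v i]. *)
  destruct (vector_pigeonhole a N n (seq 0 (S (N ^ n)))) as (q1 & q2 & H1 & H2 & Hlt & Heq).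
  - intros q i. specialize (Hfl q i). specialize (Hres q i). nia.
  - apply seq_NoDup.
  - rewrite length_seq. lia.
  - exists (Z.of_nat q2 - Z.of_nat q1)%Z,
      (fun i => (Z.of_nat q2 * w i / M - Z.of_nat q1 * w i / M)%Z).
    split.
    + apply in_seq in H1, H2. rewrite <- Nat2Z.inj_pow. lia.
    + intros i Hi. specialize (Heq i Hi). pose proof (Hfl q1 i) as F1. pose proof (Hfl q2 i) as F2.
      rewrite Heq in F1.
      assert (E : ((Z.of_nat q2 - Z.of_nat q1) * w i -
                  M * (Z.of_nat q2 * w i / M - Z.of_nat q1 * w i / M) = res q2 i - res q1 i)%Z).
      { unfold res. rewrite !Z.mod_eq by lia. ring. }
      rewrite E. nia.
Qed.

Definition dotZ (n : nat) (w x : nat -> Z) : Z := psum (fun i => w i * x i)%Z n.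
Definition norm1 (n : nat) (x : nat -> Z) : Z := psum (fun i => Z.abs (x i)) n.

Lemma norm1_nonneg n x : (0 <= norm1 n x)%Z.
Proof. unfold norm1. induction n as [|n IH]; simpl; lia. Qed.

Lemma dotZ_bound n w x B : (forall i, i < n -> (Z.abs (w i) <= B)%Z) ->
  (Z.abs (dotZ n w x) <= B * norm1 n x)%Z.
Proof.
  unfold dotZ, norm1. induction n as [|n IH]; intros H; simpl; [lia|].
  specialize (IH ltac:(intros; apply H; lia)). specialize (H n ltac:(lia)).
  assert (Z.abs (w n * x n) <= B * Z.abs (x n))%Z by (rewrite Z.abs_mul; nia). nia.
Qed.

Lemma dotZ_comb n a b u v x :
  dotZ n (fun i => a * u i + b * v i)%Z x = (a * dotZ n u x + b * dotZ n v x)%Z.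
Proof. unfold dotZ. induction n as [|n IH]; simpl; [lia|]. rewrite IH. ring. Qed.

Lemma max_coordinate n (w : nat -> Z) : (exists i, i < n /\ w i <> 0%Z) ->
  exists j, j < n /\ w j <> 0%Z /\ forall i, i < n -> (Z.abs (w i) <= Z.abs (w j))%Z.
Proof.
  induction n as [|n IH]; intros (i & Hi & Hw); [lia|].
  destruct (Z.eq_dec (w n) 0) as [E0|E0].
  - destruct IH as (j & Hj & Hwj & Hmax).
    { exists i. split; [|exact Hw]. destruct (Nat.eq_dec i n); [congruence | lia]. }
    exists j. split; [lia|]. split; [exact Hwj|]. intros i' Hi'.
    destruct (Nat.eq_dec i' n) as [->|]; [rewrite E0; lia | apply Hmax; lia].
  - destruct (existsb (fun i => negb (w i =? 0)%Z) (seq 0 n)) eqn:E.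
    + destruct IH as (j & Hj & Hwj & Hmax).
      { apply existsb_exists in E. destruct E as (i' & H1 & H2). apply in_seq in H1.
        exists i'. split; [lia|]. apply negb_true_iff, Z.eqb_neq in H2. exact H2. }
      destruct (Z_le_gt_dec (Z.abs (w n)) (Z.abs (w j))).
      * exists j. split; [lia|]. split; [exact Hwj|]. intros i' Hi'.
        destruct (Nat.eq_dec i' n) as [->|]; [lia | apply Hmax; lia].
      * exists n. split; [lia|]. split; [exact E0|]. intros i' Hi'.
        destruct (Nat.eq_dec i' n) as [->|]; [lia|]. specialize (Hmax i' ltac:(lia)). lia.
    + exists n. split; [lia|]. split; [exact E0|]. intros i' Hi'.
      destruct (Nat.eq_dec i' n) as [->|]; [lia|].
      assert (w i' = 0%Z) as ->; [|lia]. destruct (Z.eq_dec (w i') 0) as [E1|Hne]; [exact E1|exfalso].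
      rewrite <- not_true_iff_false in E. apply E. apply existsb_exists. exists i'.
      split; [apply in_seq; lia|]. apply negb_true_iff. now apply Z.eqb_neq.
Qed.

Definition support (n : nat) (w : nat -> Z) : nat :=
  length (filter (fun i => negb (w i =? 0)%Z) (seq 0 n)).

Lemma filter_length_lt {T} (f g : T -> bool) l a :
  (forall b, f b = true -> g b = true) -> In a l -> f a = false -> g a = true ->
  length (filter f l) < length (filter g l).
Proof.
  intros H. assert (Hle : forall l, length (filter f l) <= length (filter g l)).
  { clear -H. induction l as [|b l IH]; simpl; [lia|]. specialize (H b).
    destruct (f b), (g b); simpl; try lia. }
  induction l as [|b l IH]; intros Hin Hf Hg; [destruct Hin|]. simpl.
  destruct Hin as [->|Hin].
  - rewrite Hf, Hg. simpl. specialize (Hle l). lia.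
  - specialize (IH Hin Hf Hg). specialize (H b).
    destruct (f b), (g b); simpl; try lia.
Qed.

Lemma support_decreases n w w' j :
  (forall i, w i = 0%Z -> w' i = 0%Z) -> j < n -> w j <> 0%Z -> w' j = 0%Z ->
  support n w' < support n w.
Proof.
  intros H Hj H1 H2. apply filter_length_lt with (a := j).
  - intros i Hi. rewrite negb_true_iff, Z.eqb_neq in *. auto.
  - apply in_seq. lia.
  - now rewrite H2.
  - apply negb_true_iff. now apply Z.eqb_neq.
Qed.

Lemma dotZ_ext n w w' x : (forall i, i < n -> w i = w' i) -> dotZ n w x = dotZ n w' x.
Proof. intros H. unfold dotZ. apply psum_ext. intros i Hi. now rewrite H. Qed.

(* Frank and Tardos: peel off the leading Diophantine approximation [v]; the remainder has smaller
   support and only matters where [v . x = 0]. *)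
Lemma small_weights (n N k : nat) : 2 <= N -> forall w, support n w <= k ->
  exists u : nat -> Z, (forall i, i < n -> (Z.abs (u i) + 1 <= Z.of_nat N ^ Z.of_nat ((n + 2) * k))%Z) /\
    (forall i, i < n -> w i = 0%Z -> u i = 0%Z) /\
    forall x, (norm1 n x <= Z.of_nat N)%Z ->
      ((0 < dotZ n w x)%Z <-> (0 < dotZ n u x)%Z) /\ ((dotZ n w x < 0)%Z <-> (dotZ n u x < 0)%Z).
Proof.
  intros HN. induction k as [|k IH]; intros w Hk.
  - exists (fun _ => 0%Z). split; [|split; [reflexivity|]].
    + intros i Hi. rewrite Nat.mul_0_r. simpl. lia.
    + assert (Hw : forall i, i < n -> w i = 0%Z).
      { intros i Hi. destruct (Z.eq_dec (w i) 0) as [E1|Hne]; [exact E1|exfalso].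
        unfold support in Hk. destruct (filter _ _) as [|b l] eqn:E; [|simpl in Hk; lia].
        assert (Hin : In i (filter (fun i => negb (w i =? 0)%Z) (seq 0 n))).
        { apply filter_In. split; [apply in_seq; lia|]. apply negb_true_iff. now apply Z.eqb_neq. }
        rewrite E in Hin. destruct Hin. }
      intros x _. rewrite (dotZ_ext n w (fun _ => 0%Z)) by exact Hw. tauto.
  - destruct (existsb (fun i => negb (w i =? 0)%Z) (seq 0 n)) eqn:Ex.
    2:{ destruct (IH w) as (u & U1 & U2 & U3).
        - unfold support. assert (forall l, existsb (fun i => negb (w i =? 0)%Z) l = false ->
            filter (fun i => negb (w i =? 0)%Z) l = []) as Hf.
          { induction l as [|b l IHl]; simpl; [reflexivity|].
            destruct (negb _); [discriminate | exact IHl]. }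
          rewrite Hf by exact Ex. simpl. lia.
        - exists u. split; [|split; auto]. intros i Hi. specialize (U1 i Hi).
          etransitivity; [exact U1|]. apply Z.pow_le_mono_r; lia. }
    apply existsb_exists in Ex. destruct Ex as (i0 & Hi0 & Hw0). apply in_seq in Hi0.
    apply negb_true_iff, Z.eqb_neq in Hw0.
    destruct (max_coordinate n w) as (j & Hj & Hwj & Hmax); [exists i0; split; [lia | exact Hw0]|].
    set (M := Z.abs (w j)) in *. assert (HM : (0 < M)%Z) by (unfold M; lia).
    destruct (dirichlet_approximation n N w M ltac:(lia) HM) as (q & v & Hq & Hv).
    set (w' := fun i => if i <? n then (q * w i - M * v i)%Z else 0%Z).
    assert (Ew' : forall i, i < n -> w' i = (q * w i - M * v i)%Z).
    { intros i Hi. unfold w'. apply Nat.ltb_lt in Hi. now rewrite Hi. }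
    assert (Hv0 : forall i, i < n -> w i = 0%Z -> v i = 0%Z).
    { intros i Hi E. specialize (Hv i Hi). rewrite E in Hv. nia. }
    assert (Hvq : forall i, i < n -> (Z.abs (v i) <= q)%Z).
    { intros i Hi. specialize (Hv i Hi). specialize (Hmax i Hi).
      assert (M * Z.abs (v i) < q * M + M)%Z; [|nia].
      assert (Z.abs (q * w i - M * v i) < M)%Z by nia.
      assert (Z.abs (M * v i) <= Z.abs (q * w i) + Z.abs (q * w i - M * v i))%Z by lia.
      rewrite !Z.abs_mul in H0. rewrite (Z.abs_eq M), (Z.abs_eq q) in H0 by lia. nia. }
    (* The remainder loses coordinate [j]: as [|w j| = M], the entry [w' j] is a multiple of [M],
       and the approximation makes it smaller than [M]. Zeros of [w] persist, because [v] vanishes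
       there too. *)
    destruct (IH w') as (u & U1 & U2 & U3).
    { cut (support n w' < support n w); [lia|]. apply support_decreases with (j := j); auto.
      - intros i E. destruct (lt_dec i n) as [Hi|Hi].
        + rewrite Ew', E, (Hv0 i Hi E) by exact Hi. lia.
        + unfold w'. destruct (Nat.ltb_spec i n); [lia | reflexivity].
      - rewrite Ew' by exact Hj. specialize (Hv j Hj).
        assert (Hs : exists e, (w j = e * M)%Z).
        { exists (Z.sgn (w j)). unfold M. destruct (w j); simpl; lia. }
        destruct Hs as (e & He). rewrite He in Hv |- *.
        replace (q * (e * M) - M * v j)%Z with (M * (q * e - v j))%Z in Hv |- * by ring.
        rewrite Z.abs_mul, (Z.abs_eq M) in Hv by lia.
        destruct (Z.eq_dec (q * e - v j) 0) as [->|Hd]; [ring|exfalso].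
        assert (1 <= Z.abs (q * e - v j) * Z.of_nat N)%Z by nia.
        rewrite <- Z.mul_assoc in Hv. nia. }
    set (Uk := (Z.of_nat N ^ Z.of_nat ((n + 2) * k))%Z) in *.
    assert (HUk : (1 <= Uk)%Z).
    { unfold Uk. pose proof (Z.pow_pos_nonneg (Z.of_nat N) (Z.of_nat ((n + 2) * k))). lia. }
    assert (HUb : forall i, i < n -> (Z.abs (u i) <= Uk - 1)%Z) by (intros i Hi; specialize (U1 i Hi); lia).
    (* [c] exceeds every [|u . x|] with [norm1 n x <= N], so [v . x] decides the sign unless it is
       0. A round multiplies the weight bound by at most [N ^ (n + 2)]: [N] from [c], [N ^ n] from
       [|v i| <= q], and one more [N] for the remaining terms. *)
    set (c := (Z.of_nat N * (Uk - 1) + 1)%Z).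
    exists (fun i => c * v i + 1 * u i)%Z. split; [|split].
    + intros i Hi.
      replace (Z.of_nat ((n + 2) * S k)) with (Z.of_nat ((n + 2) * k) + (Z.of_nat n + 2))%Z by lia.
      rewrite Z.pow_add_r, (Z.pow_add_r _ (Z.of_nat n)) by lia. fold Uk.
      set (P := (Z.of_nat N ^ Z.of_nat n)%Z) in *. change (Z.of_nat N ^ 2)%Z with (Z.of_nat N * (Z.of_nat N * 1))%Z.
      specialize (HUb i Hi). specialize (Hvq i Hi).
      assert (Z.abs (c * v i + 1 * u i) <= c * P + (Uk - 1))%Z.
      { assert (Z.abs (c * v i) <= c * P)%Z; [|lia]. rewrite Z.abs_mul, (Z.abs_eq c) by (unfold c; nia).
        apply Z.mul_le_mono_nonneg_l; [unfold c; nia | lia]. }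
      assert (c * P + Uk <= Uk * (P * (Z.of_nat N * (Z.of_nat N * 1))))%Z; [|lia].
      assert (c <= Z.of_nat N * Uk - 1)%Z by (unfold c; nia).
      assert (c * P <= (Z.of_nat N * Uk - 1) * P)%Z by (apply Z.mul_le_mono_nonneg_r; lia).
      assert (1 <= P)%Z by lia.
      assert (Uk <= Uk * P)%Z by nia.
      assert (2 * (Uk * P) <= Z.of_nat N * (Uk * P))%Z by (apply Z.mul_le_mono_nonneg_r; nia).
      assert (2 * (Z.of_nat N * (Uk * P)) <= Z.of_nat N * (Z.of_nat N * (Uk * P)))%Z
        by (apply Z.mul_le_mono_nonneg_r; nia).
      nia.
    + intros i Hi E. rewrite (Hv0 i Hi E), U2; [ring | exact Hi |].
      rewrite Ew', E, (Hv0 i Hi E) by exact Hi. ring.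
    + intros x Hx. destruct (U3 x Hx) as [V1 V2].
      pose proof (norm1_nonneg n x) as Hn0.
      (* From [q (w . x) = M (v . x) + w' . x] with a remainder below [M], a nonzero integer [v . x]
         has the sign of [w . x]. *)
      assert (Hw' : (Z.abs (dotZ n w' x) < M)%Z).
      { destruct (Z.eq_dec M 1) as [E1|E1].
        - rewrite (dotZ_ext n w' (fun _ => 0%Z)).
          + pose proof (dotZ_bound n (fun _ => 0%Z) x 0 ltac:(intros; lia)). lia.
          + intros i Hi. rewrite Ew' by exact Hi. specialize (Hv i Hi). nia.
        - pose proof (dotZ_bound n (fun i => Z.of_nat N * w' i + 0 * w' i)%Z x (M - 1)) as HB.
          rewrite dotZ_comb in HB.
          assert (Z.abs (Z.of_nat N * dotZ n w' x + 0 * dotZ n w' x) <= (M - 1) * norm1 n x)%Z.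
          { apply HB. intros i Hi. specialize (Hv i Hi). rewrite <- Ew' in Hv by exact Hi.
            replace (Z.of_nat N * w' i + 0 * w' i)%Z with (w' i * Z.of_nat N)%Z by ring.
            rewrite Z.abs_mul, (Z.abs_eq (Z.of_nat N)) by lia. lia. }
          replace (Z.of_nat N * dotZ n w' x + 0 * dotZ n w' x)%Z with
            (dotZ n w' x * Z.of_nat N)%Z in H by ring.
          rewrite Z.abs_mul, (Z.abs_eq (Z.of_nat N)) in H by lia. nia. }
      assert (Eq : (q * dotZ n w x = M * dotZ n v x + dotZ n w' x)%Z).
      { rewrite (dotZ_ext n w' (fun i => q * w i + (- M) * v i)%Z).
        - rewrite dotZ_comb. ring.
        - intros i Hi. rewrite Ew' by exact Hi. ring. }
      rewrite dotZ_comb.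
      assert (Hu : (Z.abs (dotZ n u x) <= c - 1)%Z).
      { pose proof (dotZ_bound n u x _ HUb). unfold c. nia. }
      set (dv := dotZ n v x) in *. set (dw := dotZ n w x) in *.
      set (dw' := dotZ n w' x) in *. set (du := dotZ n u x) in *.
      assert (Hc : (1 <= c)%Z) by (unfold c; nia). clearbody c.
      destruct (Z_lt_ge_dec 0 dv) as [Hp|Hp]; [|destruct (Z_lt_ge_dec dv 0) as [Hp2|Hp2]].
      * assert (0 < q * dw)%Z by nia. assert (0 < dw)%Z by nia.
        assert (0 < c * dv + 1 * du)%Z by nia. lia.
      * assert (q * dw < 0)%Z by nia. assert (dw < 0)%Z by nia.
        assert (c * dv + 1 * du < 0)%Z by nia. lia.
      * assert (dv = 0%Z) as E0 by lia. rewrite E0 in *.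
        replace (c * 0 + 1 * du)%Z with du by ring. rewrite <- V1, <- V2.
        replace dw' with (q * dw)%Z by lia. clear -Hq. nia.
Qed.

(** * Reducing the fan-in of majority gates *)

Fixpoint nsum (g : nat -> nat) (n : nat) : nat :=
  match n with O => 0 | S n => nsum g n + g n end.

Lemma nsum_ext g g' n : (forall i, i < n -> g i = g' i) -> nsum g n = nsum g' n.
Proof.
  induction n as [|n IH]; intros H; simpl; [reflexivity|].
  rewrite IH by (intros; apply H; lia). now rewrite H by lia.
Qed.

Lemma nsum_add g g' n : nsum (fun i => g i + g' i) n = nsum g n + nsum g' n.
Proof. induction n as [|n IH]; simpl; lia. Qed.

Lemma nsum_mul c g n : nsum (fun i => c * g i) n = c * nsum g n.
Proof. induction n as [|n IH]; simpl; lia. Qed.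

Lemma nsum_le g B n : (forall i, i < n -> g i <= B) -> nsum g n <= n * B.
Proof.
  induction n as [|n IH]; intros H; simpl; [lia|].
  specialize (IH ltac:(intros; apply H; lia)). specialize (H n). lia.
Qed.

(** * Iterated addition in radix [Q] *)

Section RadixSums.
Variables (Q N : nat) (c : nat -> nat) (b : nat -> bool).
Hypothesis HQ : 1 <= Q.
Hypothesis HN : N <= Q.

Definition digit (k i : nat) : nat := c i / Q ^ k mod Q.
Definition colsum (k : nat) : nat := nsum (fun i => digit k i * Nat.b2n (b i)) N.
Definition prev_colsum (k : nat) : nat := match k with O => 0 | S k => colsum k end.

Lemma truncated_sum_succ k :
  nsum (fun i => (c i mod Q ^ S k) * Nat.b2n (b i)) N =
  nsum (fun i => (c i mod Q ^ k) * Nat.b2n (b i)) N + Q ^ k * colsum k.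
Proof.
  unfold colsum. rewrite <- nsum_mul, <- nsum_add. apply nsum_ext. intros i _.
  rewrite Nat.pow_succ_r', (Nat.mul_comm Q), Nat.Div0.mod_mul_r. unfold digit. ring.
Qed.

(* Column sums are below Q^2, so the incoming carry is the high digit of the previous column
   plus at most one. *)
Lemma radix_carry k :
  nsum (fun i => (c i mod Q ^ k) * Nat.b2n (b i)) N / Q ^ k =
  prev_colsum k / Q + Nat.b2n (carry
    (fun j => Q <=? colsum j mod Q + prev_colsum j / Q)
    (fun j => Q <=? colsum j mod Q + prev_colsum j / Q + 1) false k).
Proof.
  induction k as [|k IH].
  - cbn [carry prev_colsum Nat.b2n]. rewrite Nat.pow_0_r, Nat.div_1_r, Nat.Div0.div_0_l.
    rewrite (nsum_ext _ (fun _ => 0)) by (intros; now rewrite Nat.mod_1_r).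
    clear. induction N as [|n IHn]; simpl in *; lia.
  - assert (HQk : Q ^ k <> 0) by (apply Nat.pow_nonzero; lia).
    rewrite truncated_sum_succ, Nat.pow_succ_r', (Nat.mul_comm Q (Q ^ k)), <- Nat.Div0.div_div.
    rewrite (Nat.mul_comm (Q ^ k) (colsum k)), Nat.div_add, IH by exact HQk.
    cbn [carry prev_colsum]. set (r := carry _ _ _ k). clearbody r.
    assert (Hh : prev_colsum k / Q + 1 <= Q).
    { assert (Hp : prev_colsum k <= N * (Q - 1)).
      { destruct k as [|j]; cbn [prev_colsum]; [apply Nat.le_0_l|]. apply nsum_le. intros i _.
        assert (digit j i < Q) by (apply Nat.mod_upper_bound; lia).
        destruct (b i); cbn [Nat.b2n]; lia. }
      assert (prev_colsum k / Q < Q); [|lia]. apply Nat.Div0.div_lt_upper_bound. nia. }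
    set (h := prev_colsum k / Q) in *. set (S0 := colsum k).
    pose proof (Nat.div_mod_eq S0 Q) as E. pose proof (Nat.mod_upper_bound S0 Q ltac:(lia)) as Hlo.
    set (hi := S0 / Q) in *. set (lo := S0 mod Q) in *.
    replace (h + Nat.b2n r + S0) with (hi * Q + (lo + h + Nat.b2n r)) by lia.
    rewrite Nat.div_add_l by lia. f_equal.
    destruct (Nat.leb_spec Q (lo + h)), (Nat.leb_spec Q (lo + h + 1)), r; cbn [orb andb Nat.b2n] in *;
      try lia; first [apply Nat.div_small; lia | symmetry; apply Nat.div_unique with (lo + h - Q); lia
        | symmetry; apply Nat.div_unique with (lo + h + 1 - Q); lia ].
Qed.

(** Against a power of the radix, comparison asks whether anything is carried out of the top column,
    either as the high digit of its column sum or as the lookahead carry. Other thresholds are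
    brought to this form by a constant summand. *)
Lemma radix_threshold L : (forall i, i < N -> c i < Q ^ L) ->
  (Q ^ L <=? nsum (fun i => c i * Nat.b2n (b i)) N) =
  (Q <=? prev_colsum L) || carry
    (fun j => Q <=? colsum j mod Q + prev_colsum j / Q)
    (fun j => Q <=? colsum j mod Q + prev_colsum j / Q + 1) false L.
Proof.
  intros Hc. pose proof (radix_carry L) as E.
  rewrite (nsum_ext _ (fun i => c i * Nat.b2n (b i))) in E
    by (intros; rewrite Nat.mod_small; auto).
  set (t := nsum _ N) in *. set (r := carry _ _ _ L) in *. set (s := prev_colsum L) in *.
  assert (HQL : Q ^ L <> 0) by (apply Nat.pow_nonzero; lia).
  apply eq_true_iff_eq. rewrite orb_true_iff, !Nat.leb_le.
  rewrite <- (Nat.div_str_pos_iff t) by exact HQL. rewrite <- (Nat.div_str_pos_iff s) by lia.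
  rewrite E. destruct r; cbn [Nat.b2n]; intuition (try lia; try discriminate).
Qed.
End RadixSums.

(** * Thresholds with weights of polynomially many bits *)

Section BigThresholds.
Variable C : ectx.
Notation A := (C_A C).
Notation K := (C_K C).
Hypothesis Hmaj : C_ok C GMaj = true.

Variables (a b N L : nat) (c : nat -> nat) (f : nat -> A -> bool).
Hypothesis Ha : 1 <= a.
Hypothesis HN : N <= K.
Hypothesis HL : L <= K ^ b.
Hypothesis Hf : forall i, i < N -> hasE C a (f i).

Let col k x := colsum K N c (fun i => f i x) k.
Let prev k x := prev_colsum K N c (fun i => f i x) k.

Lemma hasE_colsum_ge k v : hasE C (a + 6) (fun x => v <=? col k x).
Proof.
  pose proof (C_K2 C) as HK.
  (* A digit is below [K], so a column sum is a plain count over at most [K * K] inputs, each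
     repeated as often as its digit says. *)
  set (copies := fun n => concat (map (fun i => repeat i (digit K c k i)) (seq 0 n))).
  assert (Hc : forall n x, count_true (map (fun i => f i x) (copies n)) =
                 nsum (fun i => digit K c k i * Nat.b2n (f i x)) n).
  { intros n x. unfold copies. induction n as [|n IH]; [reflexivity|].
    rewrite seq_S, map_app, concat_app, map_app, count_true_app, IH. simpl.
    rewrite app_nil_r, map_repeat, count_true_repeat. destruct (f n x); simpl; lia. }
  assert (Hl : forall n, length (copies n) <= n * K).
  { intros n. unfold copies. induction n as [|n IH]; [simpl; lia|].
    rewrite seq_S, map_app, concat_app, length_app. simpl. rewrite app_nil_r, repeat_length.
    assert (digit K c k n < K) by (apply Nat.mod_upper_bound; lia). lia. }
  assert (Hi : forall n i, In i (copies n) -> i < n).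
  { intros n i Hin. unfold copies in Hin. apply in_concat in Hin. destruct Hin as (l & Hl' & Hin).
    apply in_map_iff in Hl'. destruct Hl' as (j & <- & Hj). apply in_seq in Hj.
    apply repeat_spec in Hin. lia. }
  eapply hasE_ext; [|replace (a + 6) with (a + 2 + 4) by lia;
    apply (hasE_threshold C a 2 f (copies N) v Hmaj Ha)].
  - intros x. cbv beta. now rewrite Hc.
  - simpl. rewrite Nat.mul_1_r. specialize (Hl N). nia.
  - intros i Hin. apply Hf. now apply Hi.
Qed.

Lemma hasE_prev_ge k v : hasE C (a + 6) (fun x => v <=? prev k x).
Proof.
  destruct k as [|k]; [apply (hasE_const' C (a + 6) (v <=? 0)); lia | apply hasE_colsum_ge].
Qed.

Lemma hasE_columns_rel k (rel : nat -> nat -> bool) :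
  hasE C (a + 16) (fun x => rel (col k x) (prev k x)).
Proof.
  pose proof (C_K2 C) as HK.
  assert (Hb : forall k x, col k x < K * K).
  { intros k' x. unfold col, colsum.
    assert (nsum (fun i => digit K c k' i * Nat.b2n (f i x)) N <= N * (K - 1)); [|nia].
    apply nsum_le. intros i _. assert (digit K c k' i < K) by (apply Nat.mod_upper_bound; lia).
    destruct (f i x); cbn [Nat.b2n]; lia. }
  assert (Hp : forall k x, prev k x < K * K).
  { intros [|k'] x; [cbn; nia | apply (Hb k')]. }
  eapply hasE_ext; [|replace (a + 16) with ((a + 9) + 2 * 2 + 3) by lia;
    apply (hasE_table2 C (a + 9) 2 (seq 0 (K * K)) (seq 0 (K * K))
     (fun u x => (u <=? col k x) && negb (u + 1 <=? col k x))
     (fun v x => (v <=? prev k x) && negb (v + 1 <=? prev k x)) rel)].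
  - intros x. apply eq_true_iff_eq. rewrite existsb_exists. split.
    + intros ([u v] & Hin & Huv). apply filter_In in Hin. simpl in Hin, Huv.
      rewrite !andb_true_iff, !negb_true_iff, !Nat.leb_le, !Nat.leb_gt in Huv.
      replace (col k x) with u by lia. replace (prev k x) with v by lia. tauto.
    + intros Hr. exists (col k x, prev k x). split.
      * apply filter_In. split; [|exact Hr]. apply in_prod; apply in_seq.
        -- specialize (Hb k x). lia.
        -- specialize (Hp k x). lia.
      * cbn [fst snd]. rewrite !andb_true_iff, !negb_true_iff, !Nat.leb_le, !Nat.leb_gt. lia.
  - rewrite length_seq. simpl. lia.
  - rewrite length_seq. simpl. lia.
  - intros u _. replace (a + 9) with (a + 7 + 2) by lia. apply hasE_and.
    + eapply hasE_mono; [|apply hasE_colsum_ge]. lia.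
    + replace (a + 7) with (a + 6 + 1) by lia. apply hasE_not. apply hasE_colsum_ge.
  - intros v _. replace (a + 9) with (a + 7 + 2) by lia. apply hasE_and.
    + eapply hasE_mono; [|apply hasE_prev_ge]. lia.
    + replace (a + 7) with (a + 6 + 1) by lia. apply hasE_not. apply hasE_prev_ge.
Qed.

Lemma hasE_big_threshold : (forall i, i < N -> c i < K ^ L) ->
  hasE C (a + 2 * b + 24) (fun x => K ^ L <=? nsum (fun i => c i * Nat.b2n (f i x)) N).
Proof.
  intros Hc. pose proof (C_K2 C) as HK.
  eapply hasE_ext; [intros x; symmetry; apply radix_threshold; auto; lia|].
  replace (a + 2 * b + 24) with (a + 2 * b + 22 + 2) by lia. apply hasE_or.
  - eapply hasE_mono; [|apply (hasE_prev_ge L)]. lia.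
  - replace (a + 2 * b + 22) with ((a + 16) + 2 * b + 6) by lia.
    apply (hasE_carry C (a + 16) b (fun j x => K <=? col j x mod K + prev j x / K)
      (fun j x => K <=? col j x mod K + prev j x / K + 1) false L); [lia | exact HL |].
    intros i _. split.
    + apply (hasE_columns_rel i (fun u v => K <=? u mod K + v / K)).
    + apply (hasE_columns_rel i (fun u v => K <=? u mod K + v / K + 1)).
Qed.
End BigThresholds.

(** The threshold becomes the weight of an extra coordinate [W] with constant input 1, so that the
    gate is a sign test. The radius [W + 2] exceeds the norm of a 0/1 vector with [W + 1]
    coordinates. Keeping zero weights zero matters for depth: the new gate must not read wires
    deeper than its own inputs. *)
Lemma majority_small_weights (W : nat) (l : list nat) : (forall i, In i l -> i < W) ->
  exists u : nat -> Z,
    (forall i, i <= W -> (Z.abs (u i) + 1 <= Z.of_nat (W + 2) ^ Z.of_nat ((W + 3) * (W + 1)))%Z) /\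
    (forall i, i < W -> ~ In i l -> u i = 0%Z) /\
    forall y : nat -> bool,
      gate_fn GMaj (map y l) = (0 <? psum (fun i => u i * Z.b2z (y i)) W + u W)%Z.
Proof.
  intros Hl.
  set (w := fun i => if i <? W then (Z.of_nat (count_occ Nat.eq_dec l i) * 2)%Z
                     else (- Z.of_nat (length l))%Z).
  destruct (small_weights (S W) (W + 2) (S W) ltac:(lia) w) as (u & U1 & U2 & U3).
  { unfold support. etransitivity; [apply filter_length_le|]. rewrite length_seq. lia. }
  exists u. split; [|split].
  - intros i Hi. specialize (U1 i ltac:(lia)).
    replace ((W + 3) * (W + 1)) with ((S W + 2) * S W) by lia. exact U1.
  - intros i Hi Hn. apply U2; [lia|]. unfold w. destruct (Nat.ltb_spec i W); [|lia].
    apply (count_occ_not_In Nat.eq_dec) in Hn. rewrite Hn. reflexivity.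
  - intros y. set (x := fun i => if i <? W then Z.b2z (y i) else 1%Z).
    assert (Hx : forall k z, k <= W -> psum (fun i => z i * x i)%Z k =
                 psum (fun i => z i * Z.b2z (y i))%Z k).
    { intros k z Hk. apply psum_ext. intros i Hi. unfold x. destruct (Nat.ltb_spec i W); [reflexivity | lia]. }
    assert (HxW : x W = 1%Z) by (unfold x; destruct (Nat.ltb_spec W W); [lia | reflexivity]).
    destruct (U3 x) as [V _].
    { unfold norm1. assert (forall k, (psum (fun i => Z.abs (x i)) k <= Z.of_nat k)%Z) as Hk.
      { induction k as [|k IH]; simpl; [lia|]. unfold x at 2.
        destruct (k <? W); [destruct (y k); simpl|]; lia. }
      specialize (Hk (S W)). lia. }
    unfold dotZ in V. cbn [psum] in V. rewrite !Hx, HxW, !Z.mul_1_r in V by lia.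
    apply eq_true_iff_eq. rewrite Z.ltb_lt, <- V.
    rewrite (psum_ext _ (fun i => Z.of_nat (count_occ Nat.eq_dec l i) * (2 * Z.b2z (y i)))%Z).
    + rewrite psum_count_occ by exact Hl.
      rewrite fold_count_true. unfold w. destruct (Nat.ltb_spec W W); [lia|].
      cbn [gate_fn]. rewrite Nat.ltb_lt, length_map. lia.
    + intros i Hi. unfold w. destruct (Nat.ltb_spec i W); lia.
Qed.

Lemma psum_literals (u : nat -> Z) (y : nat -> bool) W :
  psum (fun i => u i * Z.b2z (y i))%Z W =
  (Z.of_nat (nsum (fun i => Z.to_nat (Z.abs (u i)) *
     Nat.b2n (if (u i <? 0)%Z then negb (y i) else y i))%nat W)
   - psum (fun i => Z.max 0 (- u i)) W)%Z.
Proof.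
  induction W as [|W IH]; simpl; [reflexivity|]. rewrite IH.
  destruct (Z.ltb_spec (u W) 0), (y W); cbn [negb Nat.b2n Z.b2z]; lia.
Qed.

Lemma hasE_majority C (W : nat) (l : list nat) :
  C_ok C GMaj = true -> (forall i, In i l -> i < W) -> (forall i, In i l -> C_V C i) ->
  W + 3 <= C_K C -> hasE C 30 (fun x => gate_fn GMaj (map (C_val C x) l)).
Proof.
  intros Hmaj Hl HV HK.
  destruct (majority_small_weights W l Hl) as (u & U1 & U2 & U3).
  (* Each weight fits in [L - 1] digits of radix [K]; the last digit makes room for sums of [W + 1]
     weights, hence for [th]. *)
  set (K := C_K C) in *. set (L := (W + 3) * (W + 1) + 1).
  set (th := (psum (fun i => Z.max 0 (- u i)) W - u W + 1)%Z).
  assert (HU : forall i, i <= W -> (Z.abs (u i) + 1 <= Z.of_nat K ^ Z.of_nat (L - 1))%Z).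
  { intros i Hi. etransitivity; [now apply U1|]. replace (L - 1) with ((W + 3) * (W + 1)) by (unfold L; lia).
    apply Z.pow_le_mono_l. lia. }
  set (U := (Z.of_nat K ^ Z.of_nat (L - 1))%Z) in *.
  assert (HKL : (Z.of_nat (K ^ L) = Z.of_nat K * U)%Z).
  { rewrite Nat2Z.inj_pow. unfold U. rewrite <- Z.pow_succ_r by lia. f_equal. unfold L. lia. }
  assert (HU1 : (1 <= U)%Z) by (specialize (HU W (le_n W)); lia).
  assert (Hth : (th <= Z.of_nat (K ^ L))%Z).
  { assert (Hs : forall k, k <= W -> (psum (fun i => Z.max 0 (- u i)) k <= Z.of_nat k * (U - 1))%Z).
    { induction k as [|k IHk]; intros Hk; cbn [psum]; [lia|].
      specialize (IHk ltac:(lia)). specialize (HU k ltac:(lia)). rewrite Nat2Z.inj_succ, Z.mul_succ_l; lia. }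
    specialize (Hs W (le_n W)). specialize (HU W (le_n W)). unfold th. rewrite HKL. nia. }
  set (T := fun x => nsum (fun i => Z.to_nat (Z.abs (u i)) *
      Nat.b2n (if (u i <? 0)%Z then negb (C_val C x i) else C_val C x i)) W).
  assert (Hgate : forall x, gate_fn GMaj (map (C_val C x) l) = (th <=? Z.of_nat (T x))%Z).
  { intros x. rewrite U3, psum_literals. fold (T x). apply eq_true_iff_eq.
    rewrite Z.ltb_lt, Z.leb_le. unfold th. lia. }
  destruct (Z_le_gt_dec th 0) as [Hneg|Hpos].
  { eapply hasE_ext; [|apply (hasE_const' C 30 true); lia].
    intros x. rewrite Hgate. symmetry. apply Z.leb_le. lia. }
  (* A constant true input of weight [K ^ L - th] moves the threshold to [K ^ L]. Literals cost 2
     and [L <= K ^ 2], which gives [2 + 2 * 2 + 24 = 30]. *)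
  set (c := fun i => if i <? W then Z.to_nat (Z.abs (u i)) else K ^ L - Z.to_nat th).
  set (f := fun i (x : C_A C) => if i <? W then
      (if (u i =? 0)%Z then false else if (u i <? 0)%Z then negb (C_val C x i) else C_val C x i)
      else true).
  eapply hasE_ext; [|apply (hasE_big_threshold C Hmaj 2 2 (S W) L c f)]; fold K.
  - intros x. rewrite Hgate. cbn [nsum].
    rewrite (nsum_ext _ (fun i => Z.to_nat (Z.abs (u i)) *
      Nat.b2n (if (u i <? 0)%Z then negb (C_val C x i) else C_val C x i))).
    + fold (T x). unfold c, f. destruct (Nat.ltb_spec W W); [lia|]. cbn [Nat.b2n].
      apply eq_true_iff_eq. rewrite Nat.leb_le, Z.leb_le. lia.
    + intros i Hi. unfold c, f. destruct (Nat.ltb_spec i W); [|lia].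
      destruct (Z.eqb_spec (u i) 0) as [->|]; reflexivity.
  - lia.
  - lia.
  - unfold L. simpl. nia.
  - intros i Hi. unfold f. destruct (Nat.ltb_spec i W) as [HiW|]; [|apply hasE_const'; lia].
    destruct (Z.eqb_spec (u i) 0) as [|Hne]; [apply hasE_const'; lia|].
    assert (Hin : In i l).
    { destruct (in_dec Nat.eq_dec i l) as [|Hn]; auto. exfalso. apply Hne. now apply U2. }
    destruct (u i <? 0)%Z.
    + apply (hasE_not C 1). apply hasE_var. auto.
    + apply hasE_var. auto.
  - intros i Hi. unfold c. destruct (Nat.ltb_spec i W) as [HiW|].
    + specialize (HU i ltac:(lia)). apply Nat2Z.inj_lt. rewrite HKL. nia.
    + assert (1 <= K ^ L) by (apply Nat2Z.inj_le; rewrite HKL; nia). lia.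
Qed.

(** AND and OR are idempotent, so removing duplicates bounds their fan-in by the number of wires;
    only majority sees multiplicities. *)
Lemma hasE_circuit_gate C (W : nat) (g : gate) :
  C_ok C GMaj = true -> (gk g = GNot -> length (gin g) = 1) ->
  (forall i, In i (gin g) -> i < W) -> (forall i, In i (gin g) -> C_V C i) ->
  W + 3 <= C_K C -> hasE C 30 (fun x => gate_fn (gk g) (map (C_val C x) (gin g))).
Proof.
  intros Hmaj Hnot Hl HV HK.
  assert (Hnd : length (nodup Nat.eq_dec (gin g)) <= C_K C ^ 1).
  { rewrite Nat.pow_1_r. etransitivity; [|exact (Nat.le_trans _ _ _ (Nat.le_add_r W 3) HK)].
    rewrite <- (length_seq W 0). apply NoDup_incl_length; [apply NoDup_nodup|].
    intros i Hi. apply nodup_In in Hi. apply in_seq. specialize (Hl i Hi). lia. }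
  assert (Hvar : forall i, In i (nodup Nat.eq_dec (gin g)) -> hasE C 0 (fun x => C_val C x i)).
  { intros i Hi. apply nodup_In in Hi. apply hasE_var. auto. }
  destruct (gk g) eqn:Eg.
  - eapply hasE_ext; [|eapply hasE_mono; [|apply (hasE_bigand C 0 1 (fun i x => C_val C x i)
      (nodup Nat.eq_dec (gin g)) Hnd Hvar)]; lia].
    intros x. cbn [gate_fn]. apply eq_true_iff_eq. rewrite !forallb_forall. split.
    + intros H b Hb. apply in_map_iff in Hb. destruct Hb as (i & <- & Hi). apply H. now apply nodup_In.
    + intros H i Hi. apply nodup_In in Hi. apply H. now apply in_map.
  - eapply hasE_ext; [|eapply hasE_mono; [|apply (hasE_bigor C 0 1 (fun i x => C_val C x i)
      (nodup Nat.eq_dec (gin g)) Hnd Hvar)]; lia].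
    intros x. cbn [gate_fn]. apply eq_true_iff_eq. rewrite !existsb_exists. split.
    + intros (i & Hi & H). apply nodup_In in Hi. exists (C_val C x i). split; [now apply in_map | exact H].
    + intros (b & Hb & H). apply in_map_iff in Hb. destruct Hb as (i & <- & Hi).
      exists i. split; [now apply nodup_In | exact H].
  - specialize (Hnot eq_refl). destruct (gin g) as [|i [|j l]] eqn:E; try discriminate.
    apply (hasE_mono C (0 + 1)); [lia|]. apply (hasE_not C 0 (fun x => C_val C x i)).
    apply hasE_var. apply HV. now left.
  - apply (hasE_majority C W); auto.
Qed.

(** * Replacing the gates of a threshold circuit *)

Lemma circ_depth_snoc n gs g : circ_depth n gs <= circ_depth n (gs ++ [g]).
Proof. unfold circ_depth. rewrite depth_wires_snoc, list_max_app. lia. Qed.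

(** Depth is tracked wire by wire: the expression for a gate starts at the depth of that gate's own
    inputs, and a bound on the whole circuit would be too weak for the induction. *)
Lemma fan_in_reduction n K gs : circ_wf tc_ok n gs -> n + length gs + 3 <= K ->
  exists gs' (pi : nat -> nat), circ_wf tc_ok n gs' /\ length gs' <= length gs * K ^ 30 /\
    (forall g, In g gs' -> length (gin g) <= K ^ 30) /\
    (forall w, wdepth n gs' w <= 30 * circ_depth n gs) /\
    forall i, i < n + length gs -> pi i < n + length gs' /\
      wdepth n gs' (pi i) <= 30 * wdepth n gs i /\
      forall x, length x = n -> wire gs' x (pi i) = wire gs x i.
Proof.
  induction gs as [|g gs IH] using rev_ind; intros Hwf HK.
  - exists [], (fun i => i). split; [exact Hwf|]. split; [simpl; lia|]. split; [easy|]. split.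
    + intros w. pose proof (wdepth_le_circ n [] w) as H.
      destruct (lt_dec w n); [rewrite wdepth_input; lia | rewrite wdepth_out; simpl; lia].
    + intros i Hi. simpl in Hi. rewrite wdepth_input by lia. simpl. split; [lia|]. split; [lia|].
      reflexivity.
  - rewrite length_app in HK. simpl in HK.
    assert (Hwf0 := circ_wf_prefix _ _ _ _ Hwf).
    destruct IH as (gs' & pi & W' & L' & G' & D' & P'); [exact Hwf0 | lia |].
    assert (Hg : nth_error (gs ++ [g]) (length gs) = Some g).
    { rewrite nth_error_app2, Nat.sub_diag by lia. reflexivity. }
    destruct (Hwf _ _ Hg) as (_ & Hin & Hnot).
    assert (HK2 : 2 <= K) by lia.
    set (C := mkEctx tc_ok (fun i => In i (gin g)) (nat -> bool) (fun v i => v i) K HK2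
                eq_refl eq_refl eq_refl).
    destruct (hasE_circuit_gate C (n + length gs) g eq_refl Hnot Hin (fun i H => H))
      as (e & We & Se & De & Ve); [simpl; lia|].
    unfold C in We, Se, Ve. cbn [C_ok C_V C_val C_K] in We, Se, Ve.
    set (D := list_max (map (wdepth n gs) (gin g))).
    destruct (compile_expr tc_ok (fun i => In i (gin g)) n (30 * D) pi e We gs' W')
      as (gs'' & w0 & HE & Hw0 & Hd0 & Hv0).
    { intros i Hi. destruct (P' i (Hin i Hi)) as (H1 & H2 & _). split; [exact H1|].
      pose proof (list_max_in _ _ (in_map (wdepth n gs) _ _ Hi)). fold D in H. lia. }
    assert (HDg : wdepth n (gs ++ [g]) (n + length gs) = S D).
    { apply wdepth_snoc. }
    exists gs'', (fun i => if i =? n + length gs then w0 else pi i).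
    pose proof (extends_length _ _ _ _ _ _ HE) as HL.
    split; [eapply extends_wf; eauto|]. split; [|split; [|split]].
    + rewrite length_app. simpl length. lia.
    + intros h Hh. destruct HE as (t & -> & _ & _ & _ & Ht). apply in_app_or in Hh.
      destruct Hh as [Hh|Hh]; [now apply G'|]. specialize (Ht h Hh). lia.
    + intros w. destruct (lt_dec w (n + length gs')) as [Hlt|Hge].
      * erewrite extends_wdepth by eauto. specialize (D' w).
        pose proof (circ_depth_snoc n gs g). lia.
      * destruct HE as (t & _ & _ & _ & Hd & _). specialize (Hd w ltac:(lia)).
        pose proof (wdepth_le_circ n (gs ++ [g]) (n + length gs)). lia.
    + intros i Hi. rewrite length_app in Hi. simpl in Hi.
      destruct (Nat.eqb_spec i (n + length gs)) as [->|Hne].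
      * split; [exact Hw0|]. split; [lia|]. intros x Hx.
        rewrite Hv0, (wire_gate _ _ _ _ _ _ Hwf Hx Hg) by exact Hx. etransitivity; [|exact (Ve (wire (gs ++ [g]) x))].
        eapply eeval_ext; [exact We|]. intros i Hi'. cbv beta in Hi'.
        destruct (P' i (Hin i Hi')) as (_ & _ & H3). rewrite H3 by exact Hx.
        symmetry. apply wire_app. rewrite Hx. now apply Hin.
      * destruct (P' i ltac:(lia)) as (H1 & H2 & H3). split; [lia|]. split.
        -- rewrite (extends_wdepth _ _ _ _ _ _ (pi i) HE), wdepth_app by lia. exact H2.
        -- intros x Hx. erewrite extends_wire by eauto. rewrite H3 by exact Hx.
           symmetry. apply wire_app. lia.
Qed.

Lemma threshold_circuit_small_fan_in n K gs (L : lang) :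
  circ_wf tc_ok n gs -> n + length gs + 3 <= K ->
  (forall x, length x = n -> circ_out gs x = L x) ->
  exists gs', circ_wf tc_ok n gs' /\ length gs' <= length gs * K ^ 30 + 2 /\
    (forall g, In g gs' -> length (gin g) <= K ^ 30 + 2) /\
    circ_depth n gs' <= 30 * circ_depth n gs + 1 /\
    (forall x, length x = n -> circ_out gs' x = L x).
Proof.
  intros Hwf HK HL. destruct (fan_in_reduction n K gs Hwf HK) as (gs' & pi & W & S & G & D & P).
  set (o := n + length gs - 1).
  (* A final one-input OR brings the output to the last wire. Without any wire, the empty OR gives
     the default [false] of [circ_out]. *)
  set (l := if n + length gs =? 0 then [] else [EVar o]).
  assert (Hl : forall e, In e l -> e = EVar o /\ n + length gs <> 0).
  { intros e He. unfold l in He. destruct (Nat.eqb_spec (n + length gs) 0); [destruct He|].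
    destruct He as [<-|[]]. auto. }
  assert (Hsz : esize (EGate GOr l) <= 2) by (unfold l; destruct (_ =? _); simpl; lia).
  assert (Hdp : edepth (EGate GOr l) <= 1) by (unfold l; destruct (_ =? _); simpl; lia).
  destruct (compile_last tc_ok (fun i => i < n + length gs) n (30 * circ_depth n gs) pi GOr l gs')
    as (gs'' & (HE & _ & _ & Hv) & _).
  - constructor; [reflexivity | discriminate |]. intros e He.
    destruct (Hl e He) as [-> Hne]. constructor. unfold o. lia.
  - exact W.
  - intros i Hi. destruct (P i Hi) as (H1 & _ & _). split; [exact H1 | apply D].
  - exists gs''. pose proof (extends_length _ _ _ _ _ _ HE) as HLen.
    split; [eapply extends_wf; eauto|]. split; [lia|]. split; [|split].
    + intros g Hg. destruct HE as (t & -> & _ & _ & _ & Ht). apply in_app_or in Hg.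
      destruct Hg as [Hg|Hg]; [specialize (G g Hg) | specialize (Ht g Hg)]; lia.
    + apply circ_depth_le. intros w. destruct (lt_dec w (n + length gs')) as [Hlt|Hge].
      * erewrite extends_wdepth by eauto. specialize (D w). lia.
      * destruct HE as (t & _ & _ & _ & Hd & _). specialize (Hd w ltac:(lia)). lia.
    + intros x Hx. rewrite <- HL, !circ_out_wire, Hx, Hv by exact Hx. fold o. cbn [eeval].
      unfold l. destruct (Nat.eqb_spec (n + length gs) 0) as [E0|Hne]; simpl.
      * unfold wire. symmetry. apply nth_overflow. rewrite eval_wires_length. lia.
      * rewrite orb_false_r. destruct (P o) as (_ & _ & H3); [unfold o; lia|]. now apply H3.
Qed.

(** * The equivalence of the classes *)

Lemma lg_pos n : 2 <= n -> 1 <= lg n.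
Proof. intros H. change 1 with (Nat.log2 2). now apply Nat.log2_le_mono. Qed.

Lemma lg_pow_pos n k : 2 <= n -> 1 <= lg n ^ k.
Proof. intros H. apply lg_pos in H. pose proof (Nat.pow_nonzero (lg n) k). lia. Qed.

Lemma lg_le n : lg n <= n.
Proof. apply Nat.log2_le_lin. lia. Qed.

Lemma pow_base2 n c : 2 <= n -> 2 ^ c <= n ^ c.
Proof. intros H. now apply Nat.pow_le_mono_l. Qed.

Lemma const_le_pow n c : 2 <= n -> c <= n ^ c.
Proof. intros H. pose proof (Nat.pow_gt_lin_r 2 c). pose proof (pow_base2 n c H). lia. Qed.

Lemma npow_mono n a b : 2 <= n -> a <= b -> n ^ a <= n ^ b.
Proof. intros H1 H2. apply Nat.pow_le_mono_r; lia. Qed.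

Lemma npow_pos n a : 2 <= n -> 1 <= n ^ a.
Proof. intros H. pose proof (Nat.pow_nonzero n a). lia. Qed.

Lemma range_size_le p c n : 2 <= n -> p <= c * lg n ->
  Z.to_nat (2 * maxZ p + 1) <= n ^ (2 * c + 1).
Proof.
  intros Hn Hp. unfold maxZ.
  replace (2 ^ (2 * Z.of_nat p))%Z with (Z.of_nat (2 ^ (2 * p))).
  2:{ rewrite Nat2Z.inj_pow. f_equal. lia. }
  transitivity (2 * 2 ^ (2 * p)); [lia|].
  assert (H : 2 ^ (2 * p) <= n ^ (2 * c)).
  { transitivity (2 ^ (lg n * (2 * c))); [apply Nat.pow_le_mono_r; nia|].
    rewrite Nat.pow_mul_r. apply Nat.pow_le_mono_l. apply Nat.log2_spec. lia. }
  rewrite Nat.pow_add_r, Nat.pow_1_r, Nat.mul_comm. apply Nat.mul_le_mono; lia.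
Qed.

(** The cost [sums c] of a clamped sum may depend on the constant of the precision bound but not on
    [n]; in this direction, the two equalities differ only in how that cost is achieved. *)
Lemma loop_to_circuits ok k (Sf : nat -> nat) (sums : nat -> nat) L :
  ok GAnd = true -> ok GOr = true -> ok GNot = true ->
  (forall n, 2 <= n -> Sf n <= lg n) ->
  (forall c n p C, C_ok C = ok -> 2 <= n -> p <= c * Sf n ->
     Z.to_nat (2 * maxZ p + 1) <= C_K C -> clamped_sums C (maxZ p) (sums c)) ->
  LoopPoly (fun n => lg n ^ k) Sf L -> CircuitClass ok k L.
Proof.
  intros Oa Oo On HS Hsums (e & c & n0 & H).
  (* [n ^ q] has to bound embedding size and hidden width (exponent [c + e]), loop iterations
     ([c + k]) and the number of grid values ([2 c + 1]). *)
  set (s := sums c). set (a := 12 + s + c * (60 + 8 * s)). set (q := 3 * c + e + k + 1).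
  exists (q * (a + 6) + (c + 3) * a), (n0 + 2). intros n.
  destruct (le_lt_dec (n0 + 2) n) as [Hn|Hn].
  2:{ destruct (boolean_function_circuit ok n L Oa Oo On) as (gs & G1 & G2).
      exists gs. split; [exact G1|]. split; [exact G2|]. lia. }
  destruct (H n) as (M & Hdec & Hb). destruct Hb as (Bd & Bw & BH & Bl & BT & Bp); [lia|].
  assert (Hn2 : 2 <= n) by lia.
  pose proof (const_le_pow n c Hn2) as Hc.
  assert (HD : c * n ^ e <= n ^ (c + e)) by (rewrite Nat.pow_add_r; now apply Nat.mul_le_mono_r).
  assert (HT : c * lg n ^ k <= n ^ (c + k)).
  { rewrite Nat.pow_add_r. apply Nat.mul_le_mono; [exact Hc|]. apply Nat.pow_le_mono_l, lg_le. }
  assert (Hq : forall r, r <= q -> n ^ r <= n ^ q) by (intros; now apply npow_mono).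
  assert (HK2 : 2 <= n ^ q).
  { specialize (Hq 1 ltac:(unfold q; lia)). rewrite Nat.pow_1_r in Hq. lia. }
  assert (HnK : n <= n ^ q).
  { specialize (Hq 1 ltac:(unfold q; lia)). rewrite Nat.pow_1_r in Hq. lia. }
  assert (HMK : Z.to_nat (2 * maxZ (lt_prec M) + 1) <= n ^ q).
  { etransitivity; [apply (range_size_le _ c n Hn2)|apply Hq; unfold q; lia].
    etransitivity; [exact Bp|]. apply Nat.mul_le_mono_l. auto. }
  assert (HdK : lt_d M <= n ^ q) by (specialize (Hq (c + e) ltac:(unfold q; lia)); lia).
  assert (HTK : lt_iters M <= n ^ q) by (specialize (Hq (c + k) ltac:(unfold q; lia)); lia).
  destruct (looped_transformer_circuit ok M n (n ^ q) s L Oa Oo On HK2)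
    as (gs & G1 & G2 & G3 & G4); auto; try lia.
  { specialize (Hq (c + e) ltac:(unfold q; lia)). lia. }
  { specialize (Hq c ltac:(unfold q; lia)). lia. }
  { intros C EC EK. apply (Hsums c n); auto. now rewrite EK. }
  exists gs. split; [exact G1|]. split; [exact G2|]. intros _.
  set (a0 := 12 + s + length (lt_layers M) * (60 + 8 * s)) in *.
  assert (Ha : a0 <= a) by (unfold a0, a; nia). clearbody a0.
  set (R := Z.to_nat (2 * maxZ (lt_prec M) + 1)) in *. set (K := n ^ q) in *. split.
  - etransitivity; [exact G3|].
    transitivity (K ^ (a + 6)).
    2:{ unfold K. rewrite <- Nat.pow_mul_r. apply npow_mono; lia. }
    assert (HKa : K ^ a0 <= K ^ a) by (apply npow_mono; lia).
    assert (H1 : 1 <= K ^ a) by (apply npow_pos; exact HK2).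
    assert (HB : n * lt_d M * R <= K * K * K).
    { apply Nat.mul_le_mono; [apply Nat.mul_le_mono|]; assumption. }
    assert (HST : S (lt_iters M) <= K * K) by nia.
    assert (Hmain : S (lt_iters M) * (n * lt_d M * R * K ^ a0) <= K * K * (K * K * K * K ^ a)).
    { apply Nat.mul_le_mono; [exact HST|]. now apply Nat.mul_le_mono. }
    rewrite Nat.pow_add_r. change (K ^ 6) with (K * (K * (K * (K * (K * (K * 1)))))).
    set (X := K * K * (K * K * K * K ^ a)) in *.
    assert (HX : K ^ a * (K * (K * (K * (K * (K * (K * 1)))))) = K * X) by (unfold X; ring).
    rewrite HX. assert (K ^ a + 1 <= X); [|nia].
    assert (4 * K ^ a <= X); [|lia]. unfold X.
    assert (4 <= K * K) by nia. assert (K ^ a <= K * K * K * K ^ a) by nia. nia.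
  - etransitivity; [exact G4|]. pose proof (lg_pow_pos n k Hn2) as Hlg.
    set (l := lg n ^ k) in *.
    transitivity ((c * l + 3) * a); [apply Nat.mul_le_mono; lia|].
    transitivity ((c + 3) * a * l); [nia|]. apply Nat.mul_le_mono_r. lia.
Qed.

Lemma clamped_sums_mono C M s s' : s <= s' -> clamped_sums C M s -> clamped_sums C M s'.
Proof.
  intros Hs H a n z Ha Hn Hz v. eapply hasE_mono; [|apply (H a n z Ha Hn Hz v)]. lia.
Qed.

Lemma maxZ_mono p q : p <= q -> (maxZ p <= maxZ q)%Z.
Proof.
  intros H. unfold maxZ. apply Z.sub_le_mono_r. apply Z.pow_le_mono_r; lia.
Qed.

Lemma loop_to_AC k L : LoopPoly (fun n => lg n ^ k) (fun _ => 1) L -> AC k L.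
Proof.
  apply loop_to_circuits with (sums := fun c => 5 + 42 * Z.to_nat (maxZ c)); auto using lg_pos.
  intros c n p C _ _ Hp HK. rewrite Nat.mul_1_r in Hp.
  eapply clamped_sums_mono; [|apply clamped_sums_constant_range; [apply maxZ_nonneg | exact HK]].
  pose proof (maxZ_mono p c Hp). lia.
Qed.

Lemma loop_to_TC k L : LoopPoly (fun n => lg n ^ k) lg L -> TC k L.
Proof.
  apply loop_to_circuits with (sums := fun _ => 21); auto.
  intros c n p C HC _ _ HK. apply clamped_sums_majority; [apply maxZ_nonneg | exact HK |].
  now rewrite HC.
Qed.

Lemma AC_to_loop k L : AC k L -> LoopPoly (fun n => lg n ^ k) (fun _ => 1) L.
Proof.
  intros (c & n0 & H). exists (c + 1), (2 * c + 13), (n0 + 2). intros n.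
  destruct (H n) as (gs & G1 & G2 & G3).
  (* Without majority gates all rules are NOR, and precision 2 holds the small constants of the
     layer. *)
  exists (netLT (2 * (n + length gs)) n 2 (2 * circ_depth n gs + 2) (circ_rules n gs)
            (n + length gs - 1)).
  split.
  - apply (circuit_looped_transformer ac_ok); auto.
    intros g Hg Ek. apply In_nth_error in Hg. destruct Hg as (j & Hj).
    destruct (G1 j g Hj) as (Hok & _). rewrite Ek in Hok. discriminate.
  - intros Hn. cbn [lt_d lt_w lt_H lt_prec lt_iters lt_layers netLT length].
    destruct G3 as [S1 S2]; [lia|]. unfold circ_size in S1.
    pose proof (lg_pow_pos n k ltac:(lia)) as Hlg.
    assert (n <= n ^ (c + 1)).
    { rewrite <- (Nat.pow_1_r n) at 1. apply npow_mono; lia. }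
    assert (n ^ c <= n ^ (c + 1)) by (apply npow_mono; lia).
    set (l := lg n ^ k) in *. set (P := n ^ (c + 1)) in *.
    repeat apply conj; try lia; nia.
Qed.

Lemma log2_pow_le n m : Nat.log2 (n ^ m) <= m * S (lg n).
Proof.
  destruct n as [|n].
  - destruct m; [apply Nat.le_0_l|]. rewrite Nat.pow_0_l by lia. apply Nat.le_0_l.
  - rewrite <- (Nat.log2_pow2 (m * S (lg (S n)))) by lia. apply Nat.log2_le_mono.
    rewrite Nat.mul_comm, Nat.pow_mul_r. apply Nat.pow_le_mono_l.
    apply Nat.lt_le_incl, Nat.log2_spec. lia.
Qed.

Lemma TC_to_loop k L : TC k L -> LoopPoly (fun n => lg n ^ k) lg L.
Proof.
  (* For large [n], [K = n + length gs + 3] is at most [n ^ (c + 3)], so [n ^ r] bounds [K ^ 30]. *)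
  intros (c & n0 & H). set (r := (c + 3) * 30).
  exists (c + r + 1), (60 * c + 2 * r + 40), (n0 + 2). intros n.
  destruct (H n) as (gs & G1 & G2 & G3).
  set (K := n + length gs + 3).
  destruct (threshold_circuit_small_fan_in n K gs L G1 (le_n _) G2) as (gs' & F1 & F2 & F3 & F4 & F5).
  (* The fan-in is at most [F + 2], and a majority rule needs [2 ^ p] to be at least three times the
     fan-in plus 3. As [F] is polynomial in [n], [p] is O(log n). *)
  set (F := K ^ 30) in *. set (p := S (Nat.log2 (3 * (F + 2) + 3))).
  exists (netLT (2 * (n + length gs')) n p (2 * circ_depth n gs' + 2) (circ_rules n gs')
            (n + length gs' - 1)).
  split.
  - apply (circuit_looped_transformer tc_ok); auto.
    + unfold p. assert (1 <= Nat.log2 (3 * (F + 2) + 3)); [|lia].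
      change 1 with (Nat.log2 2). apply Nat.log2_le_mono. lia.
    + intros g Hg _. specialize (F3 g Hg). unfold p.
      pose proof (Nat.log2_spec (3 * (F + 2) + 3) ltac:(lia)). lia.
  - intros Hn. cbn [lt_d lt_w lt_H lt_prec lt_iters lt_layers netLT length].
    assert (Hn2 : 2 <= n) by lia.
    destruct G3 as [S1 S2]; [lia|]. unfold circ_size in S1.
    pose proof (lg_pow_pos n k Hn2) as Hlg. pose proof (lg_pos n Hn2) as Hlg1.
    assert (HF : F <= n ^ r).
    { unfold F, r. rewrite Nat.pow_mul_r. apply Nat.pow_le_mono_l. unfold K.
      assert (n <= n ^ (c + 1)) by (rewrite <- (Nat.pow_1_r n) at 1; apply npow_mono; lia).
      assert (n ^ c <= n ^ (c + 1)) by (apply npow_mono; lia).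
      replace (c + 3) with (c + 1 + 2) by lia. rewrite (Nat.pow_add_r n (c + 1)).
      set (P := n ^ (c + 1)) in *. assert (4 <= n ^ 2) by (simpl; nia). nia. }
    assert (Hp : p <= (2 * r + 9) * lg n).
    { unfold p. assert (Nat.log2 (3 * (F + 2) + 3) <= (r + 4) * S (lg n)); [|nia].
      etransitivity; [apply Nat.log2_le_mono|apply log2_pow_le].
      pose proof (npow_pos n r Hn2). rewrite (Nat.pow_add_r n r 4).
      assert (16 <= n ^ 4) by (change 16 with (2 ^ 4); now apply pow_base2). nia. }
    assert (HG : n + length gs' <= 4 * n ^ (c + r + 1)).
    { assert (n <= n ^ (c + r + 1)) by (rewrite <- (Nat.pow_1_r n) at 1; apply npow_mono; lia).
      assert (n ^ (c + r) <= n ^ (c + r + 1)) by (apply npow_mono; lia).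
      assert (length gs * F <= n ^ (c + r)) by (rewrite Nat.pow_add_r; now apply Nat.mul_le_mono).
      lia. }
    assert (Hnn : n <= n ^ (c + r + 1)) by (rewrite <- (Nat.pow_1_r n) at 1; apply npow_mono; lia).
    clearbody F p. clear F3 HF.
    set (l := lg n ^ k) in *. set (P := n ^ (c + r + 1)) in *. clearbody l P r.
    repeat apply conj; try lia; nia.
Qed.

Theorem mainTheorem3 (k : nat) (L : lang) :
  (LoopPoly (fun n => lg n ^ k)%nat (fun _ => 1%nat) L <-> AC k L) /\
  (LoopPoly (fun n => lg n ^ k)%nat (fun n => lg n) L <-> TC k L).
Proof.
  split; split.
  - apply loop_to_AC.
  - apply AC_to_loop.
  - apply loop_to_TC.
  - apply TC_to_loop.
Qed.
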